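(* The adaptive learning graph $\mathcal G$ for $\mathsf{Triangle}$ described in the context, with $|X|=x$, $|A|=a$, $|B|=b$, and using $\mathsf{Load}=\mathsf{DenseLoad}$, has complexity $$O\left(\sqrt{xn^2+(ax)^2+\left(\frac na\right)^2\left(a\cdot x^2+n\left(b^2+\left(\frac ab\right)^2\left(b+\frac{b^2}{x}\right)\right)\right)}\right).$$ In particular, taking $a=n^{3/4}$ and $b=x=\sqrt n$ leads to $Q(\mathsf{Triangle})=O(n^{5/4})$.
   Context: **Problem.** An undirected graph $G$ on vertex set $V=[n]$ is encoded by $z\in\{0,1\}^N$, $N=\binom n2$, with $z_{ij}=1$ iff $ij$ is an edge. $\mathsf{Triangle}(G)=1$ iff $G$ has a triangle. $Q(f)$ is the number of queries to the input bits needed by a quantum algorithm to evaluate $f$ with error at most $1/3$. $N_u$ is the neighborhood of $u$ in $G$, and $N_{u,v}=N_u\cap N_v$. The parameters satisfy $1\le x\le n$ and $2\le b\le a\le n$. **Learning graphs.** Let $f:Z\to\{0,1\}$, $Z\subseteq\{0,1\}^N$, $Y=f^{-1}(1)$; $z_S$ is the restriction of $z$ to $S$. A $1$-certificate for $f$ on $y\in Y$ is $I\subseteq[N]$ with $f(z)=1$ for every $z\in Z$ with $z_I=y_I$. An extended learning graph for $f$ is a rooted directed acyclic graph $(\mathcal V,\mathcal E)$ with: (i) vertex labels $\mathcal S(v)\subseteq[N]$, the root being labelled $\emptyset$, and $\mathcal S(v)=\mathcal S(u)\cup\{j\}$ for some $j\notin\mathcal S(u)$ for each edge $(u,v)$ (the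 edge loads $j$); (ii) weights $w_z^b(u,v)\ge0$ ($z\in Z$, $b\in\{0,1\}$) depending on $z$ only through $z_{\mathcal S(v)}$, with $w_x^0(u,v)=w_y^1(u,v)$ whenever $x\in Z\setminus Y$, $y\in Y$, $x_{\mathcal S(u)}=y_{\mathcal S(u)}$ and $x_j\ne y_j$, where $(u,v)$ loads $j$; (iii) for each $y\in Y$, a unit flow $p_y\ge0$ from the root, zero on edges with $w_y^1=0$, each sink of which has a label containing a $1$-certificate for $f$ on $y$. It is adaptive if $w_z^0=w_z^1$ for all $z$, and non-adaptive if moreover the weights do not depend on $z$. Put $C^0(\mathcal G,x)=\sum_ew_x^0(e)$, $C^1(\mathcal G,y)=\sum_ep_y(e)^2/w_y^1(e)$, $C^0(\mathcal G)=\max_{x\in f^{-1}(0)}C^0(\mathcal G,x)$, $C^1(\mathcal G)=\max_{y\in f^{-1}(1)}C^1(\mathcal G,y)$. The complexity of $\mathcal G$ is $\sqrt{C^0(\mathcal G)C^1(\mathcal G)}$. Edges between vertices with equal labels (empty transitions) are allowed and contribute to no complexity. **Loading.** $\mathsf{DenseLoad}_S$ is the path loading the elements of $S$ one after the other, all weights being $|S|$, with unit flow. It is used below as a single (super) edge, to be replaced by the path. **OR construction.** Given learning graphs $\mathcal G_i$ for functions $f_i$ such that every positive input of $\bigvee_if_i$ is positive for at least $k$ of the $f_i$: join a new root by empty transitions to the root of each $\mathcal G_i$ and multiply all weights in $\mathcal G_i$ by $C^1(\mathcal G_i)/k$. On a positive input the flow is split uniformly among $k$ components with $f_i=1$ and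 then follows the flow of those $\mathcal G_i$. **Johnson construction** on $k$-subsets of an $s$-element set $W$, with $r=2$, a monotone map $I$ from subsets of $W$ to subsets of $[N]$, and learning graphs $\mathcal G_{A,\lambda}$ to be used when the input restricted to $I(A)$ has been loaded and equals $\lambda$. Stage 0: for each $(k-2)$-subset $A'$ of $W$, a super edge $\mathsf{Load}_{I(A')}$ from the root to a vertex $A'$. Stages $\ell=1,2$: for each $(k-3+\ell)$-subset $A'$ and each $j\in W\setminus A'$, a super edge $\mathsf{Load}_{I(A'\cup\{j\})\setminus I(A')}$ from $A'$ to $A'\cup\{j\}$. Final stage: at each $k$-subset $A$, plug $\mathcal G_{A,z_{I(A)}}$ with weights multiplied by $C^1(\mathcal G_{A,z_{I(A)}})/\binom{s-2}{k-2}$. On a positive input with target pair $T=\{j_1,j_2\}\subseteq W$, the flow goes uniformly to the $A'$ of Stage 0 disjoint from $T$, then adds $j_1$, then $j_2$, and then follows the plugged learning graphs (of the $A\supseteq T$). In each of Stages 0, 1, 2 the weights of each super edge $e$ are multiplied by $c^1(e)/n_{\rm used}$, where $c^1(e)$ is the maximal positive complexity of $e$ for unit flow and $n_{\rm used}$ is the number of super edges of the stage carrying flow on a positive input. **The learning graph $\mathcal G$.** 1. OR over all $x$-subsets $X\subseteq V$ of learning graphs $\mathcal G_X$, all computing $\mathsf{Triangle}$ (flow uniform over all $X$). 2. $\mathcal G_X$ is the OR of $\mathcal H_X$, which detects a triangle with a vertex in $X$, and $\mathcal F_X$, which detects a triangle with no vertex in $X$ ($\mathcal F_X$ is needed only when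 there is no triangle with a vertex in $X$). $\mathcal H_X$ is the simple non-adaptive learning graph searching a vertex $t\in X$ and then a pair $uv$ forming a triangle with $t$; its negative complexity is $xn^2$. 3. $\mathcal F_X$ is the Johnson construction on $a$-subsets $A$ of $V$ with $I(A')=X\times A'$ (all pairs between $X$ and $A'$), target pair two triangle vertices, and plugged learning graphs $\mathcal F_{X,A}$. 4. $\mathcal F_{X,A}$ is the OR over $w\in V$ ($w$ is the third triangle vertex) of $\mathcal F_{X,A,w}$. 5. $\mathcal F_{X,A,w}$ is the Johnson construction on $b$-subsets $B$ of $A$ with $I(B')=\{w\}\times B'$, target pair the two other triangle vertices. 6. The learning graph plugged at $B$ is the OR, over the pairs $(u,v)$ in $\Delta(X,B,w)=\{(u,v)\in B^2: N_{u,v}\cap X=\emptyset,\ u,v\in N_w\}$ (known from the pairs already loaded), of the single-edge learning graph loading $uv$.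
   Formalization: The general bound is proved, for every fixed d>0 with a constant depending on d, when a ≤ (1−d)n and b ≤ (1−d)a; as stated it fails, e.g. for a=n, x=n/2, b≈√n, where Stage 0 alone makes the complexity of order n³ against n². *)

(* Defs.v *)
From HB Require Import structures.
From mathcomp Require Import all_boot all_order all_algebra.
From mathcomp Require Import spectral complex.
From mathcomp Require Import all_classical all_reals.
From mathcomp Require Import ereal exp.

Set Implicit Arguments.
Unset Strict Implicit.
Unset Printing Implicit Defensive.

Import Order.TTheory GRing.Theory Num.Theory.
Local Open Scope ring_scope.

Section LearningGraphs.
Variables (R : realType) (I : finType).

Definition input := {ffun I -> bool}.

(* The restriction z_S, encoded as the input that is false outside S. *)
Definition restr (S : {set I}) (z : input) : input :=
  [ffun i => (i \in S) && z i].

(* A function f : Z -> {0,1} with Z included in {0,1}^I; f z = None means that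
   z is not in Z. *)
Definition bfun := input -> option bool.

Definition bfun_on (Z val : pred input) : bfun :=
  fun z => if Z z then Some (val z) else None.

Definition certificate (f : bfun) (y : input) (S : {set I}) : Prop :=
  forall z, f z != None -> restr S z = restr S y -> f z = Some true.

(* Raw data; the axioms are collected in [learning_graph].  The function f is
   a parameter of the type because the maxima defining the complexities range
   over its negative and positive inputs. *)
Record elg (f : bfun) := Elg {
  vert : finType;
  edge : finType;
  src : edge -> vert;
  tgt : edge -> vert;
  root : vert;
  label : vert -> {set I};
  weight : bool -> input -> edge -> R;
  flow : input -> edge -> R }.

Section Notions.
Variables (f : bfun) (G : elg f).

Definition arc : rel (vert G) :=
  fun u v => [exists e : edge G, (src e == u) && (tgt e == v)].

Definition loading (e : edge G) : bool := label (src e) != label (tgt e).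

Definition loads (e : edge G) (j : I) : Prop :=
  j \notin label (src e) /\ label (tgt e) = j |: label (src e).

Definition rooted_dag : Prop :=
  [/\ injective (fun e : edge G => (src e, tgt e)),
      forall (v : vert G) (s : seq (vert G)),
        path arc v s -> last v s = v -> s = [::]
    & forall v : vert G, connect arc (root G) v].

Definition labels_ok : Prop :=
  label (root G) = finset.set0 /\
  forall e : edge G, label (src e) = label (tgt e) \/ exists j, loads e j.

Definition weights_ok : Prop :=
  [/\ forall b z (e : edge G), f z != None -> 0 <= weight b z e,
      forall b z z' (e : edge G), f z != None -> f z' != None ->
        restr (label (tgt e)) z = restr (label (tgt e)) z' ->
        weight b z e = weight b z' e
    & forall x y (e : edge G) j, f x = Some false -> f y = Some true ->
        loads e j -> restr (label (src e)) x = restr (label (src e)) y ->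
        x j <> y j -> weight false x e = weight true y e].

(* The amount of flow absorbed at v, one unit being injected at the root.
   The sinks of the flow are the vertices where it is positive. *)
Definition absorbed (y : input) (v : vert G) : R :=
  (v == root G)%:R + \sum_(e : edge G | tgt e == v) flow y e
                   - \sum_(e : edge G | src e == v) flow y e.

Definition flows_ok : Prop :=
  forall y, f y = Some true ->
  [/\ forall e : edge G, 0 <= flow y e,
      forall v : vert G, 0 <= absorbed y v,
      forall e : edge G, loading e -> weight true y e = 0 -> flow y e = 0
    & forall v : vert G, 0 < absorbed y v -> certificate f y (label v)].

Definition learning_graph : Prop :=
  [/\ rooted_dag, labels_ok, weights_ok & flows_ok].

Definition adaptive : Prop :=
  forall z (e : edge G), f z != None -> weight false z e = weight true z e.

Definition C0_at (x : input) : R :=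
  \sum_(e : edge G | loading e) weight false x e.

Definition C1_at (y : input) : R :=
  \sum_(e : edge G | loading e) flow y e ^+ 2 / weight true y e.

Definition C0 : R := \big[Num.max/0]_(x : input | f x == Some false) C0_at x.

Definition C1 : R := \big[Num.max/0]_(y : input | f y == Some true) C1_at y.

Definition complexity : R := Num.sqrt (C0 * C1).

End Notions.

Section DenseLoad.
Variables (f : bfun) (S : {set I}).

Definition dense_load : elg f := {|
  vert := 'I_(#|S|).+1;
  edge := 'I_(#|S|);
  src := fun i => widen_ord (leqnSn _) i;
  tgt := fun i => lift ord0 i;
  root := ord0;
  label := fun i => [set:: take i (enum S)];
  weight := fun _ _ _ => #|S|%:R;
  flow := fun _ _ => 1 |}.

End DenseLoad.

(* The positive complexity of DenseLoad_S for unit flow; it is 0 for the empty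
   set and 1 otherwise. *)
Definition dense_load_C1 (S : {set I}) : R :=
  \sum_(i < #|S|) 1 ^+ 2 / #|S|%:R.

Section OrConstruction.
Variables (F : bfun) (J : finType) (f : J -> bfun) (k : nat).
Variable G : forall j, elg (f j).

Definition or_select (y : input) : seq J :=
  take k (enum [pred j | f j y == Some true]).

Let or_vert : finType := option {j : J & vert (G j)}.
Let or_edge : finType := (J + {j : J & edge (G j)})%type.

Let inj j (v : vert (G j)) : or_vert :=
  Some (Tagged (fun j => vert (G j) : Type) v).

Definition or_lg : elg F := {|
  vert := or_vert;
  edge := or_edge;
  src := fun e => match e with
    | inl _ => None
    | inr e => inj (src (tagged e)) end;
  tgt := fun e => match e with
    | inl j => inj (root (G j))
    | inr e => inj (tgt (tagged e)) end;
  root := None;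
  label := fun v => if v is Some u then label (tagged u) else finset.set0;
  weight := fun b z e => match e with
    | inl _ => 0
    | inr e => C1 (G (tag e)) / k%:R * weight b z (tagged e) end;
  flow := fun y e => match e with
    | inl j => (j \in or_select y)%:R / k%:R
    | inr e => (tag e \in or_select y)%:R / k%:R * flow y (tagged e) end |}.

End OrConstruction.

Section Johnson.
Variables (F : bfun) (T : finType) (W : {set T}) (k : nat).
Variable Iof : {set T} -> {set I}.
(* An ordered target pair (j1, j2) for each positive input. *)
Variable target : input -> option (T * T).
Variable f : {set T} -> input -> bfun.
Variable G : forall A l, elg (f A l).

Definition jnode := {A : {set T} | (A \subset W) && (k - 2 <= #|A| <= k)%N}.

(* The super edges of Stage 0 are the pairs (None, A') with #|A'| = k - 2; the
   others are the pairs (Some A', A' + j). *)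
Definition sedge_ok (e : option jnode * jnode) : bool :=
  match e.1 with
  | None => #|val e.2| == (k - 2)%N
  | Some A => [exists j in W :\: val A, val e.2 == j |: val A]
  end.
Definition sedge := {e : option jnode * jnode | sedge_ok e}.

Definition sedge_src (e : sedge) : option jnode := (val e).1.
Definition sedge_tgt (e : sedge) : jnode := (val e).2.

Definition jlabel (v : option jnode) : {set I} :=
  if v is Some A then Iof (val A) else finset.set0.

Definition sload (e : sedge) : {set I} :=
  Iof (val (sedge_tgt e)) :\: jlabel (sedge_src e).

(* In each stage, the super edges carrying flow are indexed by the
   (k-2)-subsets of W that are disjoint from the target pair. *)
Definition n_used : R := 'C(#|W| - 2, k - 2)%:R.

Definition carries (t : T * T) (e : sedge) : bool :=
  let B := val (sedge_tgt e) in
  match sedge_src e with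
  | None => (t.1 \notin B) && (t.2 \notin B)
  | Some A0 => let A := val A0 in
      if #|A| == (k - 2)%N
      then [&& t.1 \notin A, t.2 \notin A & B == t.1 |: A]
      else [&& t.1 \in A, t.2 \notin A & B == t.2 |: A]
  end.

(* The graph plugged at A for the value l of the input restricted to Iof A. *)
Definition plug := {p : jnode * input |
  (#|val p.1| == k) && (restr (Iof (val p.1)) p.2 == p.2)}.

Definition plug_set (p : plug) : {set T} := val (val p).1.
Definition plug_val (p : plug) : input := (val p).2.
Definition plug_lg (p : plug) := G (plug_set p) (plug_val p).

Definition reads (p : plug) (z : input) : bool :=
  restr (Iof (plug_set p)) z == plug_val p.

(* The path replacing a super edge e with #|sload e| = m has m edges and m - 1
   inner vertices if 0 < m, and is a single empty transition if m = 0. *)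
Definition sinner : finType := {e : sedge & 'I_(#|sload e|.-1)}.
Definition spath : finType := {e : sedge & 'I_(#|sload e|.-1.+1)}.

Let j_vert : finType :=
  (option jnode + (sinner + {p : plug & vert (plug_lg p)}))%type.
Let j_edge : finType :=
  (spath + (plug + {p : plug & edge (plug_lg p)}))%type.

Let j_inner e (i : 'I_(#|sload e|.-1)) : j_vert :=
  inr (inl (Tagged (fun e : sedge => 'I_(#|sload e|.-1) : Type) i)).
Let j_plug p (v : vert (plug_lg p)) : j_vert :=
  inr (inr (Tagged (fun p : plug => vert (plug_lg p) : Type) v)).

(* The plugged graphs are built with root label empty; below A their labels are
   enlarged by Iof A, so that an edge loading an element of Iof A becomes an
   empty transition.  All values l are plugged, and the branch of l has weight 0
   on the inputs that do not read l. *)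
Definition johnson : elg F := {|
  vert := j_vert;
  edge := j_edge;
  src := fun e => match e with
    | inl e => if unlift ord0 (tagged e) is Some i then j_inner i
               else inl (sedge_src (tag e))
    | inr (inl p) => inl (Some (val p).1)
    | inr (inr e) => j_plug (src (tagged e)) end;
  tgt := fun e => match e with
    | inl e => if unlift ord_max (tagged e) is Some i then j_inner i
               else inl (Some (sedge_tgt (tag e)))
    | inr (inl p) => j_plug (root (plug_lg p))
    | inr (inr e) => j_plug (tgt (tagged e)) end;
  root := inl None;
  label := fun v => match v with
    | inl A => jlabel A
    | inr (inl i) => jlabel (sedge_src (tag i))
        :|: [set:: take (tagged i).+1 (enum (sload (tag i)))]
    | inr (inr u) => Iof (plug_set (tag u)) :|: label (tagged u) end;
  weight := fun b z e => match e with
    | inl e => let S := sload (tag e) in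
        dense_load_C1 S / n_used * #|S|%:R
    | inr (inl _) => 0
    | inr (inr e) => let p := tag e in
        (reads p z)%:R * (C1 (plug_lg p) / n_used * weight b z (tagged e)) end;
  flow := fun y e => if target y is Some t then
    let at_plug p := [&& t.1 \in plug_set p, t.2 \in plug_set p & reads p y] in
    match e with
    | inl e => (carries t (tag e))%:R / n_used
    | inr (inl p) => (at_plug p)%:R / n_used
    | inr (inr e) => (at_plug (tag e))%:R / n_used * flow y (tagged e)
    end else 0 |}.

End Johnson.

End LearningGraphs.

Section Triangle.
Variables (R : realType) (n : nat).

Definition upair := {e : {set 'I_n} | #|e| == 2%N}.
Definition graph := input upair.
Implicit Types (z l : graph) (u v w t : 'I_n) (X A B : {set 'I_n}) (e : upair).

Definition adj z u v : bool := [exists e, (val e == [set u; v]) && z e].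
Definition nbh z u : {set 'I_n} := [set v | adj z u v].
Definition nbh2 z u v : {set 'I_n} := nbh z u :&: nbh z v.

Definition is_triangle z u v w : bool := [&& adj z u v, adj z v w & adj z u w].

Definition triangle : bfun upair :=
  fun z => Some [exists u, exists v, exists w, is_triangle z u v w].

Definition touches X z : bool :=
  [exists t in X, exists u, exists v, is_triangle z t u v].

Definition between X A : {set upair} :=
  [set e | [exists u in X, exists v in A, val e == [set u; v]]].

Definition fH X : bfun upair := fun z => Some (touches X z).
Definition fH_vertex t : bfun upair :=
  fun z => Some [exists u, exists v, is_triangle z t u v].
Definition tri_pairs t e : {set upair} :=
  [set e' : upair | val e' \subset t |: val e].
Definition fH_triangle t e : bfun upair :=
  fun z => Some [forall e' in tri_pairs t e, z e'].

(* The search for t and then uv is an OR over t of ORs over uv, whose components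
   load the three pairs of the triangle tuv. *)
Definition H_vertex t : elg R (fH_vertex t) :=
  or_lg (fH_vertex t) (J := {e : upair | t \notin val e}) 1
    (fun p => dense_load R (fH_triangle t (val p)) (tri_pairs t (val p))).

Definition H_lg X : elg R (fH X) :=
  or_lg (fH X) (J := {t : 'I_n | t \in X}) 1 (fun p => H_vertex (val p)).

(* The function is restricted to the inputs having no triangle with a vertex
   in X, and, inside the Johnson constructions, to those which agree with the
   values l and m already loaded. *)
Section NoVertexInX.
Variables (a b : nat) (X : {set 'I_n}).

Definition domX : pred graph := fun z => ~~ touches X z.
Definition domXA A l : pred graph :=
  fun z => domX z && (restr (between X A) z == l).
Definition domXAB A l w B (m : graph) : pred graph :=
  fun z => domXA A l z && (restr (between [set w] B) z == m).

Definition fF : bfun upair :=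
  bfun_on domX (fun z => [exists u, exists v, exists w, is_triangle z u v w]).
Definition fFA A l : bfun upair := bfun_on (domXA A l) (fun z =>
  [exists w, exists u in A, exists v in A, is_triangle z u v w]).
Definition fFAw A l w : bfun upair := bfun_on (domXA A l) (fun z =>
  [exists u in A, exists v in A, is_triangle z u v w]).
Definition fFAwB A l w B m : bfun upair := bfun_on (domXAB A l w B m) (fun z =>
  [exists u in B, exists v in B, is_triangle z u v w]).
Definition fedge A l w B m e : bfun upair :=
  bfun_on (domXAB A l w B m) (fun z => z e).

(* Delta only depends on the pairs in X * B and {w} * B. *)
Definition Delta z B w : {set upair} :=
  [set e | [exists u in B, exists v in B,
    [&& val e == [set u; v], nbh2 z u v :&: X == finset.set0,
        u \in nbh z w & v \in nbh z w]]].

Definition known l (m : graph) : graph := [ffun e => l e || m e].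

Definition FB_lg A l w B m : elg R (fFAwB A l w B m) :=
  or_lg (fFAwB A l w B m) (J := {e : upair | e \in Delta (known l m) B w}) 1
    (fun p => dense_load R (fedge A l w B m (val p)) [set val p]).

Definition FAw_lg A l w : elg R (fFAw A l w) :=
  johnson (fFAw A l w) A b (fun B => between [set w] B)
    (fun y => [pick t : 'I_n * 'I_n |
                [&& t.1 \in A, t.2 \in A & is_triangle y t.1 t.2 w]])
    (fun B m => FB_lg A l w B m).

Definition FA_lg A l : elg R (fFA A l) :=
  or_lg (fFA A l) 1 (fun w => FAw_lg A l w).

Definition F_lg : elg R fF :=
  johnson fF [set: 'I_n] a (fun A => between X A)
    (fun y => [pick t : 'I_n * 'I_n | [exists w, is_triangle y t.1 t.2 w]])
    (fun A l => FA_lg A l).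

(* true stands for H_X and false for F_X *)
Definition GX_lg : elg R triangle :=
  or_lg triangle (f := fun c : bool => if c then fH X else fF) 1
    (fun c => if c return elg R (if c then fH X else fF)
              then H_lg X else F_lg).

End NoVertexInX.

Definition G_lg (x a b : nat) : elg R triangle :=
  or_lg triangle (J := {X : {set 'I_n} | #|X| == x}) 'C(n, x)
    (fun p => GX_lg a b (val p)).

End Triangle.

Arguments triangle n z : clear implicits.

Section QueryComplexity.
Variables (R : realType) (I : finType).

(* The computational basis: a query register (None is the null query), an
   answer bit, and a finite workspace K. *)
Definition basis (K : finType) : finType := (option I * bool * K)%type.

Definition query (K : finType) (z : input I) (s : basis K) : basis K :=
  let: (i, c, k) := s in (i, c (+) (if i is Some j then z j else false), k).

Definition oracle (K : finType) (z : input I) : 'M[R[i]]_#|basis K| :=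
  \matrix_(s, t) (enum_val s == query z (enum_val t))%:R.

Record qalg (q : nat) := QAlg {
  qwork : finType;
  qinit : 'I_#|basis qwork|;
  qunit : nat -> 'M[R[i]]_#|basis qwork|;
  qunit_unitary : forall t, qunit t \is unitarymx;
  qout : basis qwork -> bool }.

Fixpoint qstate q (P : qalg q) (z : input I) (t : nat) :
    'cV[R[i]]_#|basis (qwork P)| :=
  match t with
  | 0%N => qunit P 0 *m delta_mx (qinit P) 0
  | t'.+1 => qunit P t *m (oracle (qwork P) z *m qstate P z t')
  end.

Definition qprob q (P : qalg q) (z : input I) (c : bool) : R[i] :=
  \sum_(s : 'I_#|basis (qwork P)| | qout (enum_val s) == c)
     `|qstate P z q s 0| ^+ 2.

Definition computes (f : bfun I) q (P : qalg q) : Prop :=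
  forall z c, f z = Some c -> 2%:R / 3%:R <= qprob P z c.

Definition Q (f : bfun I) : \bar R :=
  ereal_inf [set (q%:R)%:E | q in [set q | exists P : qalg q, computes f P]]%classic.

End QueryComplexity.

(* Main.v *)
Require Import Defs.
From mathcomp Require Import all_boot all_order all_algebra.
From mathcomp Require Import spectral complex.
From mathcomp Require Import all_classical all_reals.
From mathcomp Require Import ereal exp zify ring lra.

(* The learning graph of the theorem is assembled from path graphs by the OR and
   Johnson constructions, so everything reduces to how these two constructions
   act on validity, on the positive complexity (at most 1 for an OR, at most 4
   for a Johnson graph) and on the negative complexity.  The negative complexity
   of [G_lg] is an average over X of sums over A, w and B.  Its only delicate
   term is the average of |Delta(X, B, w)|: a pair e lies in B for a fixed
   fraction of the nested sets B, A, and with N the common neighbourhood of e the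
   expectation over X of |N| [N and X are disjoint] is at most n / x.

   The query bound comes from the adversary vectors of a learning graph, whose
   pairing is 1 because the unit flow crosses the cut formed by the vertices at
   which the two inputs agree.  The quantum algorithm alternates the reflection
   about the span of the positive vectors with an input dependent reflection made
   of two queries, for a number of steps held in uniform superposition, and
   accepts when the step counter is found in its initial state.  This averages
   the powers of the product U of the reflections.  On a positive input the
   initial state is close to a fixed vector of U.  On a negative input it has the
   form (v - U v) / 2, so that the average telescopes. *)

Set Implicit Arguments.
Unset Strict Implicit.
Unset Printing Implicit Defensive.

Import fintype boot.finset.
Import Order.TTheory GRing.Theory Num.Theory.
Local Open Scope ring_scope.

(** * Real vectors, reflections and ergodic averages *)

Section RealVectors.
Variable R : realType.

(** Each construction multiplies a component by the component's own positive complexity, so the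
    positive complexity does not build up along the nesting: it falls back to at most 1 at every OR,
    and the whole estimate is one of [C0]. The obstacle there is Stage 0 of a Johnson graph. Its
    flow avoids the target pair, so its ['C(s, k - 2)] super edges have weights normalised by
    ['C(s - 2, k - 2)]. The quotient s(s-1)/((s-k+2)(s-k+1)) is of order s^2 when k is close to s,
    but it is at most 1/d^2 when k <= (1-d)s. This is the origin of [d] and of the dependence of the
    constant on it. *)

Definition dotv m (u v : 'cV[R]_m) : R := (u^T *m v) 0 0.

Lemma dotvE m (u v : 'cV[R]_m) : dotv u v = \sum_i u i 0 * v i 0.
Proof. by rewrite /dotv mxE; apply: eq_bigr => i _; rewrite mxE. Qed.

Lemma dotvC m (u v : 'cV[R]_m) : dotv u v = dotv v u.
Proof. by rewrite !dotvE; apply: eq_bigr => i _; rewrite mulrC. Qed.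

Lemma dotvDr m (u v w : 'cV[R]_m) : dotv u (v + w) = dotv u v + dotv u w.
Proof. by rewrite /dotv mulmxDr mxE. Qed.

Lemma dotvZr m a (u v : 'cV[R]_m) : dotv u (a *: v) = a * dotv u v.
Proof. by rewrite /dotv -scalemxAr mxE. Qed.

Lemma dotvBr m (u v w : 'cV[R]_m) : dotv u (v - w) = dotv u v - dotv u w.
Proof. by rewrite dotvDr -scaleN1r dotvZr mulN1r. Qed.

Lemma dotvDl m (u v w : 'cV[R]_m) : dotv (v + w) u = dotv v u + dotv w u.
Proof. by rewrite dotvC dotvDr !(dotvC u). Qed.

Lemma dotvBl m (u v w : 'cV[R]_m) : dotv (v - w) u = dotv v u - dotv w u.
Proof. by rewrite dotvC dotvBr !(dotvC u). Qed.

Lemma dotvZl m a (u v : 'cV[R]_m) : dotv (a *: u) v = a * dotv u v.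
Proof. by rewrite dotvC dotvZr dotvC. Qed.

Lemma dotv_sumr m (J : finType) (u : 'cV[R]_m) (v : J -> 'cV[R]_m) :
  dotv u (\sum_j v j) = \sum_j dotv u (v j).
Proof.
rewrite /dotv mulmx_sumr.
by elim/big_ind2: _ => [|x a y b <- <-|//]; rewrite mxE.
Qed.

Lemma dotv_mulmx m n (A : 'M[R]_(n, m)) u v :
  dotv (A *m u) v = dotv u (A^T *m v).
Proof. by rewrite /dotv trmx_mul mulmxA. Qed.

Lemma dotv_ge0 m (u : 'cV[R]_m) : 0 <= dotv u u.
Proof. by rewrite dotvE; apply: sumr_ge0 => i _; rewrite -expr2 sqr_ge0. Qed.

Lemma dotv_eq0 m (u : 'cV[R]_m) : (dotv u u == 0) = (u == 0).
Proof.
apply/idP/eqP => [|->]; last by rewrite /dotv mulmx0 mxE.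
rewrite dotvE psumr_eq0 => [|i _]; last by rewrite -expr2 sqr_ge0.
move=> /allP h; apply/matrixP => i j; rewrite ord1 mxE.
by have := h i (mem_index_enum _); rewrite mulf_eq0 orbb => /eqP.
Qed.

(** The norm introduced first expands to [dotv v v] times the gap of the inequality, so only [v = 0]
    needs separate treatment. *)
Lemma cauchy_schwarz m (u v : 'cV[R]_m) :
  dotv u v ^+ 2 <= dotv u u * dotv v v.
Proof.
have := dotv_ge0 (dotv v v *: u - dotv u v *: v).
rewrite !(dotvBl, dotvBr, dotvZl, dotvZr) (dotvC v u).
have := dotv_ge0 u; have := dotv_ge0 v.
have [/eqP|v0 _ _ h] := eqVneq (dotv v v) 0.
  rewrite dotv_eq0 => /eqP ->; rewrite /dotv !mulmx0 mxE => _ _ _.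
  by rewrite expr0n mulr0.
have vp : 0 < dotv v v by rewrite lt_neqAle eq_sym v0 dotv_ge0.
rewrite -subr_ge0 -(pmulr_rge0 _ vp); apply: le_trans h _.
by rewrite le_eqVlt; apply/orP; left; apply/eqP; ring.
Qed.

Lemma orth_dotv m (U : 'M[R]_m) u v :
  U^T *m U = 1%:M -> dotv (U *m u) (U *m v) = dotv u v.
Proof. by move=> h; rewrite dotv_mulmx mulmxA h mul1mx. Qed.

(* Gram-Schmidt: each step adds the projector onto the component of the new
   vector orthogonal to the previous ones. *)
Lemma ortho_proj m (s : seq 'cV[R]_m) : exists P : 'M[R]_m,
  [/\ P^T = P, P *m P = P, forall v, v \in s -> P *m v = v
    & forall w, (forall v, v \in s -> dotv v w = 0) -> P *m w = 0].
Proof.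
elim: s => [|v s [P [Ps Pi Pv Pw]]].
  exists 0; split; rewrite ?trmx0 ?mulmx0 // => w _; exact: mul0mx.
pose r := v - P *m v.
have Pr : P *m r = 0 by rewrite mulmxBr mulmxA Pi subrr.
have rP : r^T *m P = 0 by rewrite -[P]Ps -trmx_mul Pr trmx0.
have rw w : (forall u, u \in v :: s -> dotv u w = 0) -> r^T *m w = 0.
  move=> h; rewrite linearB /= mulmxBl trmx_mul Ps -mulmxA Pw ?mulmx0 ?subr0.
    by apply/matrixP => i j; rewrite !ord1 [RHS]mxE; apply: h; rewrite mem_head.
  by move=> u us; apply: h; rewrite in_cons us orbT.
have [r0|r0] := eqVneq r 0.
  exists P; split=> // [u|w h].
    rewrite in_cons => /predU1P[->|/Pv //]; apply/esym/eqP.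
    by rewrite -subr_eq0 -/r r0.
  by apply: Pw => u us; apply: h; rewrite in_cons us orbT.
pose c := dotv r r; have c0 : c != 0 by rewrite dotv_eq0.
have rr : r^T *m r = c%:M by apply/matrixP => i j; rewrite !ord1 [RHS]mxE eqxx.
exists (P + c^-1 *: (r *m r^T)); split.
- by rewrite linearD linearZ /= trmx_mul trmxK Ps.
- have h1 : P *m (r *m r^T) = 0 by rewrite mulmxA Pr mul0mx.
  have h2 : r *m r^T *m P = 0 by rewrite -mulmxA rP mulmx0.
  have h3 : r *m r^T *m (r *m r^T) = c *: (r *m r^T).
    by rewrite mulmxA -(mulmxA r) rr mul_mx_scalar -scalemxAl.
  rewrite mulmxDl !mulmxDr Pi -!scalemxAl -!scalemxAr h1 h2 h3 !scaler0 addr0 add0r.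
  by rewrite !scalerA; congr (_ + _ *: _); field.
- move=> u; rewrite in_cons => /predU1P[->|us].
    have vE : v = r + P *m v by rewrite subrK.
    clearbody r; rewrite [in LHS]vE.
    rewrite mulmxDl -scalemxAl -mulmxA !mulmxDr Pr add0r (mulmxA P) Pi.
    rewrite (mulmxA r^T) rP mul0mx mulmx0 addr0 rr mul_mx_scalar scalerA.
    by rewrite mulVf // scale1r [RHS]vE addrC.
  rewrite mulmxDl Pv // -scalemxAl -mulmxA -[u in r^T *m u]Pv //.
  by rewrite (mulmxA r^T) rP mul0mx mulmx0 scaler0 addr0.
- move=> w h; rewrite mulmxDl -scalemxAl -mulmxA rw // mulmx0 scaler0 addr0.
  by apply: Pw => u us; apply: h; rewrite in_cons us orbT.
Qed.

Definition refl m (P : 'M[R]_m) : 'M[R]_m := 2 *: P - 1%:M.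

Lemma refl_sym m (P : 'M[R]_m) : P^T = P -> (refl P)^T = refl P.
Proof. by move=> h; rewrite /refl linearB linearZ /= h trmx1. Qed.

Lemma refl_invol m (P : 'M[R]_m) : P *m P = P -> refl P *m refl P = 1%:M.
Proof.
move=> h; rewrite /refl mulmxBl mul1mx mulmxBr mulmx1 -scalemxAl -scalemxAr h.
rewrite scalerA opprB addrA -[2 * 2]/(2 * 2 : R).
have -> : (2 * 2 : R) = 2 + 2 by ring.
by rewrite scalerDl addrK [_ + 1%:M]addrC addrK.
Qed.

Lemma refl_fix m (P : 'M[R]_m) (v : 'cV[R]_m) : P *m v = v -> refl P *m v = v.
Proof.
move=> h; rewrite /refl mulmxBl mul1mx -scalemxAl h.
by rewrite (_ : 2 = 1 + 1 :> R) // scalerDl scale1r addrK.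
Qed.

Lemma refl_neg m (P : 'M[R]_m) (v : 'cV[R]_m) : P *m v = 0 -> refl P *m v = - v.
Proof. by move=> h; rewrite /refl mulmxBl mul1mx -scalemxAl h scaler0 sub0r. Qed.

(** * Averages of the powers of an orthogonal matrix *)

Section ErgodicAverage.
Variables (m : nat) (U : 'M[R]_m).
Hypothesis UU : U^T *m U = 1%:M.

Definition ergavg T (v : 'cV[R]_m) : 'cV[R]_m :=
  T%:R^-1 *: \sum_(t < T) iter t (mulmx U) v.

(** Every power of [U] preserves the pairing with a fixed vector, so the average has the same
    pairing as [v], and Cauchy-Schwarz bounds its norm from below. *)
Lemma ergavg_fixed T (phi v : 'cV[R]_m) : (0 < T)%N -> U *m phi = phi ->
  dotv phi v ^+ 2 <= dotv phi phi * dotv (ergavg T v) (ergavg T v).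
Proof.
move=> T0 fix_phi; have <- : dotv phi (ergavg T v) = dotv phi v.
  rewrite dotvZr dotv_sumr (eq_bigr (fun=> dotv phi v)) => [|t _].
    rewrite sumr_const card_ord -[dotv _ _ *+ _]mulr_natl mulrA mulVf ?mul1r //.
    by rewrite pnatr_eq0 -lt0n.
  elim: {t}(t : nat) => //= t <-.
  by rewrite -{1}fix_phi orth_dotv.
exact: cauchy_schwarz.
Qed.

(** The sum telescopes to half the difference of [v] and its last iterate [w]. Two vectors of equal
    norm differ by at most twice that norm, and the half absorbs the 2. *)
Lemma ergavg_coboundary T (v : 'cV[R]_m) : (0 < T)%N ->
  dotv (ergavg T (2^-1 *: (v - U *m v))) (ergavg T (2^-1 *: (v - U *m v)))
    <= dotv v v / T%:R ^+ 2.
Proof.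
move=> T0; set w := iter T (mulmx U) v.
have -> : ergavg T (2^-1 *: (v - U *m v)) = (T%:R^-1 * 2^-1) *: (v - w).
  rewrite /ergavg -scalerA; congr (_ *: _).
  rewrite /w; elim: (T) => [|t IH].
    by rewrite big_ord0 subrr scaler0.
  rewrite big_ord_recr /= IH.
  have -> : iter t (mulmx U) (2^-1 *: (v - U *m v)) =
            2^-1 *: (iter t (mulmx U) v - U *m iter t (mulmx U) v).
    elim: (t) => //= k ->; rewrite -scalemxAr mulmxBr //.
  by rewrite -scalerDr addrA subrK.
have ww : dotv w w = dotv v v.
  by rewrite /w; elim: (T) => //= t IH; rewrite orth_dotv.
rewrite dotvZl dotvZr mulrA -expr2 exprMn exprVn -mulrA [X in _ <= X]mulrC.
rewrite ler_wpM2l ?invr_ge0 ?exprn_ge0 ?ler0n //.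
rewrite !(dotvBl, dotvBr); have := dotv_ge0 (v + w).
rewrite !(dotvDl, dotvDr) ww (dotvC w v).
have -> : 2^-1 ^+ 2 = 4^-1 :> R by field.
  lra.
Qed.

End ErgodicAverage.

(* With [P2 *m w = psi] and [P1 *m w = 0], the vector [v = R2 w] satisfies
   [psi = (v - U v) / 2], so the average telescopes; this replaces the
   effective spectral gap lemma. *)
Lemma two_reflections_negative m (P1 P2 : 'M[R]_m) (w psi : 'cV[R]_m) T :
  (0 < T)%N ->
  P1^T = P1 -> P1 *m P1 = P1 -> P2^T = P2 -> P2 *m P2 = P2 ->
  P1 *m w = 0 -> P2 *m w = psi ->
  dotv (ergavg (refl P1 *m refl P2) T psi) (ergavg (refl P1 *m refl P2) T psi)
    <= dotv w w / T%:R ^+ 2.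
Proof.
move=> T0 s1 i1 s2 i2 h1 h2; set U := refl P1 *m refl P2.
have UU : U^T *m U = 1%:M.
  by rewrite trmx_mul !refl_sym // mulmxA -(mulmxA (refl P2)) refl_invol // mulmx1 refl_invol.
pose v := refl P2 *m w.
have Uv : U *m v = - w.
  by rewrite -mulmxA (mulmxA (refl P2)) refl_invol // mul1mx refl_neg.
have -> : psi = 2^-1 *: (v - U *m v).
  rewrite Uv /v /refl mulmxBl mul1mx opprK subrK -scalemxAl scalerA mulVf //.
  by rewrite scale1r h2.
have <- : dotv v v = dotv w w by rewrite orth_dotv // refl_sym // refl_invol.
exact: ergavg_coboundary.
Qed.

End RealVectors.

(** * Quantum algorithms with real amplitudes *)

Section Blocks.
Variables (R : realType) (N m T : nat).
Variables (ix : 'I_N -> 'I_m) (tx : 'I_N -> 'I_T).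
Hypothesis ixtx_bij : bijective (fun i => (ix i, tx i)).

Lemma big_block (F : 'I_m -> 'I_T -> R) :
  \sum_i F (ix i) (tx i) = \sum_j \sum_t F j t.
Proof. by rewrite pair_big /= [RHS](reindex _ (onW_bij _ ixtx_bij)). Qed.

(** [ix] and [tx] present the index set as the product of a work register and a counter. This matrix
    acts on the work register under control of the counter; [ctrl_mx] is [W] on the counter tensored
    with the identity. *)
Definition block_mx_of (A : 'I_T -> 'M[R]_m) : 'M[R]_N :=
  \matrix_(i, j) ((tx i == tx j)%:R * A (tx i) (ix i) (ix j)).
Definition block_col (phi : 'I_T -> 'cV[R]_m) : 'cV[R]_N :=
  \col_i phi (tx i) (ix i) 0.
Definition ctrl_mx (W : 'M[R]_T) : 'M[R]_N :=
  \matrix_(i, j) ((ix i == ix j)%:R * W (tx i) (tx j)).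

Lemma eq_block_index i j : (i == j) = (ix i == ix j) && (tx i == tx j).
Proof.
apply/eqP/andP => [->|[/eqP h1 /eqP h2]]; first by [].
by apply: (bij_inj ixtx_bij); rewrite h1 h2.
Qed.

Lemma eq_block_col phi psi : phi =1 psi -> block_col phi = block_col psi.
Proof. by move=> h; apply/matrixP => i j; rewrite !mxE h. Qed.

Lemma sum_pick (J : finType) (j : J) (F : J -> R) :
  \sum_k (j == k)%:R * F k = F j.
Proof.
rewrite (bigD1 j) //= eqxx mul1r big1 ?addr0 // => k /negPf.
by rewrite eq_sym => ->; rewrite mul0r.
Qed.

Lemma mul_blocks_col A phi :
  block_mx_of A *m block_col phi = block_col (fun t => A t *m phi t).
Proof.
apply/matrixP => i j; rewrite !mxE.
rewrite (eq_bigr (fun k => (tx i == tx k)%:R * (A (tx i) (ix i) (ix k) *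
  phi (tx k) (ix k) 0))) => [|k _]; last by rewrite !mxE mulrA.
rewrite (big_block (fun a t => (tx i == t)%:R * (A (tx i) (ix i) a * phi t a 0))).
by rewrite exchange_big (eq_bigr _ (fun t _ => esym (mulr_sumr _ _ _ _))) sum_pick.
Qed.

Lemma mul_ctrl_col W phi :
  ctrl_mx W *m block_col phi = block_col (fun t => \sum_s W t s *: phi s).
Proof.
apply/matrixP => i j; rewrite !mxE summxE.
rewrite (eq_bigr (fun k => (ix i == ix k)%:R * (W (tx i) (tx k) *
  phi (tx k) (ix k) 0))) => [|k _]; last by rewrite !mxE mulrA.
rewrite (big_block (fun a t => (ix i == a)%:R * (W (tx i) t * phi t a 0))).
rewrite (eq_bigr _ (fun t _ => esym (mulr_sumr _ _ _ _))) sum_pick.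
by apply: eq_bigr => t _; rewrite mxE.
Qed.

Lemma block_mx_orth A : (forall t, A t *m (A t)^T = 1%:M) ->
  block_mx_of A *m (block_mx_of A)^T = 1%:M.
Proof.
move=> h; apply/matrixP => i j; rewrite !mxE eq_block_index.
rewrite (eq_bigr (fun k => (tx i == tx k)%:R * ((tx j == tx k)%:R *
   (A (tx i) (ix i) (ix k) * A (tx j) (ix j) (ix k))))) => [|k _].
  rewrite (big_block (fun a t => (tx i == t)%:R * ((tx j == t)%:R *
     (A (tx i) (ix i) a * A (tx j) (ix j) a)))).
  rewrite exchange_big (eq_bigr _ (fun t _ => esym (mulr_sumr _ _ _ _))) sum_pick.
  rewrite -mulr_sumr eq_sym; have [e|] := eqVneq (tx i) (tx j); last first.
    by rewrite mul0r andbF.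
  rewrite mul1r andbT e; have /matrixP/(_ (ix i) (ix j)) := h (tx j).
  by rewrite !mxE => <-; apply: eq_bigr => a _; rewrite mxE.
by rewrite !mxE; ring.
Qed.

Lemma ctrl_mx_orth W : W *m W^T = 1%:M -> ctrl_mx W *m (ctrl_mx W)^T = 1%:M.
Proof.
move=> h; apply/matrixP => i j; rewrite !mxE eq_block_index.
rewrite (eq_bigr (fun k => (ix i == ix k)%:R * ((ix j == ix k)%:R *
   (W (tx i) (tx k) * W (tx j) (tx k))))) => [|k _].
  rewrite (big_block (fun a t => (ix i == a)%:R * ((ix j == a)%:R *
     (W (tx i) t * W (tx j) t)))).
  rewrite (eq_bigr _ (fun t _ => esym (mulr_sumr _ _ _ _))) sum_pick.
  rewrite -mulr_sumr eq_sym; have [e|] := eqVneq (ix i) (ix j); last first.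
    by rewrite mul0r.
  rewrite mul1r andTb; have /matrixP/(_ (tx i) (tx j)) := h.
  by rewrite !mxE => <-; apply: eq_bigr => a _; rewrite mxE.
by rewrite !mxE; ring.
Qed.

End Blocks.

(** The reflection about [e + u] exchanges the unit vectors [e] (counter at 0) and [u] (uniform
    counter). Being symmetric, it serves both to prepare the uniform counter and to test for it. *)
Lemma uniform_reflection (R : realType) T : exists W : 'M[R]_T.+1,
  [/\ W^T = W, W *m W = 1%:M & forall t, W t 0 = (Num.sqrt T.+1%:R)^-1].
Proof.
pose c : R := (Num.sqrt T.+1%:R)^-1.
have cc : c * c * T.+1%:R = 1.
  rewrite -expr2 exprVn sqr_sqrtr ?ler0n // mulVf // pnatr_eq0 //.
pose e : 'cV[R]_T.+1 := delta_mx 0 0; pose u : 'cV[R]_T.+1 := const_mx c.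
have [P [Ps Pi Pv Pw]] := ortho_proj [:: e + u].
have eu : refl P *m (e + u) = e + u by apply/refl_fix/Pv/mem_head.
have ee : dotv e e = 1.
  rewrite dotvE (bigD1 0) //= big1 => [|i i0]; first by rewrite !mxE !eqxx mul1r addr0.
  by rewrite !mxE (negPf i0) mul0r.
have uu : dotv u u = 1.
  rewrite dotvE (eq_bigr (fun=> c * c)) => [|i _]; last by rewrite !mxE.
  by rewrite sumr_const card_ord -[_ *+ _]mulr_natr cc.
have eu' : refl P *m (e - u) = - (e - u).
  apply/refl_neg/Pw => v; rewrite inE => /eqP ->.
  by rewrite dotvBr !dotvDl ee uu (dotvC u); ring.
exists (refl P); split; [exact: refl_sym | exact: refl_invol | move=> t].
have eE : e = 2^-1 *: ((e + u) + (e - u)).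
  by apply/matrixP => i j; rewrite !mxE; field.
have : refl P *m e = u.
  rewrite {1}eE -scalemxAr mulmxDr eu eu'.
  by apply/matrixP => i j; rewrite !mxE; field.
by rewrite -colE => /matrixP/(_ t 0); rewrite !mxE.
Qed.

Section RealAlgorithm.
Variables (R : realType) (I K : finType).

Definition roracle (z : input I) : 'M[R]_#|Defs.basis I K| :=
  \matrix_(s, t) (enum_val s == query z (enum_val t))%:R.

Lemma queryK z : involutive (@query I K z).
Proof. by move=> [[i c] k] /=; rewrite addbK. Qed.

Lemma roracle_sym z : (roracle z)^T = roracle z.
Proof.
apply/matrixP => i j; rewrite !mxE; congr (_ %:R).
by congr nat_of_bool; apply/eqP/eqP => ->; rewrite queryK.
Qed.

Lemma roracle_invol z : roracle z *m roracle z = 1%:M.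
Proof.
apply/matrixP => i j; rewrite !mxE (bigD1 (enum_rank (query z (enum_val j)))) //=.
rewrite !mxE enum_rankK queryK eqxx mulr1 big1 => [|k kj].
  by rewrite addr0 (inj_eq enum_val_inj).
rewrite !mxE [_ == query z (enum_val j)]negbTE ?mulr0 //.
by apply: contraNN kj => /eqP <-; rewrite enum_valK.
Qed.

Variables (q : nat) (s0 : 'I_#|Defs.basis I K|) (V : nat -> 'M[R]_#|Defs.basis I K|).
Hypothesis V_orth : forall t, V t *m (V t)^T = 1%:M.
Variable out : Defs.basis I K -> bool.

Fixpoint rstate (z : input I) (t : nat) : 'cV[R]_#|Defs.basis I K| :=
  match t with
  | 0%N => V 0 *m delta_mx s0 0
  | t'.+1 => V t *m (roracle z *m rstate z t')
  end.

Lemma rstate_unit z t : dotv (rstate z t) (rstate z t) = 1.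
Proof.
have VV k : (V k)^T *m V k = 1%:M by apply: mulmx1C.
elim: t => [|t IH] /=; rewrite orth_dotv //.
  rewrite dotvE (bigD1 s0) //= big1 => [|i i0]; last by rewrite !mxE (negPf i0) mul0r.
  by rewrite !mxE !eqxx mul1r addr0.
by rewrite orth_dotv // roracle_sym roracle_invol.
Qed.

Local Notation toC := (map_mx (real_complex R)).

Fact real_unitary t : toC (V t) \is unitarymx.
Proof.
apply/unitarymxP; rewrite [X in _ *m X](_ : _ = toC (V t)^T); last first.
  by apply/matrixP => i j; rewrite !mxE; exact: conjc_real.
by rewrite -map_mxM V_orth map_mx1.
Qed.

Definition real_qalg : qalg R I q := QAlg q s0 real_unitary out.

Lemma qstate_real z t : qstate real_qalg z t = toC (rstate z t).
Proof.
elim: t => [|t IH] /=; first by rewrite map_mxM map_delta_mx.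
rewrite IH !map_mxM; congr (_ *m (_ *m _)).
by apply/matrixP => i j; rewrite !mxE rmorph_nat.
Qed.

Lemma qprob_real z c : qprob real_qalg z c =
  real_complex R (\sum_(s | out (enum_val s) == c) rstate z q s 0 ^+ 2).
Proof.
rewrite /qprob rmorph_sum; apply: eq_bigr => s _.
rewrite qstate_real mxE real_normK ?rmorphXn //.
by apply/complex_realP; exists (rstate z q s 0).
Qed.

Lemma qprob_real_false z : qprob real_qalg z false =
  real_complex R (1 - \sum_(s | out (enum_val s)) rstate z q s 0 ^+ 2).
Proof.
rewrite qprob_real; congr real_complex_def; apply/eqP.
rewrite eq_sym subr_eq addrC -(rstate_unit z q) dotvE.
rewrite (bigID (fun s => out (enum_val s))) /=; apply/eqP; congr (_ + _).
by apply: eq_big => s; rewrite ?expr2 //; case: out.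
Qed.

End RealAlgorithm.

(** * A counter register that averages the powers of an operator *)

Section AveragingAlgorithm.
Variables (R : realType) (I K : finType) (T : nat).

Let m := #|Defs.basis I K|.
Let K' : finType := (K * 'I_T.+1)%type.
Let N := #|Defs.basis I K'|.

Definition work_part (s : Defs.basis I K') : Defs.basis I K :=
  let: (i, c, (k, _)) := s in (i, c, k).
Definition counter (s : Defs.basis I K') : 'I_T.+1 := s.2.2.
Let ix (i : 'I_N) : 'I_m := enum_rank (work_part (enum_val i)).
Let tx (i : 'I_N) := counter (enum_val i).

Let ixtx_bij : bijective (fun i => (ix i, tx i)).
Proof.
exists (fun p => enum_rank (let: (i, c, k) := enum_val p.1 in (i, c, (k, p.2)))).
  move=> i; rewrite /ix /tx /= enum_rankK.
  by case: (enum_val i) (enum_valK i) => [[j c] [k t]] /= ->.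
move=> [i t]; rewrite /ix /tx /= !enum_rankK.
by case: (enum_val i) (enum_valK i) => [[j c] k] /= ->.
Qed.

Let oracle_block z :
  roracle R K' z = block_mx_of ix tx (fun=> roracle R K z).
Proof.
apply/matrixP => i j; rewrite !mxE /ix /tx !enum_rankK.
case: (enum_val i) (enum_val j) => [[j1 c1] [k1 t1]] [[j2 c2] [k2 t2]] /=.
rewrite -natrM mulnb; congr (nat_of_bool _)%:R.
by rewrite !xpair_eqE /counter /=; case: (t1 == t2); rewrite /= ?andbF ?andbT.
Qed.

Variables (e0 : 'I_m) (A B : 'M[R]_m).
Hypotheses (A_orth : A *m A^T = 1%:M) (B_orth : B *m B^T = 1%:M).

(* Running [A O B O] for a number of rounds given by a uniformly distributed
   counter and then projecting the counter on the uniform state averages the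
   powers of [A O B O].  The counter can only control the operators between the
   queries; since [O] is an involution, this is enough. *)
Lemma averaging_algorithm : exists P : qalg R I (2 * T.+1), forall z,
  let psi := ergavg (A *m (roracle R K z *m (B *m roracle R K z))) T.+1
               (delta_mx e0 0) in
  qprob P z true = real_complex R (dotv psi psi) /\
  qprob P z false = real_complex R (1 - dotv psi psi).
Proof.
have [W [Ws Wi W0]] := uniform_reflection R T.
(* In round [r] the branch of counter value [t] is active when [r <= t]. Otherwise the identities
   let the two queries cancel, so branch [t] applies [A O B O] exactly [t] times. *)
pose VA r := block_mx_of ix tx (fun t : 'I_T.+1 => if (r <= t)%N then A else 1%:M).
pose VB r := block_mx_of ix tx (fun t : 'I_T.+1 => if (r <= t)%N then B else 1%:M).
(* Round [r] uses [VB r] between its two queries and [VA r] after them. No counter value reaches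
   round [T.+1]: its two queries cancel, and its last slot is free for the final [W]. *)
pose V (s : nat) := if (s == 0%N) || (s == (2 * T.+1)%N) then ctrl_mx ix tx W
  else if odd s then VB (uphalf s) else VA s./2.
have VV s : V s *m (V s)^T = 1%:M.
  rewrite /V; case: ifP => _; first by apply: ctrl_mx_orth; rewrite // Ws.
  by case: ifP => _; apply: block_mx_orth => // t; case: ifP => _ //;
     rewrite trmx1 mul1mx.
pose s0 : 'I_N := enum_rank
  (let: (i, c, k) := enum_val e0 in (i, c, (k, ord0 : 'I_T.+1))).
pose out (s : Defs.basis I K') := counter s == ord0.
exists (real_qalg (2 * T.+1) s0 VV out) => z.
pose O := roracle R K z; pose U := A *m (O *m (B *m O)).
rewrite -/O -/U; set psi := ergavg U _ _; move=> psi'; rewrite {}/psi'.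
have OO v : O *m (O *m v) = v :> 'cV[R]_m by rewrite mulmxA roracle_invol mul1mx.
pose c : R := (Num.sqrt T.+1%:R)^-1.
pose st r := block_col ix tx (fun t : 'I_T.+1 =>
  c *: iter (minn t r) (mulmx U) (delta_mx e0 0)).
have st0 : rstate s0 V z 0 = st 0%N.
  rewrite /= /V /= -colE; apply/matrixP => i j; rewrite !mxE.
  have -> : ix s0 = e0.
    by rewrite /ix /s0 enum_rankK; case: (enum_val e0) (enum_valK e0) => [[? ?] ?].
  have -> : tx s0 = 0 by rewrite /tx /s0 enum_rankK; case: (enum_val e0) => [[? ?] ?].
  by rewrite W0 mulrC andbT /c.
have step r (phi : 'I_T.+1 -> 'cV[R]_m) :
    VA r *m (roracle R K' z *m (VB r *m (roracle R K' z *m block_col ix tx phi)))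
    = block_col ix tx (fun t => if (r <= t)%N then U *m phi t else phi t).
  rewrite !oracle_block /VA /VB !mul_blocks_col //; apply: eq_block_col => t.
  by case: ifP => _; rewrite ?mul1mx ?OO // /U -!mulmxA.
have Vodd r : V (2 * r).+1 = VB r.+1.
  rewrite /V ifF; last by apply/negbTE; lia.
  by rewrite ifT; [rewrite mul2n /= doubleK|lia].
have Veven r : (r < T)%N -> V (2 * r).+2 = VA r.+1.
  move=> rT; rewrite /V ifF; last by apply/negbTE; lia.
  by rewrite ifF; [rewrite mul2n /= doubleK|lia].
have Vlast : V (2 * T).+2 = ctrl_mx ix tx W by rewrite /V ifT //; lia.
have rec2 r : rstate s0 V z (2 * r).+2 = V (2 * r).+2 *m (roracle R K' z *m
    (V (2 * r).+1 *m (roracle R K' z *m rstate s0 V z (2 * r)))) by [].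
have stT r : (r <= T)%N -> rstate s0 V z (2 * r) = st r.
  elim: r => [_|r IH rT]; first exact: st0.
  rewrite (_ : 2 * r.+1 = (2 * r).+2)%N ?mulnS // rec2 Vodd Veven //.
  rewrite IH; last exact: ltnW.
  rewrite step; apply: eq_block_col => t.
  case: ifPn => [rt|]; first by rewrite (minn_idPr rt) (minn_idPr (ltnW rt)) -scalemxAr.
  by rewrite -leqNgt => rt; rewrite (minn_idPl rt) (minn_idPl (leqW rt)).
pose fin := block_col ix tx (fun t : 'I_T.+1 => \sum_s W t s *:
  (c *: iter s (mulmx U) (delta_mx e0 0))).
have finE : rstate s0 V z (2 * T.+1) = fin.
  rewrite (_ : 2 * T.+1 = (2 * T).+2)%N ?mulnS // rec2 Vodd Vlast stT //.
  have -> : VB T.+1 = 1%:M.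
    apply/matrixP => i j; rewrite !mxE leqNgt ltn_ord /= mxE.
    by rewrite (eq_block_index ixtx_bij) andbC -natrM mulnb.
  rewrite mul1mx mulmxA roracle_invol mul1mx (mul_ctrl_col ixtx_bij).
  apply: eq_block_col => t; apply: eq_bigr => s _; rewrite (minn_idPl _) //.
  by rewrite -ltnS.
have main : \sum_(s | out (enum_val s)) rstate s0 V z (2 * T.+1) s 0 ^+ 2 =
            dotv psi psi.
  rewrite finE big_mkcond /=.
  pose F (a : 'I_m) (t : 'I_T.+1) : R := (ord0 == t)%:R *
    ((\sum_s W t s *: (c *: iter s (mulmx U) (delta_mx e0 0)) : 'cV[R]_m) a 0) ^+ 2.
  rewrite (eq_bigr (fun i => F (ix i) (tx i))) => [|i _].
    rewrite (big_block ixtx_bij) dotvE; apply: eq_bigr => a _.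
    rewrite sum_pick -expr2; congr (_ ^+ 2); rewrite /psi /ergavg.
    congr (fun_of_matrix _ _ _); rewrite scaler_sumr; apply: eq_bigr => s _.
    (* By symmetry [W 0 s = c]; with the factor [c] of the preparation this gives the weight 1/(T+1)
       of the average. *)
    rewrite scalerA -[W]Ws mxE W0 -/c; congr (_ *: _).
    by rewrite /c -expr2 exprVn sqr_sqrtr ?ler0n.
  rewrite /F /out -/(tx i) eq_sym; case: eqP => _; last by rewrite mul0r.
  by rewrite mul1r mxE.
rewrite qprob_real qprob_real_false main; split=> //.
by congr real_complex_def; rewrite -main; apply: eq_bigl => s; rewrite eqb_id.
Qed.

End AveragingAlgorithm.

(** * From adversary vectors to quantum algorithms *)

Section AdversaryAlgorithm.
Variables (R : realType) (I K : finType) (f : bfun I).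

Lemma sum_option (J : finType) (F : option J -> R) :
  \sum_i F i = F None + \sum_j F (Some j).
Proof.
rewrite (bigD1 None) //=; congr (_ + _).
by rewrite (reindex_omap Some id) //=; [apply: eq_bigl => j; rewrite eqxx | case].
Qed.

Let S := Defs.basis I (option K).
Let s0 : S := (None, false, None).

Lemma sum_basis (F : S -> R) :
  (forall s, F s != 0 -> s = s0 \/ exists j c k, s = (Some j, c, Some k)) ->
  \sum_s F s = F s0 + \sum_j \sum_k \sum_c F (Some j, c, Some k).
Proof.
move=> h; have F0 s : s <> s0 -> (forall j c k, s <> (Some j, c, Some k)) -> F s = 0.
  move=> s1 s2; apply/eqP/negPn/negP => /h [//|[j [c [k e]]]].
  exact: (s2 j c k).
have -> : \sum_s F s = \sum_i \sum_k \sum_c F (i, c, k).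
  rewrite pair_bigA pair_bigA /=.
  rewrite (reindex (fun p : option I * option K * bool => (p.1.1, p.2, p.1.2))) //.
  by exists (fun s : S => (s.1.1, s.2, s.1.2)) => [[[i k] c]|[[i c] k]] _.
rewrite sum_option; congr (_ + _).
  rewrite sum_option [X in _ + X]big1 => [|k _]; last by rewrite big1 // => c _; rewrite F0.
  by rewrite addr0 big_bool /= F0 ?add0r.
apply: eq_bigr => j _; rewrite sum_option [X in X + _]big1 ?add0r // => c _.
by rewrite F0.
Qed.

Definition colfun (g : S -> R) : 'cV[R]_#|S| := \col_i g (enum_val i).

Lemma dotv_colfun g h : dotv (colfun g) (colfun h) = \sum_s g s * h s.
Proof.
rewrite dotvE [RHS](reindex (@enum_val S predT)) /=.
  by apply: eq_bigr => i _; rewrite !mxE.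
by apply: onW_bij; exact: enum_val_bij.
Qed.

Lemma roracle_colfun z g :
  roracle R (option K) z *m colfun g = colfun (g \o query z).
Proof.
apply/matrixP => i j; rewrite !mxE (bigD1 (enum_rank (query z (enum_val i)))) //=.
rewrite !mxE enum_rankK queryK eqxx mul1r big1 ?addr0 // => k ki.
rewrite !mxE [_ == query z _]negbTE ?mul0r //.
by apply: contraNN ki => /eqP ->; rewrite queryK enum_valK.
Qed.

(** Conjugated by the oracle of [z], this projector becomes the one onto the null queries and the
    states whose answer bit equals [z j]. Hence the input dependent reflection costs two queries. *)
Definition zero_answer (s : S) : R := ((s.1.1 == None) || ~~ s.1.2)%:R.
Let D : 'M[R]_#|S| := diag_mx (\row_i zero_answer (enum_val i)).

Lemma diag_colfun g : D *m colfun g = colfun (fun s => zero_answer s * g s).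
Proof. by apply/matrixP => i j; rewrite /D mul_diag_mx !mxE. Qed.

Variables (u v : input I -> I -> K -> R) (A B : R).
Hypothesis B_gt0 : 0 < B.
Hypothesis u_norm : forall x, f x = Some false ->
  \sum_j \sum_k u x j k ^+ 2 <= A.
Hypothesis v_norm : forall y, f y = Some true ->
  \sum_j \sum_k v y j k ^+ 2 <= B.
Hypothesis uv : forall x y, f x = Some false -> f y = Some true ->
  \sum_(j | x j != y j) \sum_k u x j k * v y j k = 1.

(** With this scale the positive vectors have squared norm at most 1 + 1/2, which yields acceptance
    probability 2/3; the price is the factor 2 in the norm of the negative vectors. *)
Let sigma := Num.sqrt (2 * B)^-1.

Let sigma_gt0 : 0 < sigma.
Proof. by rewrite sqrtr_gt0 invr_gt0 mulr_gt0. Qed.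

Let sigma2 : sigma ^+ 2 = (2 * B)^-1.
Proof. by rewrite sqr_sqrtr // invr_ge0 mulr_ge0 // ltW. Qed.

(** Its answer bits agree with [y], so it is invariant under the projector defined by [y]. *)
Definition pos_vec (y : input I) (s : S) : R :=
  match s with
  | (None, false, None) => 1
  | (Some j, c, Some k) => (c == y j)%:R * (sigma * v y j k)
  | _ => 0
  end.

(** Its answer bits contradict [x]: the pairing with [pos_vec y] only sees the [j] with
    [x j != y j], and the projector defined by [x] erases everything but the initial state. *)
Definition neg_vec (x : input I) (s : S) : R :=
  match s with
  | (None, false, None) => 1
  | (Some j, c, Some k) => - ((c != x j)%:R * (sigma^-1 * u x j k))
  | _ => 0
  end.

Let supp (g h : S -> R) :
  (forall s, g s != 0 -> s = s0 \/ exists j c k, s = (Some j, c, Some k)) ->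
  (forall s, g s * h s != 0 -> s = s0 \/ exists j c k, s = (Some j, c, Some k)).
Proof. by move=> hg s; rewrite mulf_eq0 negb_or => /andP[/hg]. Qed.

Let supp_pos y s : pos_vec y s != 0 ->
  s = s0 \/ exists j c k, s = (Some j, c, Some k).
Proof.
case: s => [[[j|] [] [k|]]] /=; rewrite ?eqxx // => _;
  by [left | right; do 3 eexists].
Qed.

Let supp_neg x s : neg_vec x s != 0 ->
  s = s0 \/ exists j c k, s = (Some j, c, Some k).
Proof.
case: s => [[[j|] [] [k|]]] /=; rewrite ?eqxx // => _;
  by [left | right; do 3 eexists].
Qed.

Lemma pos_neg_orthogonal x y : f x = Some false -> f y = Some true ->
  \sum_s pos_vec y s * neg_vec x s = 0.
Proof.
move=> fx fy; rewrite sum_basis; last exact/supp/supp_pos.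
rewrite /= mul1r -[X in X + _](uv fx fy) [X in X + _]big_mkcond -big_split /=.
apply: big1 => j _; rewrite [X in _ + X](eq_bigr
  (fun k => - ((x j != y j)%:R * (u x j k * v y j k)))) => [|k _].
  by rewrite sumrN -mulr_sumr; case: (x j != y j); rewrite ?mul1r ?mul0r subrr.
rewrite big_bool /=.
have := sigma_gt0; rewrite lt0r => /andP[s_neq0 _].
by case: (x j) (y j) => [] []; rewrite /= ?mul0r ?mulr0 ?mul1r; field.
Qed.

Lemma pos_vec_norm y : f y = Some true -> \sum_s pos_vec y s * pos_vec y s <= 3 / 2.
Proof.
move=> fy; rewrite sum_basis; last exact/supp/supp_pos.
rewrite /= mulr1.
rewrite (_ : \sum_j _ = (2 * B)^-1 * \sum_j \sum_k v y j k ^+ 2).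
  have -> : 3 / 2 = 1 + (2 * B)^-1 * B by field; rewrite gt_eqF.
  by rewrite lerD2l ler_wpM2l ?v_norm // invr_ge0 mulr_ge0 // ltW.
rewrite -sigma2 mulr_sumr; apply: eq_bigr => j _; rewrite mulr_sumr.
apply: eq_bigr => k _; rewrite big_bool /=.
by case: (y j); rewrite /= ?mul0r ?mulr0 ?mul1r; ring.
Qed.

Lemma neg_vec_norm x : f x = Some false ->
  \sum_s neg_vec x s * neg_vec x s <= 1 + 2 * A * B.
Proof.
move=> fx; rewrite sum_basis; last exact/supp/supp_neg.
rewrite /= mulr1.
rewrite (_ : \sum_j _ = (2 * B) * \sum_j \sum_k u x j k ^+ 2).
  rewrite lerD2l [X in _ <= X]mulrAC ler_wpM2l ?u_norm //.
  by rewrite mulr_ge0 // ltW.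
have -> : 2 * B = sigma^-1 ^+ 2 by rewrite exprVn sigma2 invrK.
rewrite mulr_sumr; apply: eq_bigr => j _; rewrite mulr_sumr.
apply: eq_bigr => k _; rewrite big_bool /=.
by case: (x j); rewrite /= ?mul0r ?mulr0 ?mul1r; ring.
Qed.

(** [L] projects onto the span of the positive vectors and [Pz] is the input dependent projector. On
    a positive [z], both fix [pos_vec z], which has pairing 1 with the initial state, so the average
    has squared norm at least 2/3. On a negative [z], [L] kills [neg_vec z] and [Pz] maps it to the
    initial state, so the squared norm is at most (1 + 2AB)/(T+1)^2, hence at most 1/3. *)
Theorem adversary_algorithm T : 3 * (1 + 2 * A * B) <= T.+1%:R ^+ 2 ->
  exists P : qalg R I (2 * T.+1), computes f P.
Proof.
move=> hT.
have [L [Ls Li Lv Lw]] := ortho_proj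
  [seq colfun (pos_vec y) | y <- enum [pred y | f y == Some true]].
have Ds : D^T = D by rewrite tr_diag_mx.
have Di : D *m D = D.
  apply/matrixP => i j; rewrite /D mul_diag_mx !mxE /zero_answer.
  by case: (i =P j) => [->|]; rewrite ?mulr0n ?mulr0 // !mulr1n -natrM mulnb andbb.
have reflorth (M : 'M[R]_#|S|) : M^T = M -> M *m M = M -> refl M *m (refl M)^T = 1%:M.
  by move=> h1 h2; rewrite refl_sym // refl_invol.
have [P hP] := averaging_algorithm T (enum_rank s0) (reflorth L Ls Li) (reflorth D Ds Di).
exists P => z b fz; move: (hP z) => {hP}.
pose O := roracle R (option K) z; rewrite -/O.
have OO : O *m O = 1%:M by rewrite roracle_invol.
pose Pz := O *m (D *m O).
have -> : O *m (refl D *m O) = refl Pz.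
  by rewrite /refl mulmxBl mulmxBr mul1mx OO -scalemxAl -scalemxAr.
have Pzs : Pz^T = Pz by rewrite /Pz !trmx_mul Ds roracle_sym mulmxA.
have Pzi : Pz *m Pz = Pz.
  by rewrite /Pz -!mulmxA (mulmxA O O) OO mul1mx (mulmxA D D) Di.
have Pzcol g : Pz *m colfun g = colfun (fun s => zero_answer (query z s) * g s).
  rewrite /Pz -!mulmxA roracle_colfun diag_colfun roracle_colfun.
  by congr colfun; apply/funext => s /=; rewrite queryK.
have e0E : delta_mx (enum_rank s0) 0 = colfun (fun s => (s == s0)%:R).
  apply/matrixP => i j; rewrite !mxE ord1 eqxx andbT; congr (nat_of_bool _)%:R.
  by rewrite -(inj_eq enum_val_inj) enum_rankK.
have UU : (refl L *m refl Pz)^T *m (refl L *m refl Pz) = 1%:M.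
  by rewrite trmx_mul !refl_sym // mulmxA -(mulmxA (refl Pz)) refl_invol // mulmx1 refl_invol.
set avg := ergavg _ _ _ => -[p1 p0].
rewrite (_ : 2 / 3 = real_complex R (2 / 3)); last by rewrite fmorph_div !rmorph_nat.
case: b fz => fz; rewrite ?p1 ?p0 lecR.
  have := ergavg_fixed UU (T := T.+1) (phi := colfun (pos_vec z)) (delta_mx (enum_rank s0) 0).
  rewrite -/avg e0E !dotv_colfun => /(_ isT).
  have -> : \sum_s pos_vec z s * (s == s0)%:R = 1.
    by rewrite (bigD1 s0) //= mulr1 big1 ?addr0 // => s /negPf ->; rewrite mulr0.
  rewrite expr1n => h.
  have {}h : 1 <= 3 / 2 * dotv avg avg.
    apply: le_trans (h _) _.
      rewrite -mulmxA (@refl_fix _ _ Pz); last first.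
        rewrite Pzcol; congr colfun; apply/funext => -[[[j|] c] [k|]] //=;
          rewrite /zero_answer /= ?mulr0 // ?mul1r //.
        by case: (z j) c => [] []; rewrite /= ?mul0r ?mulr0 ?mul1r.
      by apply/refl_fix/Lv/map_f; rewrite mem_enum inE fz.
    by rewrite ler_wpM2r ?dotv_ge0 ?pos_vec_norm.
  lra.
have Lz : L *m colfun (neg_vec z) = 0.
  apply: Lw => p /mapP[y]; rewrite mem_enum inE => /eqP fy -> {p}.
  by rewrite dotv_colfun pos_neg_orthogonal.
have Pw : Pz *m colfun (neg_vec z) = delta_mx (enum_rank s0) 0.
  rewrite Pzcol e0E; congr colfun; apply/funext => -[[[j|] c] [k|]] //=;
    rewrite /zero_answer /= ?mulr0 //.
  - by case: (z j) c => [] []; rewrite /= ?mul0r ?mulr0 ?mul1r ?mulr0 ?oppr0.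
  - by case: c; rewrite ?mulr0.
  - by case: c; rewrite ?mulr0 ?mulr1.
have := two_reflections_negative (ltn0Sn T) Ls Li Pzs Pzi Lz Pw.
rewrite -/avg dotv_colfun => h.
have {}h : dotv avg avg <= 3^-1.
  apply: le_trans h _; rewrite ler_pdivrMr ?exprn_gt0 ?ltr0n //.
  rewrite -(ler_pM2l (x := 3)) ?mulrA ?mulfV ?mul1r //.
  by apply: le_trans hT; rewrite ler_wpM2l ?neg_vec_norm.
lra.
Qed.

End AdversaryAlgorithm.

(** * From learning graphs to quantum algorithms *)

Section LearningGraphToQueries.
Variables (R : realType) (I : finType).
Implicit Types (z : input I) (S : {set I}).

Lemma restr_eqP S z z' :
  reflect {in S, forall i, z i = z' i} (restr S z == restr S z').
Proof.
apply: (iffP eqP) => [h i iS|h].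
  by have /ffunP/(_ i) := h; rewrite !ffunE iS.
by apply/ffunP => i; rewrite !ffunE; case: (boolP (i \in S)) => //= /h ->.
Qed.

Lemma restr_sub S S' z z' : S \subset S' ->
  restr S' z = restr S' z' -> restr S z = restr S z'.
Proof.
move=> /subsetP sub /eqP/restr_eqP h; apply/eqP/restr_eqP => i /sub; exact: h.
Qed.

Variables (f : bfun I) (G : elg R f).

Lemma C0_at_le x : f x = Some false -> C0_at G x <= C0 G.
Proof.
by move=> fx; rewrite /C0 (bigD1 x) ?fx //= le_max lexx.
Qed.

Lemma C1_at_le y : f y = Some true -> C1_at G y <= C1 G.
Proof.
by move=> fy; rewrite /C1 (bigD1 y) ?fy //= le_max lexx.
Qed.

Lemma C0_ge0 : 0 <= C0 G.
Proof. by rewrite /C0; elim/big_rec: _ => // i x _ x0; rewrite le_max x0 orbT. Qed.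

Lemma C1_ge0 : 0 <= C1 G.
Proof. by rewrite /C1; elim/big_rec: _ => // i x _ x0; rewrite le_max x0 orbT. Qed.

Lemma C0_le c : 0 <= c -> (forall x, f x = Some false -> C0_at G x <= c) -> C0 G <= c.
Proof.
move=> c0 h; rewrite /C0; elim/big_rec: _ => // i x /eqP/h ci xc.
by rewrite ge_max ci.
Qed.

Lemma C1_le c : 0 <= c -> (forall x, f x = Some true -> C1_at G x <= c) -> C1 G <= c.
Proof.
move=> c0 h; rewrite /C1; elim/big_rec: _ => // i x /eqP/h ci xc.
by rewrite ge_max ci.
Qed.

Definition loadsb (e : edge G) (j : I) : bool :=
  (j \notin label (src e)) && (label (tgt e) == j |: label (src e)).

Lemma loadsP e j : reflect (loads e j) (loadsb e j).
Proof. by apply: (iffP andP) => -[h1 /eqP h2]; split=> //; apply/eqP. Qed.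

Hypothesis lg : learning_graph G.

Lemma loadsb_loading e j : loadsb e j -> loading e.
Proof.
case/andP=> je /eqP te; rewrite /loading te; apply/eqP => /setP/(_ j).
by rewrite setU11 (negPf je).
Qed.

Lemma loadsb_inj e i j : loadsb e i -> loadsb e j -> i = j.
Proof.
case/andP=> ie /eqP ti /andP[je /eqP tj]; have : i \in i |: label (src e) by rewrite setU11.
by rewrite -ti tj !inE (negPf ie) orbF => /eqP.
Qed.

Lemma loading_loads e : loading e -> exists j, loadsb e j.
Proof.
case: lg => _ [_ /(_ e) h] _ _; rewrite /loading; case: h => [->|[j /loadsP]]; first by rewrite eqxx.
by exists j.
Qed.

Lemma label_src_tgt (e : edge G) : label (src e) \subset label (tgt e).
Proof.
case: lg => _ [_ /(_ e) h] _ _; case: h => [->|[j [_ ->]]]; first exact: subxx.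
exact: subsetUr.
Qed.

Lemma sum_loads (c : edge G -> R) :
  \sum_j \sum_(e | loadsb e j) c e = \sum_(e | loading e) c e.
Proof.
rewrite (exchange_big_dep (fun e => loading e)) /=; last by move=> j e _ /loadsb_loading.
apply: eq_bigr => e /loading_loads[j ej]; rewrite (big_pred1 j) // => i /=.
by apply/idP/eqP => [/loadsb_inj|->//]; apply.
Qed.

Lemma weight_ge0 b z e : f z != None -> 0 <= @weight _ _ _ G b z e.
Proof. by case: lg => _ _ [h _ _] _; apply: h. Qed.

(* A sink at which [x] and [y] agree would carry a certificate satisfied by [x],
   so the whole flow leaves the set of vertices at which they agree. *)
Lemma flow_cut x y : f x = Some false -> f y = Some true ->
  \sum_(e : edge G | (restr (label (src e)) x == restr (label (src e)) y) &&
     (restr (label (tgt e)) x != restr (label (tgt e)) y)) flow y e = 1.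
Proof.
move=> fx fy; pose cut (v : vert G) := restr (label v) x == restr (label v) y.
case: lg => _ [root0 _] _ /(_ y fy) [_ abs_ge0 _ cert].
have abs0 v : cut v -> absorbed y v = 0.
  move=> /eqP cv; apply/eqP; apply: contraT => a0.
  have /cert/(_ x) : 0 < absorbed y v by rewrite lt_neqAle eq_sym a0 abs_ge0.
  by rewrite fx => /(_ isT cv).
have : \sum_(v | cut v) absorbed y v = 0 by apply: big1 => v /abs0.
have cut_root : cut (Defs.root G) by rewrite /cut root0; apply/restr_eqP => i; rewrite inE.
rewrite /absorbed sumrB big_split /= (bigD1 (Defs.root G)) //= eqxx big1 ?addr0; last first.
  by move=> v /andP[_ /negPf ->].
have collect (s : edge G -> vert G) :
  \sum_(v | cut v) \sum_(e | s e == v) flow y e = \sum_(e | cut (s e)) flow y e.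
  rewrite (exchange_big_dep predT) //= [RHS]big_mkcond; apply: eq_bigr => e _.
  case: (boolP (cut (s e))) => c; last first.
    by rewrite big_pred0 // => v; case: eqP => [<-|]; rewrite ?andbF // (negPf c).
  by rewrite (big_pred1 (s e)) // => v /=; case: eqP => [<-|/eqP/negPf]; rewrite ?andbF ?c ?eqxx // eq_sym.
rewrite !collect (bigID (fun e => cut (tgt e)) (fun e => cut (src e))) /=.
(* Labels grow along edges, so an edge whose target lies in the cut also starts there. The inner
   edges cancel, and the flow that leaves is the injected unit. *)
rewrite [X in _ - (X + _)](eq_bigl (fun e : edge G => cut (tgt e))) => [|e /=].
  by rewrite opprD addrA addrK => /eqP; rewrite subr_eq0 => /eqP <-.
case: (boolP (cut (tgt e))) => h; rewrite ?andbF ?andbT //.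
by apply/eqP/(restr_sub (label_src_tgt e))/eqP.
Qed.

Let K : finType := (edge G * input I)%type.

(** A coordinate records a loaded index, an edge and the values seen on the label of its source. Two
    inputs meet only on edges at whose source they agree, which turns pairings into sums over such
    edges. *)
Let coord (c : edge G -> R) z (j : I) (k : K) : R :=
  (loadsb k.1 j && (k.2 == restr (label (src k.1)) z))%:R * c k.1.

Let coord_dot c c' x y j :
  \sum_k coord c x j k * coord c' y j k =
  \sum_(e | loadsb e j && (restr (label (src e)) x == restr (label (src e)) y))
     c e * c' e.
Proof.
rewrite -(pair_bigA _ (fun e l => coord c x j (e, l) * coord c' y j (e, l))) /=.
rewrite [RHS]big_mkcond; apply: eq_bigr => e _; rewrite /coord /=.
case: (loadsb e j) => /=; last by apply: big1 => l _; rewrite !mul0r.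
rewrite (bigD1 (restr (label (src e)) x)) //= eqxx big1 => [|l /negPf ->].
  by rewrite addr0 mul1r; case: eqP => _ /=; rewrite ?mul0r ?mulr0 ?mul1r.
by rewrite !mul0r.
Qed.

(** Negative vectors carry the roots of the weights, positive ones the flow divided by these roots,
    so the norms are bounded by the two complexities. On an edge of the cut the axiom on weights
    makes both roots equal: the product is the flow, and the pairing is the flow through the cut. *)
Theorem learning_graph_algorithm (A B : R) T :
  0 < B -> C0 G <= A -> C1 G <= B -> 3 * (1 + 2 * A * B) <= T.+1%:R ^+ 2 ->
  exists P : qalg R I (2 * T.+1), computes f P.
Proof.
move=> B0 C0A C1B hT; pose sw b z e := Num.sqrt (@weight _ _ _ G b z e).
apply: (@adversary_algorithm R I K f
  (fun x => coord (sw false x) x) (fun y => coord (fun e => flow y e / sw true y e) y)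
  A B B0 _ _ _ T hT).
- move=> x fx; apply: le_trans C0A; apply: le_trans (C0_at_le fx).
  rewrite /C0_at -sum_loads; apply: ler_sum => j _.
  rewrite (eq_bigr _ (fun k _ => expr2 _)) coord_dot.
  rewrite (eq_bigl (fun e => loadsb e j)) => [|e]; last by rewrite eqxx andbT.
  by apply: ler_sum => e _; rewrite -expr2 sqr_sqrtr // weight_ge0 ?fx.
- move=> y fy; apply: le_trans C1B; apply: le_trans (C1_at_le fy).
  rewrite /C1_at -sum_loads; apply: ler_sum => j _.
  rewrite (eq_bigr _ (fun k _ => expr2 _)) coord_dot.
  rewrite (eq_bigl (fun e => loadsb e j)) => [|e]; last by rewrite eqxx andbT.
  by apply: ler_sum => e _; rewrite -expr2 exprMn exprVn sqr_sqrtr // weight_ge0 ?fy.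
move=> x y fx fy; rewrite -(flow_cut fx fy).
rewrite (eq_bigr _ (fun j _ => coord_dot _ _ x y j)).
rewrite (exchange_big_dep (fun e : edge G =>
  (restr (label (src e)) x == restr (label (src e)) y) &&
  (restr (label (tgt e)) x != restr (label (tgt e)) y))) /=; last first.
  move=> j e xy /andP[/andP[je /eqP te] ->] /=.
  by apply: contraNN xy => /restr_eqP h; apply/eqP/h; rewrite te setU11.
apply: eq_bigr => e /andP[agree differ].
have load_e : loading e by apply: contraNN differ => /eqP <-.
have [j ej] := loading_loads load_e.
have xyj : x j != y j.
  apply: contraNN differ => /eqP xyj; apply/restr_eqP => i.
  case/andP: ej => _ /eqP ->; rewrite !inE => /predU1P[->//|].
  by move/restr_eqP: agree; apply.
rewrite (big_pred1 j) => [|i /=]; last first.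
  rewrite agree andbT; apply/andP/eqP => [[_ /loadsb_inj]|->//]; exact.
case: lg => _ _ [_ _ w3] /(_ y fy)[_ _ w0 _].
rewrite /sw (w3 x y e j fx fy (elimT (loadsP _ _) ej) _ (elimN eqP xyj)); last exact/eqP.
(* A loading edge of weight 0 carries no flow, which covers the division by zero in the positive
   vector. *)
have [w|w] := eqVneq (@weight _ _ _ G true y e) 0.
  by rewrite (w0 e load_e w) mul0r mulr0.
rewrite mulrC divfK // sqrtr_eq0 -ltNge lt_neqAle eq_sym w.
by rewrite weight_ge0 ?fy.
Qed.

End LearningGraphToQueries.

Lemma Q_le_queries (R : realType) (I : finType) (f : bfun I) q (P : qalg R I q) :
  computes f P -> (Q R f <= q%:R%:E)%E.
Proof. by move=> h; apply: ereal_inf_lbound; exists q => //; exists P. Qed.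

Lemma query_count_bound (R : realType) (A : R) : 0 <= A ->
  exists2 T : nat, 3 * (1 + 2 * A) <= T.+1%:R ^+ 2 &
    (2 * T.+1)%:R <= 8 + 6 * Num.sqrt A.
Proof.
(* Now [T.+1] exceeds 3 + 3 sqrt(A), whose square is at least 3 + 6A, and it is at most 4 + 3
   sqrt(A), which doubled is the stated count. *)
move=> A0; exists (Num.truncn (3 + 3 * Num.sqrt A)).
  have := truncnS_gt (3 + 3 * Num.sqrt A); set t : R := _%:R.
  have s0 := sqrtr_ge0 A; have := sqr_sqrtr A0; set s := Num.sqrt A in s0 *.
  by nra.
rewrite natrM -natr1.
have : (Num.truncn (3 + 3 * Num.sqrt A))%:R <= 3 + 3 * Num.sqrt A.
  by rewrite truncn_le // addr_ge0 // mulr_ge0 ?sqrtr_ge0.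
lra.
Qed.

(** * Validity and cost of the OR construction *)

Lemma connect_homo (T T' : finType) (e : rel T) (e' : rel T') (h : T -> T') x y :
  (forall u v, e u v -> e' (h u) (h v)) -> connect e x y -> connect e' (h x) (h y).
Proof.
move=> hh /connectP[p ep ->]; apply/connectP; exists (map h p); last by rewrite last_map.
exact: homo_path ep.
Qed.

Lemma big_tag_fiber (R : nmodType) (J : finType) (V E : J -> finType)
    (s : forall j, E j -> V j) (F : forall j, E j -> R) j (v : V j) :
  \sum_(p : {j : J & E j} | Tagged V (s (tag p) (tagged p)) == Tagged V v)
     F (tag p) (tagged p) = \sum_(e : E j | s j e == v) F j e.
Proof.
rewrite -(sig_big_dep xpredT (fun i (e : E i) => Tagged V (s i e) == Tagged V v) F) /=.
rewrite (bigD1 j) //= [X in _ + X]big1 ?addr0 => [|i ij].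
  by apply: eq_bigl => e; rewrite eq_Tagged.
rewrite big_pred0 // => e; apply/negbTE; apply: contraNN ij => /eqP h.
by have /= -> := congr1 tag h.
Qed.

Lemma big_sig_val (R : nmodType) (T : finType) (P : pred T) (F : T -> R) :
  \sum_(p : {x | P x}) F (val p) = \sum_(x | P x) F x.
Proof.
rewrite [RHS](reindex_omap (val : {x | P x} -> T) insub) /= => [|x Px].
  by apply: eq_bigl => p; rewrite valK (valP p) eqxx.
by rewrite insubT.
Qed.

Lemma take_enum_load (I : finType) (S : {set I}) i : (i < #|S|)%N ->
  exists j, [/\ j \in S, j \notin [set:: take i (enum S)]
    & [set:: take i.+1 (enum S)] = j |: [set:: take i (enum S)]].
Proof.
move=> iS; have [j0 j0S] : exists j, j \in S.
  by apply/set0Pn; rewrite -card_gt0; apply: leq_ltn_trans iS.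
have iE : (i < size (enum S))%N by rewrite -cardE.
exists (nth j0 (enum S) i); split.
- by rewrite -mem_enum mem_nth.
- rewrite inE; apply/negP => /(nthP j0)[k]; rewrite size_take iE => ki.
  rewrite nth_take // => /eqP; rewrite nth_uniq ?enum_uniq ?(ltn_trans ki) //.
  by rewrite ltn_eqF.
- apply/setP => x; rewrite !inE (take_nth j0) // mem_rcons in_cons.
  by [].
Qed.

Lemma take_enum_all (I : finType) (S : {set I}) i : (#|S| <= i)%N ->
  [set:: take i (enum S)] = S.
Proof. by move=> h; apply/setP => x; rewrite inE take_oversize -?cardE // mem_enum. Qed.

Section Robust.
Variables (R : realType) (I : finType).

(* Besides a rank function instead of acyclicity, this asks that the weights be
   determined by the label of the source alone, even outside of the domain of
   [f]; this is what survives when a graph for a partial function is used as a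
   component of a graph for a larger one. *)
Record robust (f : bfun I) (G : elg R f) : Prop := Robust {
  robust_rank : exists r : vert G -> nat, forall e, (r (src e) < r (tgt e))%N;
  robust_inj : injective (fun e : edge G => (src e, tgt e));
  robust_connect : forall v : vert G, connect (@Defs.arc _ _ _ G) (Defs.root G) v;
  robust_labels : labels_ok G;
  robust_weight_ge0 : forall b z e, 0 <= @weight _ _ _ G b z e;
  robust_weight : forall b b' z z' e,
    restr (label (src e)) z = restr (label (src e)) z' ->
    @weight _ _ _ G b z e = weight b' z' e;
  robust_flows : flows_ok G }.

Lemma label_sub (f : bfun I) (G : elg R f) (e : edge G) :
  labels_ok G -> label (src e) \subset label (tgt e).
Proof.
by case=> _ /(_ e) [->|[j [_ ->]]]; [exact: subxx | exact: subsetUr].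
Qed.

Lemma robust_learning_graph (f : bfun I) (G : elg R f) :
  robust G -> learning_graph G /\ adaptive G.
Proof.
case=> [[r hr] inj conn lab w0 w fl]; split; last by move=> z e _; apply: w.
split=> //; last first.
  split=> [b z e _|b z z' e _ _ h|x y e j _ _ _ h _]; first exact: w0.
    by apply: w; apply: restr_sub (label_sub _ lab) h.
  exact: w.
split=> // v s; have arc_r : forall u u' : vert G, Defs.arc u u' -> (r u < r u')%N.
  by move=> u u' /existsP[e /andP[/eqP <- /eqP <-]].
have path_r : forall (s : seq (vert G)) u, path (@Defs.arc _ _ _ G) u s ->
    (r u + size s <= r (last u s))%N.
  elim=> [|u' s' IH] u /=; first by rewrite addn0.
  by case/andP=> /arc_r h /IH; lia.
by move=> /path_r h e; move: h; rewrite e; case: s {e} => //= *; lia.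
Qed.

(** Weights get rescaled by [C1 G], which may vanish. Then each quotient of squared flow by weight
    on a loading edge is 0; as weight 0 already excludes flow, the flow itself is 0. The axiom on
    flows thus survives the rescaling. *)
Lemma robust_flow_eq0 (f : bfun I) (G : elg R f) : robust G ->
  forall y (e : edge G), f y = Some true -> loading e -> C1 G * weight true y e = 0 ->
  flow y e = 0.
Proof.
move=> rG y e fy le /eqP; have [fl0 _ fl _] := robust_flows rG fy.
have terms e' : 0 <= flow y e' ^+ 2 / @weight _ _ _ G true y e'.
  by rewrite divr_ge0 ?sqr_ge0 // (robust_weight_ge0 rG).
rewrite mulf_eq0 => /orP[/eqP c0|/eqP]; last exact: fl.
have := C1_at_le G fy; rewrite c0 /C1_at => s0.
have /eqP : flow y e ^+ 2 / weight true y e = 0.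
  apply/eqP; rewrite eq_le terms andbT; apply: le_trans s0.
  by rewrite (bigD1 e) //= lerDl sumr_ge0.
by rewrite mulf_eq0 invr_eq0 expf_eq0 /= => /orP[/eqP //|/eqP /fl]; apply.
Qed.

Section DenseLoadRobust.
Variables (f : bfun I) (S : {set I}).

Lemma dense_load_robust :
  (forall y, f y = Some true -> certificate f y S) -> robust (dense_load R f S).
Proof.
move=> cert; split.
- by exists (fun v : 'I_(#|S|).+1 => v : nat) => i; rewrite lift0.
- by move=> i j [] /val_inj.
- move=> v; have [n vn] : exists n, val v = n by exists (val v).
  elim: n v vn => [|n IH] v vn; first by rewrite (_ : v = ord0) //; apply: val_inj.
  have nS : (n < #|S|)%N by rewrite -ltnS -vn ltn_ord.
  apply: connect_trans (IH (widen_ord (leqnSn _) (Ordinal nS)) erefl) _.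
  apply: connect1; apply/existsP; exists (Ordinal nS); rewrite eqxx /=.
  by apply/eqP/val_inj; rewrite /= vn.
- split; first by apply/setP => x; rewrite /= take0 !inE.
  move=> i; right; have [j [_ h1 h2]] := take_enum_load (ltn_ord i).
  by exists j; split.
- by move=> *; apply: ler0n.
- by [].
move=> y fy; have absE : forall v : vert (dense_load R f S),
    absorbed y v = (v == ord_max)%:R.
  move=> v; rewrite /absorbed /=.
  have -> : \sum_(e < #|S| | lift ord0 e == v) 1 = (v != ord0)%:R :> R.
    case: (unliftP ord0 v) => [j ->|->]; last first.
      by rewrite big_pred0 // => e; rewrite eq_sym; apply/negbTE/neq_lift.
    rewrite (big_pred1 j) => [|e]; last by rewrite /= (inj_eq lift_inj).
    by rewrite eq_sym neq_lift.
  have -> : \sum_(e < #|S| | widen_ord (leqnSn #|S|) e == v) 1 = (v != ord_max)%:R :> R.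
    case: (unliftP ord_max v) => [j ->|->]; last first.
      rewrite big_pred0 ?eqxx // => e; apply/negbTE/eqP => /(congr1 val) /= h.
      by have := ltn_ord e; rewrite h ltnn.
    rewrite (big_pred1 j) => [|e /=]; first by rewrite eq_sym neq_lift.
    rewrite -(inj_eq val_inj) /= /bump leqNgt ltn_ord add0n.
    by apply/eqP/eqP => [/val_inj|->].
  by do 2 case: eqP => _; rewrite /= ?addr0 ?add0r ?subrr ?subr0.
split=> [e|v|e|v]; rewrite ?absE ?ler01 ?ler0n //=.
- move=> _ /eqP; rewrite pnatr_eq0 => /eqP h.
  by have := leq_ltn_trans (leq0n _) (ltn_ord e); rewrite [in X in X -> _]h.
- by case: eqP => [-> _|]; rewrite ?ltxx //= take_enum_all //; apply: cert.
Qed.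

End DenseLoadRobust.

Section OrRobust.
Variables (F : bfun I) (J : finType) (f : J -> bfun I) (k : nat).
Variable G : forall j, elg R (f j).
Hypothesis k_gt0 : (0 < k)%N.

Lemma or_select_uniq y : uniq (or_select f k y).
Proof. by rewrite take_uniq // enum_uniq. Qed.

Lemma or_select_pos y j : j \in or_select f k y -> f j y = Some true.
Proof. by move/mem_take; rewrite mem_enum inE => /eqP. Qed.

Lemma or_select_size y : (size (or_select f k y) <= k)%N.
Proof. by rewrite size_take; case: ltnP. Qed.

Lemma sum_or_select y (a : J -> R) :
  \sum_j (j \in or_select f k y)%:R * a j = \sum_(j <- or_select f k y) a j.
Proof.
rewrite (big_uniq _ (or_select_uniq y)) [RHS]big_mkcond.
by apply: eq_bigr => j _ /=; case: ifP; rewrite ?mul1r ?mul0r.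
Qed.

Lemma or_C0_at x : (forall j, labels_ok (G j)) ->
  C0_at (or_lg F k G) x = \sum_j C1 (G j) / k%:R * C0_at (G j) x.
Proof.
move=> lab; rewrite /C0_at big_sumType /= big1 ?add0r //.
rewrite -(sig_big_dep xpredT (fun j (e : edge (G j)) => loading e)
  (fun j e => C1 (G j) / k%:R * weight false x e)) /=.
by apply: eq_bigr => j _; rewrite mulr_sumr.
Qed.

Hypothesis G_robust : forall j, robust (G j).
Hypothesis cert : forall j y S, F y = Some true -> f j y = Some true ->
  certificate (f j) y S -> certificate F y S.
Hypothesis select : forall y, F y = Some true ->
  (k <= #|[pred j | f j y == Some true]|)%N.

(** The factor [C1 (G j) / k] makes each selected component contribute at most 1/k, and at most [k]
    are selected. A component with [C1 (G j) = 0] contributes 0 by the convention on inverses. *)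
Lemma or_C1_at y : C1_at (or_lg F k G) y <= 1.
Proof.
have k0 : k%:R != 0 :> R by rewrite pnatr_eq0 -lt0n.
rewrite /C1_at big_sumType /= big1 ?add0r => [|j _]; last by rewrite invr0 mulr0.
rewrite -(sig_big_dep xpredT (fun j (e : edge (G j)) => loading e)
  (fun j e => ((j \in or_select f k y)%:R / k%:R * flow y e) ^+ 2 /
              (C1 (G j) / k%:R * weight true y e))) /=.
rewrite (eq_bigr (fun j => (j \in or_select f k y)%:R *
    (k%:R^-1 * (C1_at (G j) y / C1 (G j))))) => [|j _].
  rewrite sum_or_select -mulr_sumr.
  apply: (@le_trans _ _ (k%:R^-1 * \sum_(j <- or_select f k y) 1)).
    rewrite ler_wpM2l ?invr_ge0 ?ler0n // big_seq [leRHS]big_seq.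
    apply: ler_sum => j /or_select_pos fy.
    have [->|c0] := eqVneq (C1 (G j)) 0; first by rewrite invr0 mulr0 ler01.
    rewrite ler_pdivrMr ?mul1r ?C1_at_le //.
    by rewrite lt_neqAle eq_sym c0 C1_ge0.
  rewrite big_const_seq count_predT iter_addr_0 ler_pdivrMl ?ltr0n // mulr1.
  by rewrite ler_nat or_select_size.
rewrite /C1_at mulr_suml !mulr_sumr; apply: eq_bigr => e _.
case: (j \in _); rewrite /= ?mul0r ?expr0n ?mul0r //=.
rewrite !mul1r exprMn !invfM invrK exprVn.
set w := (weight _ _ _)^-1; set c := (C1 _)^-1.
by field.
Qed.

Lemma or_C1 : C1 (or_lg F k G) <= 1.
Proof. by apply: C1_le => // y _; apply: or_C1_at. Qed.

Definition or_node j (v : vert (G j)) : vert (or_lg F k G) :=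
  Some (Tagged (fun j => vert (G j) : Type) v).

(** The empty transition into the root of [G j] brings, scaled, the unit that is injected at this
    root when [G j] stands alone; elsewhere the flow is merely scaled. *)
Lemma or_absorbed y j (v : vert (G j)) :
  absorbed y (or_node v) =
  (j \in or_select f k y)%:R / k%:R * absorbed y v.
Proof.
rewrite /absorbed /= add0r !big_sumType /= [X in _ - (X + _)]big_pred0 // add0r.
pose c j := (j \in or_select f k y)%:R / k%:R : R.
have tgtE := big_tag_fiber (fun j (e : edge (G j)) => tgt e)
   (fun j e => c j * flow y e) v.
have srcE := big_tag_fiber (fun j (e : edge (G j)) => src e)
   (fun j e => c j * flow y e) v.
rewrite /c in tgtE srcE; rewrite [X in _ + X - _]tgtE [X in _ - X]srcE.
rewrite mulrBr mulrDr !mulr_sumr; congr (_ + _ - _).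
rewrite big_mkcond (bigD1 j) //= big1 ?addr0 => [|i ij].
  rewrite (_ : (_ == _) = (Defs.root (G j) == v)); last exact: eq_Tagged.
  by rewrite eq_sym; case: eqP => _; rewrite ?mulr1 ?mulr0.
by case: eqP => // -[] h; rewrite h eqxx in ij.
Qed.

Lemma or_robust : robust (or_lg F k G).
Proof.
have k0 : k%:R != 0 :> R by rewrite pnatr_eq0 -lt0n.
have root0 j : label (Defs.root (G j)) = set0 by case: (robust_labels (G_robust j)).
split.
- have [r hr] : exists r : forall j, vert (G j) -> nat,
      forall j e, (r j (src e) < r j (tgt e))%N.
    exact: fin_all_exists (fun j => robust_rank (G_robust j)).
  exists (fun v : vert (or_lg F k G) => if v is Some u then (r (tag u) (tagged u)).+1 else 0%N).
  by case=> //= -[j e] /=; rewrite ltnS.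
- move=> [i|[i e]] [j|[j e']] // h; have h1 := congr1 fst h; have h2 := congr1 snd h.
  + by case: h2 => ->.
  + have [ij] := congr1 (omap (fun u : {j : J & vert (G j)} => tag u)) h1.
    move: ij e' h h1 h2 => /= <- e' _ h1 h2; congr inr; congr Tagged.
    apply: (robust_inj (G_robust i)); congr pair; apply/eqP.
      by move/eqP: h1; rewrite (inj_eq Some_inj) eq_Tagged.
    by move/eqP: h2; rewrite (inj_eq Some_inj) eq_Tagged.
- case=> [[j v]|]; last exact: connect0.
  apply: (@connect_trans _ _ (or_node (Defs.root (G j)))).
    by apply: connect1; apply/existsP; exists (inl j); rewrite !eqxx.
  apply: (connect_homo (h := @or_node j))
    (robust_connect (G_robust j) v) => u u' /existsP[e /andP[/eqP <- /eqP <-]].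
  by apply/existsP; exists (inr (Tagged (fun j => edge (G j)) e)); rewrite !eqxx.
- split=> // -[j|[j e]] /=; first by left; rewrite root0.
  by case: (robust_labels (G_robust j)) => _ /(_ e).
- case=> [] z [j|[j e]] //=; rewrite mulr_ge0 ?divr_ge0 ?C1_ge0 ?ler0n //;
    exact: robust_weight_ge0.
- move=> b b' z z' [j|[j e]] //= h; congr (_ * _).
  exact: (robust_weight (G_robust j)).
(* By [select] exactly [k] components are chosen, so the whole unit leaves the new root. *)
move=> y Fy; have absN : @absorbed _ _ _ (or_lg F k G) y None = 0.
  rewrite /absorbed !big_sumType /= [X in _ + (X + _) - _]big_pred0 //.
  rewrite [X in _ + (_ + X) - _]big_pred0 // [X in _ - (_ + X)]big_pred0 // !addr0.
  rewrite -mulr_suml (eq_bigr (fun j => (j \in or_select f k y)%:R * 1)) => [|j _].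
    rewrite sum_or_select big_const_seq count_predT iter_addr_0 size_take -cardE.
    by have := select Fy; case: ltngtP => // [_|<-] _; rewrite divff ?subrr.
  by rewrite mulr1.
split.
- move=> [j|[j e]] /=; first by rewrite divr_ge0 ?ler0n.
  case: (boolP (j \in _)) => [/or_select_pos fj|_]; last by rewrite !mul0r.
  rewrite mulr_ge0 ?divr_ge0 ?ler0n //.
  by case: (robust_flows (G_robust j) fj).
- case=> [[j v]|]; last by rewrite absN.
  rewrite or_absorbed.
  case: (boolP (j \in _)) => [/or_select_pos fj|_]; last by rewrite !mul0r.
  rewrite mulr_ge0 ?divr_ge0 ?ler0n //.
  by case: (robust_flows (G_robust j) fj).
- move=> [j|[j e]] /=; first by rewrite /loading /= root0 eqxx.
  rewrite /loading /= => le w0.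
  case: (boolP (j \in _)) => [/or_select_pos fj|_]; last by rewrite !mul0r.
  rewrite (@robust_flow_eq0 _ _ (G_robust j)) ?mulr0 //.
  by move/eqP: w0; rewrite mulrAC mulf_eq0 invr_eq0 (negPf k0) orbF => /eqP.
- case=> [[j v]|]; last by rewrite absN ltxx.
  rewrite or_absorbed.
  case: (boolP (j \in _)) => [/or_select_pos fj|_]; last by rewrite !mul0r ltxx.
  rewrite mul1r pmulr_rgt0 ?invr_gt0 ?ltr0n //.
  by case: (robust_flows (G_robust j) fj) => _ _ _ h /h; apply: cert.
Qed.

End OrRobust.
End Robust.

(** * Validity and cost of the Johnson construction *)

(** Serves to count the carrying super edges at a subset: at most one on each side, with a Boolean
    telling whether it exists. *)
Lemma sum_indicator_unique (R : realType) (E : finType) (Q c : pred E) (b : bool) :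
  (b -> exists2 e, Q e & c e) -> (forall e, Q e -> c e -> b) ->
  (forall e e', Q e -> c e -> Q e' -> c e' -> e = e') ->
  \sum_(e | Q e) (c e)%:R = b%:R :> R.
Proof.
case: b => [/(_ isT) [e Qe ce] _ h|_ h _].
  rewrite (bigD1 e) //= ce big1 ?addr0 // => e' /andP[Qe' e'e].
  by case: (boolP (c e')) => // ce'; rewrite (h e' e) ?eqxx in e'e.
by rewrite big1 // => e Qe; case: (boolP (c e)) => // /(h e Qe).
Qed.

(** An input reads exactly one plugged value per subset, so the sum over all branches collapses to
    one branch per [k]-subset. *)
Lemma sum_reads (R : realType) (I T : finType) (W : {set T}) (k : nat)
    (Iof : {set T} -> {set I}) (y : input I) (H : {set T} -> input I -> R) :
  \sum_(p : plug W k Iof) (reads p y)%:R * H (plug_set p) (plug_val p) =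
  \sum_(A : {set T} | (A \subset W) && (#|A| == k)) H A (restr (Iof A) y).
Proof.
rewrite (big_sig_val (fun p : jnode W k * input I =>
  (#|val p.1| == k) && (restr (Iof (val p.1)) p.2 == p.2))
  (fun p => (restr (Iof (val p.1)) y == p.2)%:R * H (val p.1) p.2)).
rewrite -(pair_big_dep (fun A : jnode W k => #|val A| == k)
  (fun (A : jnode W k) l => restr (Iof (val A)) l == l)
  (fun A l => (restr (Iof (val A)) y == l)%:R * H (val A) l)) /=.
transitivity (\sum_(A : jnode W k | #|val A| == k) H (val A) (restr (Iof (val A)) y)).
  apply: eq_bigr => A _; rewrite (bigD1 (restr (Iof (val A)) y)) /=; last first.
    by apply/eqP/ffunP => i; rewrite !ffunE andbA andbb.
  rewrite eqxx mul1r big1 ?addr0 // => l /andP[_ /negPf].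
  by rewrite eq_sym => ->; rewrite mul0r.
rewrite [LHS]big_mkcond (big_sig_val (fun A : {set T} => (A \subset W) && (k - 2 <= #|A| <= k)%N)
  (fun A : {set T} => if #|A| == k then H A (restr (Iof A) y) else 0)) -big_mkcondr /=.
apply: eq_bigl => A; case: (A \subset W) => //=; lia.
Qed.

(** * The flow through the subsets of W *)

Section JohnsonFlow.
Variables (R : realType) (I T : finType) (W : {set T}) (k : nat).
Variables (Iof : {set T} -> {set I}) (t : T * T).
Hypotheses (k_ge2 : (2 <= k)%N) (t1W : t.1 \in W) (t2W : t.2 \in W).
Hypothesis t12 : t.1 != t.2.
Implicit Types (A : jnode W k) (e : sedge W k).

Definition on_way A : bool :=
  if #|val A| == (k - 2)%N then (t.1 \notin val A) && (t.2 \notin val A)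
  else if #|val A| == (k - 1)%N then (t.1 \in val A) && (t.2 \notin val A)
  else (t.1 \in val A) && (t.2 \in val A).

Lemma jnode_sub A : val A \subset W.
Proof. by case/andP: (valP A). Qed.

Lemma jnode_card A : (k - 2 <= #|val A| <= k)%N.
Proof. by case/andP: (valP A). Qed.

Lemma jnodeP (B : {set T}) : B \subset W -> (k - 2 <= #|B| <= k)%N ->
  exists A, val A = B.
Proof.
move=> h1 h2; have h : (B \subset W) && (k - 2 <= #|B| <= k)%N by rewrite h1 h2.
by exists (exist _ B h).
Qed.

Lemma sedge_someP e A : sedge_src e = Some A ->
  exists2 j, j \in W :\: val A & val (sedge_tgt e) = j |: val A.
Proof.
move=> h; have := valP e; rewrite /sedge_ok -/(sedge_src e) h.
by case/existsP=> j /andP[jW /eqP h']; exists j.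
Qed.

Lemma sedge_noneP e : sedge_src e = None -> #|val (sedge_tgt e)| = (k - 2)%N.
Proof. by move=> h; have := valP e; rewrite /sedge_ok -/(sedge_src e) h => /eqP. Qed.

Lemma sedge_card e A : sedge_src e = Some A ->
  #|val (sedge_tgt e)| = #|val A|.+1.
Proof. by case/sedge_someP=> j /setDP[_ jA] ->; rewrite cardsU1 jA. Qed.

Lemma sedge_ext e e' : sedge_src e = sedge_src e' -> sedge_tgt e = sedge_tgt e' ->
  e = e'.
Proof.
move=> h1 h2; apply: val_inj; rewrite [LHS]surjective_pairing [RHS]surjective_pairing.
by congr pair.
Qed.

Lemma carries_someP e A : carries t e -> sedge_src e = Some A ->
  [/\ on_way A, on_way (sedge_tgt e),
      val A = val (sedge_tgt e) :\ (if #|val (sedge_tgt e)| == (k - 1)%N then t.1 else t.2)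
    & val (sedge_tgt e) = (if #|val A| == (k - 2)%N then t.1 else t.2) |: val A].
Proof.
move=> + eA; have := sedge_card eA; have := jnode_card A.
have := jnode_card (sedge_tgt e); rewrite /carries eA /on_way => kB kA cB; rewrite cB in kB *.
case: eqP => h.
  rewrite (_ : (_.+1 == k - 2)%N = false); last by apply/negbTE; lia.
  rewrite (_ : (_.+1 == k - 1)%N = true); last by lia.
  case/and3P=> h1 h2 /eqP ->; rewrite h1 h2 setU1K // !inE eqxx; split=> //.
  by rewrite eq_sym (negPf t12).
have cA : #|val A| = (k - 1)%N by lia.
have e1 : ((k - 1).+1 == k - 2)%N = false by apply/negbTE; lia.
have e2 : ((k - 1).+1 == k - 1)%N = false by apply/negbTE; lia.
rewrite cA e1 e2 eqxx.
by case/and3P=> h1 h2 /eqP ->; rewrite h1 h2 setU1K // !inE eqxx h1 orbT.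
Qed.

Lemma carries_noneP e : carries t e -> sedge_src e = None -> on_way (sedge_tgt e).
Proof.
by move=> + eA; rewrite /carries eA /on_way (sedge_noneP eA) eqxx.
Qed.

Lemma carries_on_way e : carries t e -> on_way (sedge_tgt e).
Proof.
case E: (sedge_src e) => [A|] h; last exact: carries_noneP.
by case: (carries_someP h E).
Qed.

Lemma sedge_mk (o : option (jnode W k)) A : sedge_ok (o, A) ->
  exists e, sedge_src e = o /\ sedge_tgt e = A.
Proof. by move=> h; exists (exist _ (o, A) h). Qed.

(** The predecessor is forced: remove [t.1] at level [k - 1], remove [t.2] at level [k], and take
    the root at level [k - 2]. *)
Lemma carries_in A :
  \sum_(e | sedge_tgt e == A) (carries t e)%:R = (on_way A)%:R :> R.
Proof.
apply: sum_indicator_unique.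
- move=> wA; have kA := jnode_card A; have [h|h] := eqVneq #|val A| (k - 2)%N.
    have [|e [se te]] := @sedge_mk None A; first by rewrite /sedge_ok h eqxx.
    exists e; first by rewrite te.
    by move: wA; rewrite /on_way h eqxx /carries se te.
  pose s := if #|val A| == (k - 1)%N then t.1 else t.2.
  have sA : s \in val A.
    by move: wA; rewrite /on_way (negPf h) /s; case: ifP => _ /andP[].
  have cA : #|val A| = #|val A :\ s|.+1 by rewrite (cardsD1 s) sA.
  have [||A0 A0E] := @jnodeP (val A :\ s).
  - by apply: subset_trans (jnode_sub A); apply: subD1set.
  - by move: h => /eqP; lia.
  have sW : s \in W by exact: (subsetP (jnode_sub A)).
  have [|e [se te]] := @sedge_mk (Some A0) A.
    by apply/existsP; exists s; rewrite inE A0E sW !inE eqxx /= setD1K.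
  exists e; first by rewrite te.
  rewrite /carries se te A0E; move: wA; rewrite /on_way (negPf h) /s.
  have [hk|hk] := eqVneq #|val A| (k - 1)%N.
    case/andP=> a1 a2; rewrite /s hk eqxx in cA.
    rewrite (_ : (_ == _)%N = true); last by apply/eqP; lia.
    by rewrite !inE eqxx (negPf a2) andbF /= setD1K.
  case/andP=> a1 a2; rewrite /s (negPf hk) in cA.
  rewrite (_ : (_ == (k - 2))%N = false); last by apply/negbTE; move/eqP: hk; lia.
  by rewrite !inE eqxx t12 a1 /= setD1K.
- by move=> e /eqP <- /carries_on_way.
- move=> e e' /eqP eA ce /eqP e'A ce'; apply: sedge_ext; last by rewrite eA.
  case E: (sedge_src e) => [A0|]; case E': (sedge_src e') => [A0'|] //.
  + case: (carries_someP ce E) => _ _ h _; case: (carries_someP ce' E') => _ _ h' _.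
    by congr Some; apply: val_inj; rewrite h h' eA e'A.
  + have := sedge_card E; have := sedge_noneP E'; have := jnode_card A0.
    by rewrite eA e'A; lia.
  + have := sedge_card E'; have := sedge_noneP E; have := jnode_card A0'.
    by rewrite eA e'A; lia.
Qed.

Lemma carries_out A :
  \sum_(e | sedge_src e == Some A) (carries t e)%:R =
  (on_way A && (#|val A| != k))%:R :> R.
Proof.
apply: sum_indicator_unique.
- case/andP=> wA Ak; have kA := jnode_card A.
  pose s := if #|val A| == (k - 2)%N then t.1 else t.2.
  have sA : s \notin val A.
    move: wA; rewrite /on_way /s; case: eqP => e1; first by case/andP.
    case: eqP => [_ /andP[]//|e2]; exfalso; move/eqP: Ak; lia.
  have sW : s \in W by rewrite /s; case: ifP.
  have [||B BE] := @jnodeP (s |: val A).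
  - by rewrite subUset sub1set sW jnode_sub.
  - by rewrite cardsU1 sA -[nat_of_bool _]/1%N add1n; move/eqP: Ak; lia.
  have [|e [se te]] := @sedge_mk (Some A) B.
    by apply/existsP; exists s; rewrite inE sA sW BE eqxx.
  exists e; first by rewrite se.
  rewrite /carries se te BE; move: wA; rewrite /on_way /s.
  case: ifP => h; first by case/andP=> -> ->; rewrite eqxx.
  case: ifP => h'; first by case/andP=> -> ->; rewrite eqxx.
  by move/eqP: Ak; move/eqP: h; move/eqP: h'; lia.
- move=> e /eqP eA ce; case: (carries_someP ce eA) => -> _ _ _; rewrite andTb.
  have := sedge_card eA; have := jnode_card (sedge_tgt e).
  by move=> h1 h2; apply/eqP; lia.
- move=> e e' /eqP eA ce /eqP e'A ce'; apply: sedge_ext; first by rewrite eA.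
  case: (carries_someP ce eA) => _ _ _ h; case: (carries_someP ce' e'A) => _ _ _ h'.
  by apply: val_inj; rewrite h h'.
Qed.

Lemma carries_root :
  \sum_(e : sedge W k | sedge_src e == None) (carries t e)%:R = n_used R W k.
Proof.
rewrite -natr_sum /n_used; congr _%:R; rewrite -big_mkcondr sum1_card /=.
have cW : #|W :\ t.1 :\ t.2| = (#|W| - 2)%N.
  have := cardsD1 t.1 W; have := cardsD1 t.2 (W :\ t.1).
  by rewrite t1W !inE eq_sym t12 t2W /=; lia.
rewrite -cW -cards_draws.
rewrite -(@card_in_imset _ _ (fun e => val (sedge_tgt e))
   [pred e | (sedge_src e == None) && carries t e]); last first.
  move=> e e'; rewrite !inE => /andP[/eqP h _] /andP[/eqP h' _] /val_inj h2.
  by apply: sedge_ext => //; rewrite h h'.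
apply: eq_card => B; rewrite !inE; apply/imsetP/andP => [[e]|[BW /eqP Bk]].
  rewrite inE => /andP[/eqP se]; rewrite /carries se => /andP[h1 h2] ->.
  rewrite (sedge_noneP se) eqxx; split=> //.
  apply/subsetP => x xB; rewrite !inE (subsetP (jnode_sub _) _ xB) andbT.
  by apply/andP; split; apply: contraTneq xB => ->.
have [||A AE] := @jnodeP B.
- exact: subset_trans BW (subset_trans (subD1set _ _) (subD1set _ _)).
- by lia.
have [|e [se te]] := @sedge_mk None A; first by rewrite /sedge_ok AE Bk eqxx.
exists e; last by rewrite te AE.
rewrite inE /carries se te AE eqxx /=; apply/andP; split; apply/negP => /(subsetP BW);
  by rewrite !inE eqxx ?andbF.
Qed.

(** Conservation between levels: below level [k] each subset on the way has one carrying super edge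
    out, and each at the next level has one in. All levels thus have as many as [carries_root]
    counts. *)
Lemma sum_on_way j : (j <= 2)%N ->
  \sum_(A : jnode W k | #|val A| == (k - 2 + j)%N) (on_way A)%:R = n_used R W k.
Proof.
have level j' (s : sedge W k -> jnode W k -> bool) :
  \sum_(A : jnode W k | #|val A| == (k - 2 + j')%N) \sum_(e | s e A) (carries t e)%:R =
  \sum_e \sum_(A : jnode W k | (#|val A| == (k - 2 + j')%N) && s e A) (carries t e)%:R :> R.
  exact: exchange_big_dep.
elim: j => [_|j IH j2].
  rewrite -carries_root (eq_bigr _ (fun A _ => esym (carries_in A))).
  rewrite (level 0%N (fun e A => sedge_tgt e == A)) [RHS]big_mkcond.
  apply: eq_bigr => e _; case: eqP => se.
    have h0 : (#|val (sedge_tgt e)| == k - 2 + 0)%N by have := sedge_noneP se; lia.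
    rewrite (big_pred1 (sedge_tgt e)) // => A.
    by apply/andP/eqP => [[_ /eqP <-]//|->].
  rewrite big_pred0 // => A; apply/negbTE/negP => /andP[/eqP Ak /eqP eA].
  case E: (sedge_src e) => [A0|//]; have := sedge_card E; have := jnode_card A0.
  by rewrite eA; lia.
rewrite -(IH (ltnW j2)) (eq_bigr _ (fun A _ => esym (carries_in A))).
rewrite (level j.+1 (fun e A => sedge_tgt e == A)).
rewrite [RHS](eq_bigr (fun A => \sum_(e | sedge_src e == Some A) (carries t e)%:R)).
  rewrite (level j (fun e A => sedge_src e == Some A)); apply: eq_bigr => e _.
  case E: (sedge_src e) => [A0|]; last first.
    rewrite [RHS]big_pred0 => [|A]; last by rewrite andbF.
    rewrite big_pred0 // => A; apply/negbTE/negP => /andP[/eqP Ak /eqP eA].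
    by have := sedge_noneP E; rewrite eA; lia.
  have cE := sedge_card E.
  have [h|h] := eqVneq #|val A0| (k - 2 + j)%N.
    rewrite (big_pred1 (sedge_tgt e)) => [|A].
      rewrite [RHS](big_pred1 A0) // => A; rewrite (inj_eq Some_inj).
      by apply/andP/eqP => [[_ /eqP <-]//|->]; rewrite h !eqxx.
    apply/andP/eqP => [[_ /eqP <-]//|->]; rewrite eqxx.
    by split=> //; apply/eqP; lia.
  rewrite !big_pred0 // => A; apply/negbTE/negP => /andP[/eqP Ak /eqP eA].
    by case: eA => eA; rewrite eA Ak eqxx in h.
  by rewrite eA in cE; move/eqP: h; lia.
move=> A /eqP Ak; rewrite carries_out; congr (nat_of_bool _)%:R.
by rewrite (_ : #|val A| != k) ?andbT //; apply/eqP; lia.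
Qed.

Lemma carries_total : \sum_(e : sedge W k) (carries t e)%:R = 3 * n_used R W k.
Proof.
have -> : \sum_(e : sedge W k) (carries t e)%:R =
    \sum_(A : jnode W k) \sum_(e | sedge_tgt e == A) (carries t e)%:R :> R.
  by rewrite (partition_big (@sedge_tgt _ W k) predT).
rewrite (eq_bigr _ (fun A _ => carries_in A)).
rewrite (bigID (fun A : jnode W k => #|val A| == (k - 2)%N)) /=.
rewrite [X in _ + X](bigID (fun A : jnode W k => #|val A| == (k - 1)%N)) /=.
have := sum_on_way (leq0n 2); have := sum_on_way (leqnSn 1); have := sum_on_way (leqnn 2).
rewrite addn0 => s2 s1 s0.
rewrite s0 (eq_bigl (fun A : jnode W k => #|val A| == (k - 2 + 1)%N)) => [|A].
  rewrite s1 (eq_bigl (fun A : jnode W k => #|val A| == (k - 2 + 2)%N)) => [|A].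
    by rewrite s2; ring.
    by have /= := jnode_card A; lia.
  by have /= := jnode_card A; lia.
Qed.

Definition at_plug y (p : plug W k Iof) : bool :=
  [&& t.1 \in plug_set p, t.2 \in plug_set p & reads p y].

Lemma at_plug_node y A : \sum_(p : plug W k Iof | (val p).1 == A) (at_plug y p)%:R
  = (on_way A && (#|val A| == k))%:R :> R.
Proof.
apply: sum_indicator_unique.
- case/andP=> wA Ak.
  have h : (#|val A| == k) && (restr (Iof (val A)) (restr (Iof (val A)) y) == restr (Iof (val A)) y).
    by rewrite Ak; apply/eqP/ffunP => i; rewrite !ffunE andbA andbb.
  exists (exist _ (A, restr (Iof (val A)) y) h : plug W k Iof); first by rewrite eqxx.
  rewrite /at_plug /reads /plug_set /plug_val /= eqxx andbT.
  by move: wA; rewrite /on_way !ifF //; apply/negbTE; move/eqP: Ak; lia.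
- move=> p /eqP <- /and3P[h1 h2 _]; have /andP[h _] := valP p; rewrite h andbT.
  move/eqP: h => h; rewrite /on_way !ifF; first by rewrite h1 h2.
    by apply/negbTE; rewrite h; lia.
  by apply/negbTE; rewrite h; lia.
- move=> p p' /eqP pA /and3P[_ _ /eqP r] /eqP p'A /and3P[_ _ /eqP r'].
  apply: val_inj; rewrite [LHS]surjective_pairing [RHS]surjective_pairing pA p'A.
  by congr pair; rewrite -/(plug_val p) -/(plug_val p') -r -r' /plug_set pA p'A.
Qed.

Lemma at_plug_total y : \sum_(p : plug W k Iof) (at_plug y p)%:R = n_used R W k.
Proof.
rewrite (partition_big (fun p : plug W k Iof => (val p).1) predT) //=.
rewrite (eq_bigr _ (fun A _ => at_plug_node y A)) -(sum_on_way (leqnn 2)) [RHS]big_mkcond.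
apply: eq_bigr => A _; rewrite (_ : (k - 2 + 2)%N = k); last by lia.
by case: (_ == k); rewrite ?andbT ?andbF.
Qed.

End JohnsonFlow.

Lemma dense_load_C1E (R : realType) (I : finType) (S : {set I}) :
  dense_load_C1 R S = (#|S| != 0%N)%:R.
Proof.
rewrite /dense_load_C1 sumr_const card_ord expr1n div1r -[_ *+ _]mulr_natl.
by case: eqP => [->|/eqP h]; rewrite ?mul0r // divff // pnatr_eq0.
Qed.

(** * Incidence sums on subdivided super edges *)

Section PathSums.
Variables (R : realType) (E : finType) (m : E -> nat) (V : eqType).
Variables (s : E -> V) (inn : forall e, 'I_(m e) -> V) (h : forall n, 'I_n.+1).
Variable X : E -> R.

(** One definition serves both ends of the edges of a path: with [h] equal to [ord0] it is the
    source, with [ord_max] the target, [s] being the corresponding end of the super edge. *)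
Let node (p : {e : E & 'I_(m e).+1}) : V :=
  if unlift (h (m (tag p))) (tagged p) is Some i then inn i else s (tag p).

Lemma path_sum_end v : (forall e (i : 'I_(m e)), inn i != v) ->
  \sum_(p | node p == v) X (tag p) = \sum_(e | s e == v) X e.
Proof.
move=> inv; rewrite -(sig_big_dep xpredT (fun e (i : 'I_(m e).+1) =>
  node (Tagged _ i) == v) (fun e _ => X e)) [RHS]big_mkcond.
apply: eq_bigr => e _; rewrite /node /=; case: (boolP (s e == v)) => sv.
  rewrite (big_pred1 (h (m e))) // => i /=; case: unliftP => [j ->|->]; last by rewrite sv eqxx.
  by rewrite (negPf (inv _ _)) eq_sym (negPf (neq_lift _ _)).
by rewrite big_pred0 // => i; case: unliftP => [j _|_]; apply/negbTE.
Qed.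

Lemma path_sum_inner e0 (i0 : 'I_(m e0)) : (forall e, s e != inn i0) ->
  (forall e (i : 'I_(m e)), inn i = inn i0 ->
     Tagged (fun e => 'I_(m e)) i = Tagged (fun e => 'I_(m e)) i0) ->
  \sum_(p | node p == inn i0) X (tag p) = X e0.
Proof.
move=> sinn inj; rewrite -(sig_big_dep xpredT (fun e (i : 'I_(m e).+1) =>
  node (Tagged _ i) == inn i0) (fun e _ => X e)) /= (bigD1 e0) //=.
rewrite [X in _ + X]big1 ?addr0 => [|e ee0].
  rewrite (big_pred1 (lift (h (m e0)) i0)) // => i; rewrite /node /=.
  case: unliftP => [j ->|->]; last by rewrite (negPf (sinn _)) (negPf (neq_lift _ _)).
  rewrite (inj_eq lift_inj); apply/eqP/eqP => [/inj /eqP|->//].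
  by rewrite eq_Tagged => /eqP.
rewrite big_pred0 // => i; rewrite /node /=; case: unliftP => [j _|_]; last exact: negbTE.
by apply/negbTE; apply: contraNN ee0 => /eqP/inj ji; have /= -> := congr1 tag ji.
Qed.

End PathSums.

Section JohnsonRobust.
Variables (R : realType) (I T : finType) (F : bfun I) (W : {set T}) (k : nat).
Variables (Iof : {set T} -> {set I}) (target : input I -> option (T * T)).
Variables (f : {set T} -> input I -> bfun I) (G : forall A l, elg R (f A l)).

Let J := johnson F W k Iof target G.

Definition jn_main (o : option (jnode W k)) : vert J := inl o.
Definition jn_inner (e : sedge W k) (i : 'I_(#|sload Iof e|.-1)) : vert J :=
  inr (inl (Tagged (fun e : sedge W k => 'I_(#|sload Iof e|.-1) : Type) i)).
Definition jn_plug (p : plug W k Iof) (v : vert (plug_lg G p)) : vert J :=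
  inr (inr (Tagged (fun p : plug W k Iof => vert (plug_lg G p) : Type) v)).
Definition je_path (e : sedge W k) (i : 'I_(#|sload Iof e|.-1.+1)) : edge J :=
  inl (Tagged (fun e : sedge W k => 'I_(#|sload Iof e|.-1.+1) : Type) i).
Definition je_plug (p : plug W k Iof) (e : edge (plug_lg G p)) : edge J :=
  inr (inr (Tagged (fun p : plug W k Iof => edge (plug_lg G p) : Type) e)).

Hypothesis k_ge2 : (2 <= k)%N.
Hypothesis Iof_mono : forall A B : {set T}, A \subset B -> Iof A \subset Iof B.

Lemma jlabel_sub (e : sedge W k) :
  jlabel Iof (sedge_src e) \subset Iof (val (sedge_tgt e)).
Proof.
case E: (sedge_src e) => [A|] /=; last exact: sub0set.
by case: (sedge_someP E) => j _ ->; apply/Iof_mono/subsetUr.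
Qed.

Lemma label_src_path e i : label (src (@je_path e i)) =
  jlabel Iof (sedge_src e) :|: [set:: take i (enum (sload Iof e))].
Proof.
rewrite /= ; case: (unliftP ord0 i) => [j ->|->] /=; first by [].
by apply/setP => x; rewrite take0 !inE orbF.
Qed.

Lemma label_tgt_path e i : label (tgt (@je_path e i)) =
  jlabel Iof (sedge_src e) :|: [set:: take i.+1 (enum (sload Iof e))].
Proof.
rewrite /=; case: (unliftP ord_max i) => [j ->|->] /=.
  by rewrite /bump leqNgt ltn_ord.
rewrite take_enum_all ?leqSpred // /sload.
by rewrite setDE setUIr setUCr setIT; apply/esym/setUidPr/jlabel_sub.
Qed.

Lemma path_labels e i : label (src (@je_path e i)) = label (tgt (@je_path e i)) \/
  exists j, loads (@je_path e i) j.
Proof.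
rewrite /loads label_src_path label_tgt_path.
(* As [i] is below [#|sload Iof e|.-1.+1], the second case only occurs for an empty load, where the
   path is a single empty transition. *)
have [iS|Si] := ltnP i #|sload Iof e|; last first.
  by left; rewrite !take_enum_all // ltnW.
have [j [jS j1 j2]] := take_enum_load iS; right; exists j; split.
  by rewrite inE negb_or j1 andbT; move: jS; rewrite inE => /andP[].
by rewrite j2 setUCA.
Qed.

Lemma path_loading e i : loading (@je_path e i) -> (0 < #|sload Iof e|)%N.
Proof.
rewrite lt0n; apply: contraNN => /eqP h; rewrite label_src_path label_tgt_path.
have m0 j : (#|sload Iof e| <= j)%N by rewrite h.
by rewrite !take_enum_all.
Qed.

Lemma jn_main_inj : injective jn_main.
Proof. by move=> u v []. Qed.

Lemma jn_inner_inj e (i : 'I_(#|sload Iof e|.-1)) e0 (i0 : 'I_(#|sload Iof e0|.-1)) :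
  jn_inner i = jn_inner i0 ->
  Tagged (fun e : sedge W k => 'I_(#|sload Iof e|.-1)) i =
  Tagged (fun e : sedge W k => 'I_(#|sload Iof e|.-1)) i0.
Proof.
move=> h; apply: Some_inj.
exact: (congr1 (fun v : vert J => if v is inr (inl u) then Some u else None) h).
Qed.

Section JohnsonPathSums.
Variable X : sedge W k -> R.

Lemma path_in_root : \sum_(p : spath W k Iof | tgt (inl p : edge J) == jn_main None) X (tag p) = 0.
Proof.
have h e (i : 'I_(#|sload Iof e|.-1)) : jn_inner i != jn_main None by [].
have := @path_sum_end R (sedge W k) (fun e => #|sload Iof e|.-1) (vert J)
    (fun e => jn_main (Some (sedge_tgt e))) jn_inner (@ord_max) X (jn_main None) h.
rewrite [in X in _ = X -> _]big_pred0 //; apply.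
Qed.

Lemma path_in_main A :
  \sum_(p : spath W k Iof | tgt (inl p : edge J) == jn_main (Some A)) X (tag p) =
  \sum_(e | sedge_tgt e == A) X e.
Proof.
have h e (i : 'I_(#|sload Iof e|.-1)) : jn_inner i != jn_main (Some A) by [].
have := @path_sum_end R (sedge W k) (fun e => #|sload Iof e|.-1) (vert J)
    (fun e => jn_main (Some (sedge_tgt e))) jn_inner (@ord_max) X (jn_main (Some A)) h.
rewrite [in X in _ = X -> _](eq_bigl (fun e => sedge_tgt e == A)); first by apply.
by move=> e; rewrite (inj_eq jn_main_inj) (inj_eq Some_inj).
Qed.

Lemma path_out_main o :
  \sum_(p : spath W k Iof | src (inl p : edge J) == jn_main o) X (tag p) =
  \sum_(e | sedge_src e == o) X e.
Proof.
have h e (i : 'I_(#|sload Iof e|.-1)) : jn_inner i != jn_main o by [].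
have := @path_sum_end R (sedge W k) (fun e => #|sload Iof e|.-1) (vert J)
    (fun e => jn_main (sedge_src e)) jn_inner (@ord0) X (jn_main o) h.
rewrite [in X in _ = X -> _](eq_bigl (fun e => sedge_src e == o)); first by apply.
by move=> e; rewrite (inj_eq jn_main_inj).
Qed.

Lemma path_in_inner e0 (i0 : 'I_(#|sload Iof e0|.-1)) :
  \sum_(p : spath W k Iof | tgt (inl p : edge J) == jn_inner i0) X (tag p) = X e0.
Proof.
apply: (@path_sum_inner R (sedge W k) (fun e => #|sload Iof e|.-1) (vert J)
    (fun e => jn_main (Some (sedge_tgt e))) jn_inner (@ord_max) X) => // e i.
exact: jn_inner_inj.
Qed.

Lemma path_out_inner e0 (i0 : 'I_(#|sload Iof e0|.-1)) :
  \sum_(p : spath W k Iof | src (inl p : edge J) == jn_inner i0) X (tag p) = X e0.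
Proof.
apply: (@path_sum_inner R (sedge W k) (fun e => #|sload Iof e|.-1) (vert J)
    (fun e => jn_main (sedge_src e)) jn_inner (@ord0) X) => // e i.
exact: jn_inner_inj.
Qed.

Lemma path_in_plug p (v : vert (plug_lg G p)) :
  \sum_(q : spath W k Iof | tgt (inl q : edge J) == jn_plug v) X (tag q) = 0.
Proof.
transitivity (\sum_(e : sedge W k | jn_main (Some (sedge_tgt e)) == jn_plug v) X e).
  exact: (@path_sum_end R (sedge W k) (fun e => #|sload Iof e|.-1) (vert J)
    (fun e => jn_main (Some (sedge_tgt e))) jn_inner (@ord_max) X).
by rewrite big_pred0.
Qed.

Lemma path_out_plug p (v : vert (plug_lg G p)) :
  \sum_(q : spath W k Iof | src (inl q : edge J) == jn_plug v) X (tag q) = 0.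
Proof.
transitivity (\sum_(e : sedge W k | jn_main (sedge_src e) == jn_plug v) X e).
  exact: (@path_sum_end R (sedge W k) (fun e => #|sload Iof e|.-1) (vert J)
    (fun e => jn_main (sedge_src e)) jn_inner (@ord0) X).
by rewrite big_pred0.
Qed.

End JohnsonPathSums.

Hypothesis kW : (k <= #|W|)%N.

Lemma n_used_gt0 : 0 < n_used R W k.
Proof. by rewrite /n_used ltr0n bin_gt0 leq_sub2r. Qed.

Hypothesis G_robust : forall (A : {set T}) l, A \subset W -> #|A| = k ->
  restr (Iof A) l = l -> robust (G A l).

Lemma plug_robust (p : plug W k Iof) : robust (plug_lg G p).
Proof.
have /andP[/eqP h1 /eqP h2] := valP p.
by apply: G_robust => //; apply: jnode_sub.
Qed.

Section Absorbed.
Variables (y : input I) (t : T * T).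
Hypotheses (target_y : target y = Some t) (t1W : t.1 \in W) (t2W : t.2 \in W).
Hypothesis t12 : t.1 != t.2.

Let n := n_used R W k.
Let c (e : sedge W k) : R := (carries t e)%:R / n.

Let c_root : \sum_(e | sedge_src e == None) c e = 1.
Proof. by rewrite /c -mulr_suml carries_root // divff // gt_eqF // n_used_gt0. Qed.

Let c_in A : \sum_(e | sedge_tgt e == A) c e = (on_way t A)%:R / n.
Proof. by rewrite /c -mulr_suml carries_in. Qed.

Let c_out A : \sum_(e | sedge_src e == Some A) c e =
  (on_way t A && (#|val A| != k))%:R / n.
Proof. by rewrite /c -mulr_suml carries_out. Qed.

Let in_flow v := \sum_(p : spath W k Iof | tgt (inl p : edge J) == v) c (tag p).
Let out_flow v := \sum_(p : spath W k Iof | src (inl p : edge J) == v) c (tag p).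
Let plug_flow (q : {p : plug W k Iof & edge (plug_lg G p)}) : R :=
  (at_plug t y (tag q))%:R / n * flow y (tagged q).

Lemma johnson_absorbedE v : absorbed y v = (v == jn_main None)%:R +
  (in_flow v +
   (\sum_(p : plug W k Iof | jn_plug (Defs.root (plug_lg G p)) == v) (at_plug t y p)%:R / n +
    \sum_(q | jn_plug (tgt (tagged q)) == v) plug_flow q)) -
  (out_flow v +
   (\sum_(p : plug W k Iof | jn_main (Some (val p).1) == v) (at_plug t y p)%:R / n +
    \sum_(q | jn_plug (src (tagged q)) == v) plug_flow q)).
Proof.
rewrite /absorbed !big_sumType; congr (_ + (_ + (_ + _)) - (_ + (_ + _)));
  by apply: eq_bigr => p _; rewrite /= target_y.
Qed.

Lemma johnson_absorbed_root : absorbed y (jn_main None) = 0.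
Proof.
rewrite johnson_absorbedE eqxx /in_flow /out_flow path_in_root path_out_main c_root.
by rewrite !big_pred0 // !addr0 subrr.
Qed.

(** What enters a subset on the way leaves by a super edge below level [k], and at level [k] by the
    transition to the one plugged graph that [y] reads. *)
Lemma johnson_absorbed_main A : absorbed y (jn_main (Some A)) = 0.
Proof.
rewrite johnson_absorbedE /in_flow /out_flow path_in_main path_out_main c_in c_out.
rewrite [X in _ + (_ + (X + _)) - _]big_pred0 // [X in _ + (_ + (_ + X)) - _]big_pred0 //.
rewrite [X in _ - (_ + (_ + X))]big_pred0 // !addr0.
rewrite (_ : (jn_main (Some A) == jn_main None) = false) // add0r.
rewrite (eq_bigl (fun p : plug W k Iof => (val p).1 == A)) //.
rewrite -mulr_suml at_plug_node // -mulrDl -mulrBl.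
by case: (on_way t A); case: (_ == k); rewrite /= ?addr0 ?add0r ?subrr ?oppr0 mul0r.
Qed.

Lemma johnson_absorbed_inner e (i : 'I_(#|sload Iof e|.-1)) : absorbed y (jn_inner i) = 0.
Proof.
rewrite johnson_absorbedE /in_flow /out_flow path_in_inner path_out_inner.
by rewrite (_ : (jn_inner i == jn_main None) = false) // !big_pred0 // !addr0 add0r subrr.
Qed.

Lemma johnson_absorbed_plug p (v : vert (plug_lg G p)) :
  absorbed y (jn_plug v) = (at_plug t y p)%:R / n * absorbed y v.
Proof.
rewrite johnson_absorbedE /in_flow /out_flow path_in_plug path_out_plug.
rewrite [X in _ - (_ + (X + _))]big_pred0 //.
have aux (a b d : R) : false%:R + (0 + (a + b)) - (0 + (0 + d)) = a + b - d.
  by rewrite !add0r.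
rewrite (_ : (jn_plug v == jn_main None) = false) // aux.
have tgtE := big_tag_fiber (fun p (e : edge (plug_lg G p)) => tgt e)
   (fun p e => (at_plug t y p)%:R / n * flow y e) v.
have srcE := big_tag_fiber (fun p (e : edge (plug_lg G p)) => src e)
   (fun p e => (at_plug t y p)%:R / n * flow y e) v.
rewrite [X in _ + X - _]tgtE [X in _ - X]srcE /absorbed.
rewrite mulrBr mulrDr !mulr_sumr; congr (_ + _ - _).
rewrite big_mkcond (bigD1 p) //= big1 ?addr0 => [|q qp].
  rewrite (_ : (_ == _) = (Defs.root (plug_lg G p) == v)); last exact: eq_Tagged.
  by rewrite eq_sym; case: eqP => _; rewrite ?mulr1 ?mulr0.
by case: eqP => // -[] h; rewrite h eqxx in qp.
Qed.

End Absorbed.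

(** Levels are spaced by [#|I|.+1], more than the number of inner vertices of any path, and the
    plugged graphs are ranked above the last level, which has rank at most [3 * #|I|.+1]. *)
Lemma johnson_ranked : exists r : vert J -> nat, forall e, (r (src e) < r (tgt e))%N.
Proof.
have [r hr] := fin_all_exists (fun p : plug W k Iof => robust_rank (plug_robust p)).
pose base (o : option (jnode W k)) :=
  if o is Some A then ((#|val A| - (k - 2)).+1 * #|I|.+1)%N else 0%N.
have base_step (e : sedge W k) :
    (base (sedge_src e) + #|I|.+1 <= base (Some (sedge_tgt e)))%N.
  case E: (sedge_src e) => [A|]; last by rewrite add0n leq_pmull.
  have cE := sedge_card E; have cA := jnode_card A.
  by rewrite /base cE subSn ?[X in (_ <= X)%N]mulSn 1?addnC //; case/andP: cA.
have base_le A : (base (Some A) <= 3 * #|I|.+1)%N.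
  by rewrite leq_mul2r; have := jnode_card A; lia.
have sload_le (e : sedge W k) : (#|sload Iof e|.-1 < #|I|.+1)%N.
  by have h : (#|sload Iof e| <= #|I|)%N := max_card _; lia.
exists (fun v : vert J => match v with
  | inl o => base o
  | inr (inl u) => (base (sedge_src (tag u)) + (tagged u).+1)%N
  | inr (inr u) => (3 * #|I|.+1 + (r (tag u) (tagged u)).+1)%N end).
move=> [[e i]|[p|[p e]]].
- have := base_step e; have := sload_le e; have iM := ltn_ord i.
  rewrite [src _]/= [tgt _]/=.
  have -> : match (if unlift ord0 i is Some i0 then jn_inner i0 else jn_main (sedge_src e)) with
    | inl o => base o
    | inr (inl u) => (base (sedge_src (tag u)) + (tagged u).+1)%N
    | inr (inr u) => (3 * #|I|.+1 + (r (tag u) (tagged u)).+1)%N end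
    = (base (sedge_src e) + i)%N.
    by case: (unliftP ord0 i) => [j ->|->] //=; rewrite addn0.
  case: (unliftP ord_max i) => [j ->|_]; last by rewrite /=; lia.
  by rewrite lift_max /=; lia.
- by apply: leq_ltn_trans (base_le _) _; rewrite -addn1 leq_add2l.
- by rewrite /= ltn_add2l ltnS; apply: hr.
Qed.

Lemma johnson_edge_inj : injective (fun e : edge J => (src e, tgt e)).
Proof.
pose p_main (v : vert J) := if v is inl o then Some o else None.
pose p_plug (v : vert J) := if v is inr (inr u) then Some u else None.
move=> a b h; have h1 := congr1 fst h; have h2 := congr1 snd h.
move: a b h1 h2 {h} => [[e i]|[p|[p e]]] [[e' i']|[p'|[p' e']]].
- rewrite [fst _]/= [X in _ = X]/= => h1 h2; congr inl.
  have {}h1 : (if unlift ord0 i is Some i0 then jn_inner i0 else jn_main (sedge_src e)) =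
    (if unlift ord0 i' is Some i0 then jn_inner i0 else jn_main (sedge_src e')) by exact: h1.
  have {}h2 : (if unlift ord_max i is Some i0 then jn_inner i0 else jn_main (Some (sedge_tgt e))) =
    (if unlift ord_max i' is Some i0 then jn_inner i0 else jn_main (Some (sedge_tgt e'))) by exact: h2.
  pose up (x : forall n, 'I_n.+1) (u : {e : sedge W k & 'I_(#|sload Iof e|.-1)}) :=
    Tagged (fun e : sedge W k => 'I_(#|sload Iof e|.-1.+1) : Type) (lift (x _) (tagged u)).
  case: (unliftP ord0 i) h1 => [j ->|i0]; case: (unliftP ord0 i') => [j' ->|i'0] h1 //.
    exact: (congr1 (up (@ord0)) (jn_inner_inj h1)).
  case: (unliftP ord_max i) h2 => [j ->|i1]; case: (unliftP ord_max i') => [j' ->|i'1] h2 //.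
    exact: (congr1 (up (@ord_max)) (jn_inner_inj h2)).
  (* Here both paths are single edges between main vertices, and a super edge is determined by its
     ends. *)
  have [se] := congr1 p_main h1; have [te] := congr1 p_main h2.
  have ee : e = e' by apply: sedge_ext.
  by move: i' i'0 {h1 h2 i'1 se te}; rewrite -ee i0 => i' ->.
- rewrite /= => _; case: unlift => //.
- by rewrite /=; case: unlift.
- by rewrite /= => _; case: unlift.
- move=> _ h2; have [] := congr1 p_plug h2 => h _.
  by congr (inr (inl _)).
- by [].
- by rewrite /=; case: unlift.
- by [].
- move=> h1 h2.
  have [pp] := congr1 (omap (fun u : {p : plug W k Iof & vert (plug_lg G p)} => tag u)) (congr1 p_plug h1).
  move: pp e' h1 h2 => /= <- e' h1 h2; congr (inr (inr _)); congr Tagged.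
  apply: (robust_inj (plug_robust p)); congr pair; apply/eqP.
    by have /eqP := congr1 p_plug h1; rewrite (inj_eq Some_inj) eq_Tagged.
  by have /eqP := congr1 p_plug h2; rewrite (inj_eq Some_inj) eq_Tagged.
Qed.

Lemma johnson_connect (v : vert J) : connect (@Defs.arc _ _ _ J) (Defs.root J) v.
Proof.
have step (e : edge J) : connect (@Defs.arc _ _ _ J) (src e) (tgt e).
  by apply: connect1; apply/existsP; exists e; rewrite !eqxx.
have path_src (e : sedge W k) : connect (@Defs.arc _ _ _ J) (Defs.root J) (jn_main (sedge_src e)) ->
    forall i, connect (@Defs.arc _ _ _ J) (Defs.root J) (src (@je_path e i)).
  move=> base i; have [n ni] : exists n, nat_of_ord i = n by exists i.
  elim: n i ni => [|n IH] i ni.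
    rewrite [src _]/= (_ : unlift ord0 i = None) //.
    by rewrite (_ : i = ord0) ?unlift_none //; apply: val_inj.
  case: (unliftP ord0 i) ni => [j ->|->] // nj.
  have jn : nat_of_ord (lift ord_max j) = n by rewrite lift_max; move: nj; rewrite lift0 => -[].
  have := connect_trans (IH _ jn) (step (je_path (lift ord_max j))).
  by rewrite [tgt _]/= liftK [src (je_path (lift _ _))]/= liftK.
have path_tgt (e : sedge W k) : connect (@Defs.arc _ _ _ J) (Defs.root J) (jn_main (sedge_src e)) ->
    connect (@Defs.arc _ _ _ J) (Defs.root J) (jn_main (Some (sedge_tgt e))).
  move=> base; have := connect_trans (path_src e base ord_max) (step (je_path ord_max)).
  by rewrite [tgt _]/= unlift_none.
have main o : connect (@Defs.arc _ _ _ J) (Defs.root J) (jn_main o).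
  case: o => [A|]; last exact: connect0.
  have [n An] : exists n, (#|val A| = k - 2 + n)%N.
    by exists (#|val A| - (k - 2))%N; have := jnode_card A; lia.
  elim: n A An => [|n IH] A An.
    have [|e [se te]] := @sedge_mk _ W k None A; first by rewrite /sedge_ok An addn0 eqxx.
    by rewrite -te; apply: path_tgt; rewrite se; exact: connect0.
  have [x xA] : exists x, x \in val A by apply/set0Pn; rewrite -card_gt0 An addnS.
  have cA : #|val A| = #|val A :\ x|.+1 by rewrite (cardsD1 x) xA.
  have [||A0 A0E] := @jnodeP _ W k (val A :\ x).
  - by apply: subset_trans (jnode_sub A); apply: subD1set.
  - by have := jnode_card A; lia.
  have [|e [se te]] := @sedge_mk _ W k (Some A0) A.
    apply/existsP; exists x; rewrite inE A0E !inE eqxx /= setD1K // eqxx andbT.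
    exact: (subsetP (jnode_sub A)).
  by rewrite -te; apply: path_tgt; rewrite se; apply: IH; rewrite A0E; lia.
case: v => [o|[[e i]|[p v]]]; first exact: main.
  have := path_src e (main _) (lift ord0 i).
  by rewrite [src _]/= liftK.
apply: connect_trans (main (Some (val p).1)) _.
apply: connect_trans (step (inr (inl p) : edge J)) _.
apply: (connect_homo (h := @jn_plug p)) (robust_connect (plug_robust p) v) => u u'.
case/existsP=> e /andP[/eqP <- /eqP <-].
by apply/existsP; exists (je_plug e); rewrite !eqxx.
Qed.

Hypothesis targetP : forall y, F y = Some true -> exists t,
  [/\ target y = Some t, t.1 \in W, t.2 \in W, t.1 != t.2
    & forall A : {set T}, A \subset W -> #|A| = k -> t.1 \in A -> t.2 \in A ->
        f A (restr (Iof A) y) y = Some true].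
Hypothesis cert : forall (A : {set T}) y S, A \subset W -> F y = Some true ->
  f A (restr (Iof A) y) y = Some true ->
  certificate (f A (restr (Iof A) y)) y S -> certificate F y (Iof A :|: S).

Lemma at_plugP y t (p : plug W k Iof) :
  (forall A : {set T}, A \subset W -> #|A| = k -> t.1 \in A -> t.2 \in A ->
        f A (restr (Iof A) y) y = Some true) ->
  at_plug t y p -> f (plug_set p) (plug_val p) y = Some true.
Proof.
move=> h /and3P[h1 h2 /eqP <-]; have /andP[/eqP kp _] := valP p.
exact: h (jnode_sub _) kp h1 h2.
Qed.

Lemma johnson_robust : robust J.
Proof.
have root0 (p : plug W k Iof) : label (Defs.root (plug_lg G p)) = set0.
  by case: (robust_labels (plug_robust p)).
split.
- exact: johnson_ranked.
- exact: johnson_edge_inj.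
- exact: johnson_connect.
- split=> // -[[e i]|[p|[p e]]].
  + exact: path_labels.
  + by left; rewrite /= root0 setU0.
  + case: (robust_labels (plug_robust p)) => _ /(_ e) [h|[j [h1 h2]]]; first by left; rewrite /= h.
    rewrite /loads /= h2; have [jA|jA] := boolP (j \in Iof (plug_set p)).
      by left; apply/setP => x; rewrite !inE; case: eqP => [->|]; rewrite ?jA.
    by right; exists j; rewrite inE negb_or jA h1 setUCA.
- move=> b z [[e i]|[p|[p e]]] //=.
    by rewrite mulr_ge0 ?divr_ge0 ?ler0n // dense_load_C1E ler0n.
  by rewrite !mulr_ge0 ?ler0n ?invr_ge0 ?ler0n ?C1_ge0 // (robust_weight_ge0 (plug_robust p)).
- move=> b b' z z' [[e i]|[p|[p e]]] //= h.
  have h1 := restr_sub (subsetUl _ _) h; have h2 := restr_sub (subsetUr _ _) h.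
  rewrite /reads h1; congr (_ * (_ * _)).
  exact: (robust_weight (plug_robust p)).
move=> y Fy; have [t [ty t1W t2W t12 ft]] := targetP Fy.
have n0 := n_used_gt0.
split.
- move=> [[e i]|[p|[p e]]] /=; rewrite ty; rewrite ?divr_ge0 ?ler0n //.
  rewrite -/(at_plug t y p); case: (boolP (at_plug t y p)) => [/(at_plugP ft) fp|_].
    rewrite mulr_ge0 ?divr_ge0 ?ler0n //.
    by case: (robust_flows (plug_robust p) fp).
  by rewrite !mul0r.
- case=> [[A|]|[[e i]|[p v]]].
  + by rewrite (johnson_absorbed_main ty).
  + by rewrite (johnson_absorbed_root ty).
  + by rewrite (johnson_absorbed_inner ty).
  + rewrite (johnson_absorbed_plug ty).
    case: (boolP (at_plug t y p)) => [/(at_plugP ft) fp|_]; last by rewrite !mul0r.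
    rewrite mulr_ge0 ?divr_ge0 ?ler0n //.
    by case: (robust_flows (plug_robust p) fp).
- move=> [[e i]|[p|[p e]]].
  + move=> /path_loading m0 /eqP; rewrite /= dense_load_C1E -lt0n m0 mul1r.
    by rewrite mulf_eq0 invr_eq0 gt_eqF //= pnatr_eq0 gtn_eqF.
  + by rewrite /loading /= root0 setU0 eqxx.
  + rewrite /loading /= ty -/(at_plug t y p) => le w0.
    case: (boolP (at_plug t y p)) => [tp|_]; last by rewrite !mul0r.
    have rp : reads p y by case/and3P: tp.
    rewrite (robust_flow_eq0 (plug_robust p) (at_plugP ft tp)) ?mulr0 //.
      by rewrite /loading; apply: contraNN le => /eqP ->.
    by move/eqP: w0; rewrite rp mul1r mulrAC mulf_eq0 invr_eq0 (gt_eqF n0) orbF => /eqP.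
- case=> [[A|]|[[e i]|[p v]]].
  + by rewrite (johnson_absorbed_main ty) // ltxx.
  + by rewrite (johnson_absorbed_root ty) // ltxx.
  + by rewrite (johnson_absorbed_inner ty) // ltxx.
  + rewrite (johnson_absorbed_plug ty) //.
    case: (boolP (at_plug t y p)) => [tp|_]; last by rewrite !mul0r ltxx.
    rewrite mul1r pmulr_rgt0 ?invr_gt0 //.
    have fp := at_plugP ft tp; have rp : reads p y by case/and3P: tp.
    have c S : f (plug_set p) (plug_val p) y = Some true ->
        certificate (f (plug_set p) (plug_val p)) y S ->
        certificate F y (Iof (plug_set p) :|: S).
      by rewrite -(eqP rp); apply: cert => //; apply: jnode_sub.
    by case: (robust_flows (plug_robust p) fp) => _ _ _ h /h; apply: c.
Qed.

(** Write N for [n_used]. A carrying super edge with a load of size m > 0 consists of m edges with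
    flow 1/N and weight m/N, so it costs 1/N. Each of the three stages has N carrying super edges
    and contributes at most 1. The plugged graphs contribute at most 1, as in an OR. *)
Lemma johnson_C1_at y : F y = Some true -> C1_at J y <= 4.
Proof.
move=> Fy; have [t [ty t1W t2W t12 ft]] := targetP Fy.
have n0 := n_used_gt0; set n := n_used R W k in n0.
have nE : n != 0 by rewrite gt_eqF.
rewrite /C1_at !big_sumType /= [X in _ + (X + _)]big1; last first.
  by move=> p _; rewrite invr0 mulr0.
rewrite add0r (_ : 4 = 3 + 1 :> R); last by ring.
apply: lerD.
  apply: (@le_trans _ _ (\sum_(p : spath W k Iof) ((carries t (tag p))%:R / n) ^+ 2 /
      (dense_load_C1 R (sload Iof (tag p)) / n * #|sload Iof (tag p)|%:R))).
    rewrite [X in X <= _]big_mkcond; apply: ler_sum => p _; rewrite /= ty.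
    case: ifP => // _; rewrite divr_ge0 ?sqr_ge0 // mulr_ge0 ?ler0n //.
    by rewrite divr_ge0 ?ler0n // dense_load_C1E ler0n.
  rewrite -(sig_big_dep xpredT (fun (e : sedge W k) (i : 'I_(#|sload Iof e|.-1.+1)) => true)
    (fun e _ => ((carries t e)%:R / n) ^+ 2 /
      (dense_load_C1 R (sload Iof e) / n * #|sload Iof e|%:R))) /=.
  apply: (@le_trans _ _ (\sum_(e : sedge W k) (carries t e)%:R / n)).
    apply: ler_sum => e _; rewrite sumr_const card_ord dense_load_C1E.
    have [->|m0] := eqVneq #|sload Iof e| 0%N.
      by rewrite mulr0 invr0 mulr0 mul0rn divr_ge0 ?ler0n.
    rewrite prednK ?lt0n // -mulr_natr.
    have mE : #|sload Iof e|%:R != 0 :> R by rewrite pnatr_eq0.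
    rewrite le_eqVlt; apply/orP; left; apply/eqP.
    by case: (carries t e); rewrite /= ?mul0r ?expr0n ?mul0r //=; field; rewrite mE nE.
  by rewrite -mulr_suml carries_total // mulfK.
apply: (@le_trans _ _ (\sum_(p : plug W k Iof) (at_plug t y p)%:R / n)); last first.
  by rewrite -mulr_suml at_plug_total // divff.
pose w (p : plug W k Iof) (e : edge (plug_lg G p)) : R :=
  ((at_plug t y p)%:R / n * flow y e) ^+ 2 /
  ((reads p y)%:R * (C1 (plug_lg G p) / n * weight true y e)).
have w_ge0 p e : 0 <= w p e.
  have h := robust_weight_ge0 (plug_robust p) true y e.
  by rewrite divr_ge0 ?sqr_ge0 // mulr_ge0 ?ler0n // mulr_ge0 // divr_ge0 ?(ltW n0) ?C1_ge0.
(* Enlarging the labels by [Iof A] can only turn loading edges into empty transitions, so summing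
   over the edges that load in the component gives an upper bound. *)
apply: (@le_trans _ _ (\sum_(q : {p : plug W k Iof & edge (plug_lg G p)} |
    loading (tagged q)) w (tag q) (tagged q))).
  rewrite [X in X <= _]big_mkcond [X in _ <= X]big_mkcond.
  apply: ler_sum => -[p e] _; rewrite /loading /= ty.
  case: ifP => le; case: ifP => // /negbFE/eqP h.
  by rewrite h eqxx in le.
rewrite -(sig_big_dep xpredT (fun p (e : edge (plug_lg G p)) => loading e) w) /=.
apply: ler_sum => p _; case: (boolP (at_plug t y p)) => tp; last first.
  rewrite big1 ?mul0r // => e _; rewrite /w (negPf tp) !mul0r expr0n mul0r //.
have fp := at_plugP ft tp; have rp : reads p y by case/and3P: tp.
rewrite (eq_bigr (fun e => n^-1 * (C1 (plug_lg G p))^-1 *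
    (flow y e ^+ 2 / weight true y e))) => [|e _]; last first.
  rewrite /w tp rp !mul1r exprMn !invfM invrK exprVn.
  by set u := (weight _ _ _)^-1; set c := (C1 _)^-1; field.
rewrite -mulr_sumr -mulrA mul1r -[X in _ <= X]mulr1 ler_wpM2l ?invr_ge0 ?(ltW n0) //.
have [->|c0] := eqVneq (C1 (plug_lg G p)) 0; first by rewrite invr0 mul0r ler01.
rewrite mulrC ler_pdivrMr ?mul1r; first exact: C1_at_le.
by rewrite lt_neqAle eq_sym c0 C1_ge0.
Qed.

Lemma johnson_C1 : C1 J <= 4.
Proof. by apply: C1_le => // y; apply: johnson_C1_at. Qed.

(** A load of size m is a path of m edges of weight m / [n_used], hence the square. Among the graphs
    plugged at a subset, only the one read by [x] has nonzero weights. *)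
Lemma johnson_C0_at x : C0_at J x <=
  \sum_(e : sedge W k) #|sload Iof e|%:R ^+ 2 / n_used R W k +
  \sum_(A : {set T} | (A \subset W) && (#|A| == k))
     C1 (G A (restr (Iof A) x)) / n_used R W k * C0_at (G A (restr (Iof A) x)) x.
Proof.
have n0 := n_used_gt0; set n := n_used R W k in n0 *.
rewrite /C0_at !big_sumType /= [X in _ + (X + _)]big1 // add0r; apply: lerD.
  apply: (@le_trans _ _ (\sum_(p : spath W k Iof)
      (dense_load_C1 R (sload Iof (tag p)) / n * #|sload Iof (tag p)|%:R))).
    rewrite [X in X <= _]big_mkcond; apply: ler_sum => p _ /=.
    case: ifP => // _; rewrite mulr_ge0 ?ler0n //.
    by rewrite divr_ge0 ?(ltW n0) // dense_load_C1E ler0n.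
  rewrite -(sig_big_dep xpredT (fun (e : sedge W k) (i : 'I_(#|sload Iof e|.-1.+1)) => true)
    (fun e _ => dense_load_C1 R (sload Iof e) / n * #|sload Iof e|%:R)) /=.
  apply: ler_sum => e _; rewrite sumr_const card_ord dense_load_C1E.
  have [->|m0] := eqVneq #|sload Iof e| 0%N.
    by rewrite mulr0 mul0rn expr0n mul0r.
  rewrite prednK ?lt0n // -[X in X <= _]mulr_natr (_ : true%:R = 1 :> R) //.
  by rewrite le_eqVlt; apply/orP; left; apply/eqP; field; rewrite gt_eqF.
rewrite -(sum_reads W k Iof x (fun (A : {set T}) l => C1 (G A l) / n * C0_at (G A l) x)).
apply: (@le_trans _ _ (\sum_(q : {p : plug W k Iof & edge (plug_lg G p)} |
    loading (tagged q)) (reads (tag q) x)%:R *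
       (C1 (plug_lg G (tag q)) / n * weight false x (tagged q)))).
  rewrite [X in X <= _]big_mkcond [X in _ <= X]big_mkcond.
  apply: ler_sum => -[p e] _; rewrite /loading /=.
  case: ifP => le; case: ifP => h //.
    by move/negbFE/eqP: h => h; rewrite h eqxx in le.
  have w0 := robust_weight_ge0 (plug_robust p) false x e.
  by rewrite mulr_ge0 ?ler0n // mulr_ge0 // divr_ge0 ?(ltW n0) ?C1_ge0.
rewrite -(sig_big_dep xpredT (fun p (e : edge (plug_lg G p)) => loading e)
  (fun p e => (reads p x)%:R * (C1 (plug_lg G p) / n * weight false x e))) /=.
apply: ler_sum => p _; rewrite /C0_at !mulr_sumr le_eqVlt; apply/orP; left.
by apply/eqP; apply: eq_bigr => e _.
Qed.

End JohnsonRobust.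

(** * The learning graph for Triangle *)

Section TriangleValidity.
Variables (R : realType) (n : nat).
Implicit Types (z y l m : graph n) (u v w t p q : 'I_n) (X A B : {set 'I_n}) (e : upair n).

Lemma adjE z u v e : val e = [set u; v] -> adj z u v = z e.
Proof.
move=> eE; apply/existsP/idP => [[e' /andP[/eqP e'E]]|ze].
  by rewrite (_ : e' = e) //; apply: val_inj; rewrite e'E eE.
by exists e; rewrite eE eqxx.
Qed.

Lemma adj_pair z u v : adj z u v -> exists2 e, val e = [set u; v] & z e.
Proof. by case/existsP=> e /andP[/eqP h1 h2]; exists e. Qed.

Lemma adj_sym z u v : adj z u v = adj z v u.
Proof. by rewrite /adj setUC. Qed.

Lemma adj_neq z u v : adj z u v -> u != v.
Proof.
case/adj_pair=> e eE _; apply: contraTneq (valP e) => uv.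
by rewrite eE uv setUid cards1.
Qed.

Lemma upairP e : exists u v, u != v /\ val e = [set u; v].
Proof. by have /cards2P[u [v [uv eE]]] := valP e; exists u, v. Qed.

Lemma upair_of u v : u != v -> exists e, val e = [set u; v].
Proof.
move=> uv; have h : #|[set u; v]| == 2%N by rewrite cards2 uv.
by exists (exist _ [set u; v] h).
Qed.

Lemma adj_le z z' u v : (forall e, z e -> z' e) -> adj z u v -> adj z' u v.
Proof. by move=> h /adj_pair[e eE ze]; rewrite (adjE _ eE) h. Qed.

Lemma betweenP X A e :
  reflect (exists u v, [/\ u \in X, v \in A & val e = [set u; v]]) (e \in between X A).
Proof.
rewrite inE; apply: (iffP existsP) => [[u /andP[uX /existsP[v /andP[vA /eqP h]]]]|].
  by exists u, v.
move=> [u [v [uX vA h]]]; exists u; rewrite uX; apply/existsP; exists v.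
by rewrite vA h eqxx.
Qed.

Lemma between_mono X A B : A \subset B -> between X A \subset between X B.
Proof.
move=> /subsetP AB; apply/subsetP => e /betweenP[u [v [uX vA h]]].
by apply/betweenP; exists u, v; rewrite (AB v).
Qed.

Lemma bfun_on_true (Z f : pred (graph n)) z :
  bfun_on Z f z = Some true <-> Z z /\ f z.
Proof. by rewrite /bfun_on; case: (Z z); case: (f z); split=> // -[]. Qed.

Lemma bfun_on_dom (Z f : pred (graph n)) z : bfun_on Z f z != None -> Z z.
Proof. by rewrite /bfun_on; case: (Z z). Qed.

Lemma bfun_on_in (Z f : pred (graph n)) z : Z z -> bfun_on Z f z != None.
Proof. by rewrite /bfun_on => ->. Qed.

Lemma restrU (S S' : {set upair n}) z z' :
  restr (S :|: S') z = restr (S :|: S') z' ->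
  restr S z = restr S z' /\ restr S' z = restr S' z'.
Proof. by move=> h; split; apply: restr_sub h; rewrite ?subsetUl ?subsetUr. Qed.

Lemma tri_pairs_triangle y t u v e e' : is_triangle y t u v ->
  val e = [set u; v] -> e' \in tri_pairs t e -> y e'.
Proof.
move=> /and3P[tu uv tv] eE; rewrite inE eE => /subsetP sub.
have [p [q [pq e'E]]] := upairP e'; rewrite -(adjE _ e'E).
have := sub p; have := sub q; rewrite e'E !inE !eqxx orbT /= => /(_ isT) hq /(_ isT) hp.
by case/or3P: hp pq => /eqP ->; case/or3P: hq => /eqP ->; rewrite ?eqxx // adj_sym.
Qed.

Lemma triangle_tri_pairs y t u v e : u != v -> val e = [set u; v] -> t \notin val e ->
  (forall e', e' \in tri_pairs t e -> y e') -> is_triangle y t u v.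
Proof.
move=> uv eE; rewrite eE !inE negb_or => /andP[tu tv] h.
have edge p q : p != q -> p \in [set t; u; v] -> q \in [set t; u; v] -> adj y p q.
  move=> pq pD qD; have [e' e'E] := upair_of pq; rewrite (adjE _ e'E).
  apply: h; rewrite inE e'E eE; apply/subsetP => r; rewrite !inE in pD qD *.
  by case/orP=> /eqP ->; rewrite ?orbA in pD qD *.
by rewrite /is_triangle !edge // !inE eqxx ?orbT.
Qed.

Lemma H_vertex_robust t : robust (H_vertex R t).
Proof.
apply: or_robust; first by [].
- move=> [e te]; apply: dense_load_robust => y [/forallP h] z _ /eqP/restr_eqP zy.
  congr Some; apply/forallP => e'; apply/implyP => e'T; rewrite (zy _ e'T).
  exact: (implyP (h e')).
- move=> [e te] y S _ _ /= cert z _ zy.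
  have [/forallP h] := cert z isT zy.
  have [u [v [uv eE]]] := upairP e.
  congr Some; apply/existsP; exists u; apply/existsP; exists v.
  by apply: (triangle_tri_pairs uv eE te) => e' e'T; apply: (implyP (h e')).
- move=> y [/existsP[u /existsP[v tri]]].
  have /and3P[tu uv tv] := tri; have [e eE _] := adj_pair uv.
  have te : t \notin val e by rewrite eE !inE negb_or (adj_neq tu) (adj_neq tv).
  apply/card_gt0P; exists (exist _ e te); rewrite inE; apply/eqP; congr Some.
  by apply/forallP => e'; apply/implyP; apply: tri_pairs_triangle tri eE.
Qed.

Lemma H_robust X : robust (H_lg R X).
Proof.
apply: or_robust; first by [].
- by move=> p; apply: H_vertex_robust.
- move=> [t tX] y S _ _ cert z _ zy.
  have [h] := cert z isT zy.
  by congr Some; apply/existsP; exists t; rewrite tX.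
- move=> y [/existsP[t /andP[tX h]]].
  by apply/card_gt0P; exists (exist _ t tX); rewrite inE; apply/eqP; congr Some.
Qed.

Section NoVertexInX.
Variables (a b : nat) (X : {set 'I_n}).

Lemma known_le z S S' e : known (restr S z) (restr S' z) e -> z e.
Proof. by rewrite !ffunE => /orP[] /andP[]. Qed.

(** A present edge of [Delta] closes a triangle with [w], because the loaded pairs show both its
    ends adjacent to [w]. Conversely the edge opposite [w] in a triangle lies in [Delta]: a common
    neighbour of its ends in [X] would give a triangle with a vertex in [X], which the domain
    excludes. *)
Lemma FB_robust A l w B m : robust (FB_lg R X A l w B m).
Proof.
apply: or_robust; first by [].
- move=> [e eD]; apply: dense_load_robust => y /bfun_on_true[_ ye] z dz /eqP/restr_eqP zy.
  by apply/bfun_on_true; split; [exact: bfun_on_dom dz | rewrite (zy e) ?inE].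
- move=> [e eD] y S _ _ cert z dz zy.
  have dz' := bfun_on_dom dz; have /bfun_on_true[_ /= ze] := cert z (bfun_on_in _ dz') zy.
  apply/bfun_on_true; split=> //.
  have /andP[/andP[_ /eqP lE] /eqP mE] := dz'.
  have := eD; rewrite inE => /existsP[u /andP[uB /existsP[v /andP[vB]]]].
  case/and4P=> /eqP eE _; rewrite !inE => uw vw.
  apply/existsP; exists u; rewrite uB; apply/existsP; exists v; rewrite vB /=.
  rewrite -lE -mE in uw vw.
  have le e' := @known_le z (between X A) (between [set w] B) e'.
  rewrite /is_triangle (adjE _ eE) ze (adj_sym z v w) (adj_sym z u w).
  by rewrite !(adj_le le).
- move=> y /bfun_on_true[dy /existsP[u /andP[uB /existsP[v /andP[vB tri]]]]].
  have /andP[/andP[domy /eqP lE] /eqP mE] := dy.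
  have /and3P[uv vw uw] := tri; have [e eE ye] := adj_pair uv.
  have le e' := @known_le y (between X A) (between [set w] B) e'.
  have inm q : q \in B -> adj y q w -> q \in nbh (known l m) w.
    move=> qB qw; have [e' e'E ye'] := adj_pair qw; rewrite inE adj_sym (adjE _ e'E).
    rewrite ffunE -mE ffunE ye' andbT; apply/orP; right.
    by apply/betweenP; exists w, q; rewrite set11 setUC.
  have eD : e \in Delta X (known l m) B w.
    rewrite inE; apply/existsP; exists u; rewrite uB; apply/existsP; exists v.
    rewrite vB eE eqxx !inm //= andbT; apply/eqP/setP => s; rewrite !inE.
    apply/negbTE/negP => /andP[/andP[us vs] sX].
    case/negP: domy; apply/existsP; exists s; rewrite sX.
    apply/existsP; exists u; apply/existsP; exists v.
    rewrite -lE -mE in us vs.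
    by rewrite /is_triangle (adj_sym y s u) (adj_sym y s v) uv !(adj_le le).
  by apply/card_gt0P; exists (exist _ e eD); rewrite inE; apply/eqP/bfun_on_true.
Qed.

Lemma FAw_target A l w y : fFAw X A l w y = Some true -> exists t : 'I_n * 'I_n,
  [/\ [pick t : 'I_n * 'I_n | [&& t.1 \in A, t.2 \in A & is_triangle y t.1 t.2 w]] = Some t,
      t.1 \in A, t.2 \in A, t.1 != t.2
    & forall B : {set 'I_n}, B \subset A -> #|B| = b -> t.1 \in B -> t.2 \in B ->
        fFAwB X A l w B (restr (between [set w] B) y) y = Some true].
Proof.
move=> /bfun_on_true[dy /existsP[u /andP[uA /existsP[v /andP[vA tri]]]]].
case: pickP => [t /and3P[t1 t2 h]|/(_ (u, v))]; last by rewrite /= uA vA tri.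
have /and3P[h12 _ _] := h.
exists t; split=> //; first exact: adj_neq h12.
move=> B BA _ t1B t2B; apply/bfun_on_true; split; first by rewrite /domXAB dy eqxx.
apply/existsP; exists t.1; rewrite t1B; apply/existsP; exists t.2.
by rewrite t2B.
Qed.

(** Agreement with [y] on the loaded pairs puts [z] in the domain of the function plugged at [B];
    only there does a certificate of this partial function say anything about [z]. *)
Lemma FAw_cert A l w B y (S : {set upair n}) : B \subset A ->
  fFAw X A l w y = Some true ->
  fFAwB X A l w B (restr (between [set w] B) y) y = Some true ->
  certificate (fFAwB X A l w B (restr (between [set w] B) y)) y S ->
  certificate (fFAw X A l w) y (between [set w] B :|: S).
Proof.
move=> /subsetP BA _ _ cert z dz /restrU[zb zS]; have dz' := bfun_on_dom dz.
have dzB : domXAB X A l w B (restr (between [set w] B) y) z by rewrite /domXAB dz' zb eqxx.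
have /bfun_on_true[_ /existsP[u /andP[uB /existsP[v /andP[vB tri]]]]] :=
  cert z (bfun_on_in _ dzB) zS.
apply/bfun_on_true; split=> //; apply/existsP; exists u; rewrite BA //=.
by apply/existsP; exists v; rewrite BA.
Qed.

Hypotheses (b_ge2 : (2 <= b)%N) (ba : (b <= a)%N) (an : (a <= n)%N).

Lemma FAw_robust A l w : #|A| = a -> robust (FAw_lg R b X A l w).
Proof.
move=> Aa; apply: johnson_robust.
- exact: b_ge2.
- by move=> B B' BB'; apply: between_mono.
- by rewrite Aa.
- by move=> B m _ _ _; apply: FB_robust.
- by move=> y; apply: FAw_target.
- by move=> B y S; apply: FAw_cert.
Qed.

Lemma FAw_C1 A l w : #|A| = a -> C1 (FAw_lg R b X A l w) <= 4.
Proof.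
move=> Aa; apply: johnson_C1.
- exact: b_ge2.
- by rewrite Aa.
- by move=> B m _ _ _; apply: FB_robust.
- by move=> y; apply: FAw_target.
Qed.

Lemma FA_robust A l : #|A| = a -> robust (FA_lg R b X A l).
Proof.
move=> Aa; apply: or_robust; first by [].
- by move=> w; apply: FAw_robust.
- move=> w y S _ _ cert z dz zy; have dz' := bfun_on_dom dz.
  have /bfun_on_true[_ h] := cert z (bfun_on_in _ dz') zy.
  by apply/bfun_on_true; split=> //; apply/existsP; exists w.
- move=> y /bfun_on_true[dy /existsP[w h]].
  by apply/card_gt0P; exists w; rewrite inE; apply/eqP/bfun_on_true.
Qed.

Lemma F_target y : fF X y = Some true -> exists t : 'I_n * 'I_n,
  [/\ [pick t : 'I_n * 'I_n | [exists w, is_triangle y t.1 t.2 w]] = Some t,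
      t.1 \in [set: 'I_n], t.2 \in [set: 'I_n], t.1 != t.2
    & forall A : {set 'I_n}, A \subset [set: 'I_n] -> #|A| = a -> t.1 \in A -> t.2 \in A ->
        fFA X A (restr (between X A) y) y = Some true].
Proof.
move=> /bfun_on_true[dy /existsP[u /existsP[v h]]].
case: pickP => [t /existsP[w tri]|/(_ (u, v))]; last by rewrite /= h.
have /and3P[h12 _ _] := tri.
exists t; rewrite !inE; split=> //; first exact: adj_neq h12.
move=> A _ _ t1A t2A; apply/bfun_on_true; split; first by rewrite /domXA dy eqxx.
apply/existsP; exists w; apply/existsP; exists t.1; rewrite t1A.
by apply/existsP; exists t.2; rewrite t2A.
Qed.

Lemma F_robust : robust (F_lg R a b X).
Proof.
apply: johnson_robust.
- exact: leq_trans ba.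
- by move=> A A' AA'; apply: between_mono.
- by rewrite cardsT card_ord.
- by move=> A l _ Aa _; apply: FA_robust.
- by move=> y; apply: F_target.
move=> A y S _ _ _ cert z dz /restrU[zb zS]; have dz' := bfun_on_dom dz.
have dzA : domXA X A (restr (between X A) y) z by rewrite /domXA dz' zb eqxx.
have /bfun_on_true[_ /existsP[w /existsP[u /andP[_ /existsP[v /andP[_ tri]]]]]] :=
  cert z (bfun_on_in _ dzA) zS.
apply/bfun_on_true; split=> //; apply/existsP; exists u; apply/existsP; exists v.
by apply/existsP; exists w.
Qed.

Lemma F_C1 : C1 (F_lg R a b X) <= 4.
Proof.
apply: johnson_C1.
- exact: leq_trans ba.
- by rewrite cardsT card_ord.
- by move=> A l _ Aa _; apply: FA_robust.
- by move=> y; apply: F_target.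
Qed.

Lemma touches_triangle z : touches X z -> triangle n z = Some true.
Proof.
by case/existsP=> t /andP[_ h]; congr Some; apply/existsP; exists t.
Qed.

Lemma GX_robust : robust (GX_lg R a b X).
Proof.
apply: or_robust; first by [].
- by case; [exact: H_robust | exact: F_robust].
- case=> y S _ _ cert z _ zy.
    have [h] := cert z isT zy; exact: touches_triangle.
  (* Inputs outside the domain of [fF X] have a triangle anyway, so a certificate for the partial
     function also certifies [triangle]. *)
  have [/touches_triangle //|dz] := boolP (touches X z).
  have /bfun_on_true[_ h] := cert z (bfun_on_in _ dz) zy.
  by congr Some.
- move=> y [tri]; apply/card_gt0P; exists (touches X y); rewrite inE.
  have [h|h] := boolP (touches X y); apply/eqP; first by congr Some.
  by apply/bfun_on_true.
Qed.

End NoVertexInX.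

Lemma card_xsets x : #|{: {X : {set 'I_n} | #|X| == x}}| = 'C(n, x).
Proof. by rewrite card_sig -[n in RHS]card_ord -card_draws; apply: eq_card => A; rewrite !inE. Qed.

Lemma G_robust x a b : (x <= n)%N -> (2 <= b)%N -> (b <= a)%N -> (a <= n)%N ->
  robust (G_lg R n x a b).
Proof.
move=> xn b2 ba an; apply: or_robust.
- by rewrite bin_gt0.
- by move=> p; apply: GX_robust.
- by [].
(* All the [GX_lg] compute [triangle], so every [X] is a positive component; this is why the OR
   divides by ['C(n, x)] and turns a sum over [X] into a mean. *)
- move=> y yt; rewrite -(card_xsets x) leq_eqVlt; apply/orP; left; apply/eqP.
  by apply: eq_card => p; rewrite !inE yt eqxx.
Qed.

End TriangleValidity.

(** * Costs of the learning graph for Triangle *)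

Section Binomials.

(** Among p + m points, ['C(p, x)] counts the x-subsets avoiding m given ones: m times the
    probability of avoidance is at most (p + m)/x. The auxiliary [h] follows from Pascal's rule. *)
Lemma bin_avoid p m x : (0 < x)%N ->
  (x * m * 'C(p, x) <= (p + m) * 'C(p + m, x))%N.
Proof.
case: x => // x _; have h j : (j * 'C(p, x) <= 'C(p + j, x.+1))%N.
  elim: j => [|j IH]; first by rewrite mul0n.
  rewrite addnS binS mulSn addnC leq_add //.
  by apply: leq_bin2l; rewrite leq_addr.
apply: (@leq_trans (p * 'C(p + m, x.+1))); last by rewrite leq_mul2r leq_addr orbT.
rewrite mulnAC mul_bin_left -mulnA; apply: leq_mul; first exact: leq_subr.
by rewrite mulnC.
Qed.

(** This identity and the next two compare the numbers of subsets at levels [k - 2], [k - 1] and [k]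
    with [n_used]. The factors involving [s - k] are those that the margin [d] controls. *)
Lemma bin_down2 s k : (2 <= k <= s)%N ->
  ('C(s, k - 2) * ((s - k + 2) * (s - k + 1)) = s * (s - 1) * 'C(s - 2, k - 2))%N.
Proof.
case/andP=> k2 ks; have e1 := mul_bin_down s (k - 2).
have e2 := mul_bin_down (s - 1) (k - 2).
rewrite (_ : s.-1 = s - 1)%N in e1; last by lia.
rewrite (_ : (s - 1).-1 = s - 2)%N in e2; last by lia.
rewrite (_ : s - (k - 2) = s - k + 2)%N in e1; last by lia.
rewrite (_ : s - 1 - (k - 2) = s - k + 1)%N in e2; last by lia.
by rewrite -mulnA e2 [RHS]mulnCA e1; lia.
Qed.

Lemma bin_down1 s k : (2 <= k <= s)%N ->
  ('C(s, k - 1) * ((s - k + 1) * (k - 1)) = s * (s - 1) * 'C(s - 2, k - 2))%N.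
Proof.
case/andP=> k2 ks; have e1 := mul_bin_down s (k - 1).
have e2 := mul_bin_diag (s - 1) (k - 2).
rewrite (_ : s.-1 = s - 1)%N in e1; last by lia.
rewrite (_ : (s - 1).-1 = s - 2)%N in e2; last by lia.
rewrite (_ : (k - 2).+1 = k - 1)%N in e2; last by lia.
rewrite (_ : s - (k - 1) = s - k + 1)%N in e1; last by lia.
by rewrite -mulnA e2 [RHS]mulnCA e1; lia.
Qed.

Lemma bin_diag2 s k : (2 <= k <= s)%N ->
  ('C(s, k) * (k * (k - 1)) = s * (s - 1) * 'C(s - 2, k - 2))%N.
Proof.
case/andP=> k2 ks; have e1 := mul_bin_diag s (k - 1).
have e2 := mul_bin_diag (s - 1) (k - 2).
rewrite (_ : s.-1 = s - 1)%N in e1; last by lia.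
rewrite (_ : (s - 1).-1 = s - 2)%N in e2; last by lia.
rewrite (_ : (k - 2).+1 = k - 1)%N in e2; last by lia.
rewrite (_ : (k - 1).+1 = k)%N in e1; last by lia.
by rewrite -mulnA e2 [RHS]mulnCA e1; lia.
Qed.

Lemma card_supersets (T : finType) (D A : {set T}) k : D \subset A -> (#|D| <= k)%N ->
  #|[set B : {set T} | [&& D \subset B, B \subset A & #|B| == k]]|
    = 'C(#|A| - #|D|, k - #|D|).
Proof.
move=> DA Dk; have <- : #|A :\: D| = (#|A| - #|D|)%N.
  by rewrite cardsD (setIidPr DA).
rewrite -cards_draws -[RHS](card_in_imset (f := fun B => D :|: B)).
  apply: eq_card => B. apply/idP/imsetP => [|[B']].
    rewrite inE => /and3P[DB BA /eqP Bk]; exists (B :\: D).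
      by rewrite !inE setSD // cardsD (setIidPr DB) Bk eqxx.
    apply/setP => x; rewrite !inE; move/subsetP: DB => /(_ x).
    by case: (x \in D); case: (x \in B) => //= /(_ isT).
  rewrite !inE => /andP[/subsetDP[B'A B'D] /eqP B'k] ->.
  rewrite subsetUl subUset DA B'A cardsU B'k.
  have -> : D :&: B' = set0 by apply/eqP; rewrite setI_eq0 disjoint_sym.
  by rewrite cards0 subn0 subnKC //=.
move=> B B'; rewrite !inE => /andP[/subsetDP[_ d] _] /andP[/subsetDP[_ d'] _] /setP h.
apply/setP => x; have := h x; rewrite !inE.
case: (boolP (x \in D)) => xD //= _.
by rewrite (disjointFl d xD) (disjointFl d' xD).
Qed.

End Binomials.

(** * Negative cost of the loading stages of a Johnson graph *)

Section StageCosts.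
Variables (R : realType) (n : nat) (Y W : {set 'I_n}) (k : nat) (d : R).
Hypotheses (k_ge2 : (2 <= k)%N) (d_gt0 : 0 < d).
Hypothesis kW : k%:R <= (1 - d) * #|W|%:R.

Lemma card_between (X A : {set 'I_n}) : (#|between X A| <= #|X| * #|A|)%N.
Proof.
rewrite -cardsX -(card_imset _ val_inj).
apply: leq_trans (leq_imset_card (fun p : 'I_n * 'I_n => [set p.1; p.2]) _).
apply/subset_leq_card/subsetP => _ /imsetP[e /betweenP[u [v [uX vA eE]]] ->].
by apply/imsetP; exists (u, v); rewrite ?inE ?uX.
Qed.

Lemma sload_root (e : sedge W k) : sedge_src e = None ->
  (#|sload (between Y) e| <= #|Y| * k)%N.
Proof.
move=> h; rewrite /sload h setD0; apply: leq_trans (card_between _ _) _.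
by rewrite leq_mul2l (sedge_noneP h) leq_subr orbT.
Qed.

Lemma sload_main (e : sedge W k) A : sedge_src e = Some A ->
  (#|sload (between Y) e| <= #|Y|)%N.
Proof.
move=> h; have -> : sload (between Y) e = between Y (val (sedge_tgt e)) :\: between Y (val A).
  by rewrite /sload h.
case: (sedge_someP h) => j _ ->.
have := card_between Y [set j]; rewrite cards1 muln1; apply: leq_trans.
apply/subset_leq_card/subsetP => e'; rewrite inE => /andP[eA /betweenP[u [v [uY + eE]]]].
rewrite in_setU1 => /orP[/eqP vj|vA]; last first.
  by case/negP: eA; apply/betweenP; exists u, v.
by apply/betweenP; exists u, j; rewrite set11 -vj.
Qed.

Lemma card_sedge_root : (#|[pred e : sedge W k | sedge_src e == None]| <= 'C(#|W|, k - 2))%N.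
Proof.
rewrite -cards_draws -(@card_in_imset _ _ (fun e => val (sedge_tgt e))); last first.
  move=> e e'; rewrite !inE => /eqP h /eqP h' /val_inj h2.
  by apply: sedge_ext => //; rewrite h h'.
apply/subset_leq_card/subsetP => B /imsetP[e]; rewrite inE => /eqP h -> {B}.
by rewrite jnode_sub (sedge_noneP h) eqxx.
Qed.

Lemma card_sedge_main (A : jnode W k) :
  (#|[pred e : sedge W k | sedge_src e == Some A]| <=
     ((#|val A| == k - 2) + (#|val A| == k - 1)) * #|W|)%N.
Proof.
have [|h] := boolP ((#|val A| == k - 2) || (#|val A| == k - 1))%N; last first.
  have -> // : #|[pred e : sedge W k | sedge_src e == Some A]| = 0%N.
  apply: eq_card0 => e; rewrite !inE; apply/negbTE/negP => /eqP h'.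
  have := sedge_card h'; have := jnode_card (sedge_tgt e); have := jnode_card A.
  by move: h; rewrite negb_or => /andP[/eqP h1 /eqP h2]; lia.
move=> h; apply: (@leq_trans #|W|); last by case/orP: h => ->; rewrite ?leq_pmull ?addn1.
rewrite -(@card_in_imset _ _ (fun e => val (sedge_tgt e))); last first.
  move=> e e'; rewrite !inE => /eqP h1 /eqP h1' /val_inj h2.
  by apply: sedge_ext => //; rewrite h1 h1'.
apply: leq_trans (leq_imset_card (fun j => j |: val A) W).
apply/subset_leq_card/subsetP => B /imsetP[e]; rewrite inE => /eqP h' -> {B}.
case: (sedge_someP h') => j; rewrite inE => /andP[_ jW] ->.
by apply/imsetP; exists j.
Qed.

Let s := #|W|.
Let D : R := n_used R W k.

Let ks : (k <= s)%N.
Proof.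
rewrite -(ler_nat R); apply: le_trans kW _; rewrite -[X in _ <= X]mul1r.
by rewrite ler_wpM2r ?ler0n // gerBl ltW.
Qed.

Let s_gt0 : 0 < s%:R :> R.
Proof. by rewrite ltr0n; apply: leq_trans ks; lia. Qed.

Let ds : d * s%:R <= (s - k)%:R.
Proof. by rewrite natrB //; move: kW; rewrite -/s mulrBl mul1r lerBrDr -lerBrDl. Qed.

Let D_gt0 : 0 < D.
Proof. by rewrite /D /n_used ltr0n bin_gt0 leq_sub2r. Qed.

Let ratio2 : 'C(s, k - 2)%:R * d ^+ 2 <= D.
Proof.
have h : 'C(s, k - 2)%:R * ((s - k + 2)%:R * (s - k + 1)%:R) = s%:R * (s - 1)%:R * D :> R.
  by rewrite /D /n_used -!natrM bin_down2 // k_ge2.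
have s1 : (s - 1)%:R <= s%:R :> R by rewrite ler_nat leq_subr.
have c0 : 0 <= 'C(s, k - 2)%:R :> R by [].
have h1 : 'C(s, k - 2)%:R * ((d * s%:R) * (d * s%:R)) <= s%:R * s%:R * D.
  apply: (@le_trans _ _ (s%:R * (s - 1)%:R * D)).
    rewrite -h ler_wpM2l // ler_pM ?mulr_ge0 ?ler0n ?(ltW d_gt0) //.
      by apply: le_trans ds _; rewrite ler_nat leq_addr.
    by apply: le_trans ds _; rewrite ler_nat leq_addr.
  by rewrite ler_wpM2r ?(ltW D_gt0) // ler_wpM2l ?ler0n.
rewrite -(ler_pM2l (x := s%:R * s%:R)) ?mulr_gt0 //.
by apply: le_trans h1; rewrite le_eqVlt; apply/orP; left; apply/eqP; ring.
Qed.

Let ratio1 : 'C(s, k - 1)%:R * (d * k%:R) <= 2 * s%:R * D.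
Proof.
have h : 'C(s, k - 1)%:R * ((s - k + 1)%:R * (k - 1)%:R) = s%:R * (s - 1)%:R * D :> R.
  by rewrite /D /n_used -!natrM bin_down1 // k_ge2.
have s1 : (s - 1)%:R <= s%:R :> R by rewrite ler_nat leq_subr.
have c0 : 0 <= 'C(s, k - 1)%:R :> R by [].
have k1 : k%:R / 2 <= (k - 1)%:R :> R.
  have k2 : 2 <= k%:R :> R by rewrite ler_nat.
  by rewrite natrB ?(ltnW k_ge2) //; lra.
have h1 : 'C(s, k - 1)%:R * ((d * s%:R) * (k%:R / 2)) <= s%:R * s%:R * D.
  apply: (@le_trans _ _ (s%:R * (s - 1)%:R * D)).
    rewrite -h ler_wpM2l // ler_pM ?mulr_ge0 ?ler0n ?(ltW d_gt0) // ?divr_ge0 ?ler0n //.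
    by apply: le_trans ds _; rewrite ler_nat leq_addr.
  by rewrite ler_wpM2r ?(ltW D_gt0) // ler_wpM2l ?ler0n.
rewrite -(ler_pM2l (x := s%:R)) //.
apply: (@le_trans _ _ (2 * ('C(s, k - 1)%:R * ((d * s%:R) * (k%:R / 2))))).
  by rewrite le_eqVlt; apply/orP; left; apply/eqP; field.
by rewrite (_ : s%:R * _ = 2 * (s%:R * s%:R * D)) ?ler_wpM2l //; ring.
Qed.

(** Stage 0 has at most ['C(s, k - 2)] super edges, each loading at most |Y|k pairs. In Stages 1 and
    2 a subset has at most s outgoing super edges, each loading at most |Y| pairs. Relative to
    [n_used], level [k - 2] counts with constant 1 and level [k - 1] with constant 2 (from k/2 <= k
    - 1), whence the 3. *)
Lemma stage_cost : \sum_(e : sedge W k) #|sload (between Y) e|%:R ^+ 2 / D <=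
  3 / d ^+ 2 * ((#|Y|%:R * k%:R) ^+ 2 + #|Y|%:R ^+ 2 * (s%:R ^+ 2 / k%:R)).
Proof.
pose y : R := #|Y|%:R; have y0 : 0 <= y by [].
have card_level j : \sum_(A : jnode W k) (#|val A| == j)%:R <= 'C(s, j)%:R :> R.
  rewrite (big_sig_val (fun A : {set 'I_n} => (A \subset W) && (k - 2 <= #|A| <= k)%N)
    (fun A => (#|A| == j)%:R)) -natr_sum ler_nat -cards_draws -sum1_card.
  rewrite [leqLHS]big_mkcond [leqRHS]big_mkcond; apply: leq_sum => A _; rewrite inE.
  by case: (A \subset W) => //=; case: ifP => // _; case: (_ == j).
have total : \sum_(e : sedge W k) #|sload (between Y) e|%:R ^+ 2 <=
    'C(s, k - 2)%:R * (y * k%:R) ^+ 2 +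
    ('C(s, k - 2)%:R + 'C(s, k - 1)%:R) * s%:R * y ^+ 2.
  rewrite (partition_big (@sedge_src _ W k) predT) //= sum_option; apply: lerD.
    apply: (@le_trans _ _ (\sum_(e : sedge W k | sedge_src e == None) (y * k%:R) ^+ 2)).
      apply: ler_sum => e /eqP h; rewrite ler_sqr ?nnegrE ?mulr_ge0 ?ler0n //.
      by rewrite -natrM ler_nat sload_root.
    rewrite sumr_const -[X in X <= _]mulr_natl ler_wpM2r ?sqr_ge0 // ler_nat.
    exact: card_sedge_root.
  apply: (@le_trans _ _ (\sum_(A : jnode W k)
    ((#|val A| == k - 2)%N%:R + (#|val A| == k - 1)%N%:R) * (s%:R * y ^+ 2))).
    apply: ler_sum => A _.
    apply: (@le_trans _ _ (\sum_(e : sedge W k | sedge_src e == Some A) y ^+ 2)).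
      apply: ler_sum => e /eqP h; rewrite ler_sqr ?nnegrE ?ler0n //.
      by rewrite ler_nat (sload_main h).
    rewrite sumr_const -[X in X <= _]mulr_natl mulrA ler_wpM2r ?sqr_ge0 //.
    by rewrite -natrD -natrM ler_nat card_sedge_main.
  rewrite -mulr_suml big_split /= -mulrA ler_wpM2r ?mulr_ge0 ?ler0n ?sqr_ge0 //.
  exact: lerD.
rewrite -mulr_suml ler_pdivrMr //; apply: le_trans total _.
have k0 : 0 < k%:R :> R by rewrite ltr0n; lia.
have d1 : d <= 1.
  have : 0 < (1 - d) * s%:R by apply: lt_le_trans k0 _.
  by rewrite pmulr_lgt0 // subr_gt0 => /ltW.
have d2 : 0 < d ^+ 2 by rewrite exprn_gt0.
have c2 : 'C(s, k - 2)%:R <= D / d ^+ 2 by rewrite ler_pdivlMr.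
have c1 : 'C(s, k - 1)%:R <= 2 * s%:R * D / (d ^+ 2 * k%:R).
  rewrite ler_pdivlMr ?mulr_gt0 //; apply: le_trans ratio1.
  rewrite ler_wpM2l ?ler0n // ler_wpM2r ?ler0n // expr2.
  by rewrite -[X in _ <= X]mulr1 ler_wpM2l // ltW.
have sk : 1 <= s%:R / k%:R :> R by rewrite ler_pdivlMr // mul1r ler_nat.
have Dd : 0 <= D / d ^+ 2 by rewrite divr_ge0 // ltW.
have c12 : ('C(s, k - 2)%:R + 'C(s, k - 1)%:R) <= 3 * (s%:R / k%:R) * (D / d ^+ 2).
  apply: le_trans (lerD c2 c1) _.
  rewrite (_ : 2 * s%:R * D / (d ^+ 2 * k%:R) = 2 * (s%:R / k%:R) * (D / d ^+ 2)); last first.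
    by field; rewrite !gt_eqF.
  set r := s%:R / k%:R in sk *; set q := D / d ^+ 2 in Dd *.
  by nra.
rewrite -/y [leRHS](_ : _ = 3 / d ^+ 2 * (y * k%:R) ^+ 2 * D +
  3 / d ^+ 2 * (y ^+ 2 * (s%:R ^+ 2 / k%:R)) * D); last by ring.
apply: lerD.
  apply: (@le_trans _ _ (D / d ^+ 2 * (y * k%:R) ^+ 2)); first by rewrite ler_wpM2r ?sqr_ge0.
  rewrite (_ : 3 / d ^+ 2 * _ * D = 3 * (D / d ^+ 2 * (y * k%:R) ^+ 2)); last by field; rewrite gt_eqF.
  have : 0 <= D / d ^+ 2 * (y * k%:R) ^+ 2 by rewrite mulr_ge0 ?sqr_ge0.
  by set q := D / _ * _; lra.
apply: (@le_trans _ _ (3 * (s%:R / k%:R) * (D / d ^+ 2) * s%:R * y ^+ 2)).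
  by rewrite ler_wpM2r ?sqr_ge0 // ler_wpM2r ?ler0n.
by rewrite le_eqVlt; apply/orP; left; apply/eqP; field; rewrite !gt_eqF.
Qed.

End StageCosts.

Lemma C0_at_ge0 (R : realType) (I : finType) (f : bfun I) (G : elg R f) z :
  robust G -> 0 <= C0_at G z.
Proof. by move=> rG; apply: sumr_ge0 => e _; apply: robust_weight_ge0. Qed.

Lemma dense_load_C1_le (R : realType) (I : finType) (f : bfun I) (S : {set I}) :
  C1 (dense_load R f S) <= 1.
Proof.
apply: C1_le => // y _; rewrite /C1_at /=.
apply: (@le_trans _ _ (dense_load_C1 R S)).
  by rewrite big_mkcond; apply: ler_sum => i _; case: ifP => // _; rewrite divr_ge0 ?sqr_ge0.
by rewrite dense_load_C1E; case: (_ == _).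
Qed.

Lemma dense_load_C0_at (R : realType) (I : finType) (f : bfun I) (S : {set I}) z :
  0 <= C0_at (dense_load R f S) z <= #|S|%:R ^+ 2.
Proof.
rewrite /C0_at /= sumr_ge0 //= big_mkcond.
apply: (@le_trans _ _ (\sum_(i < #|S|) #|S|%:R)).
  by apply: ler_sum => i _; case: ifP => // _; rewrite ler0n.
by rewrite sumr_const card_ord -[X in X <= _]mulr_natl.
Qed.

Lemma or1_C0_at_le (R : realType) (I J : finType) (F : bfun I) (f : J -> bfun I)
    (G : forall j, elg R (f j)) (c : R) (u : J -> R) z :
  (forall j, labels_ok (G j)) -> (forall j, C1 (G j) <= c) ->
  (forall j, 0 <= C0_at (G j) z <= u j) ->
  C0_at (or_lg F 1 G) z <= c * \sum_j u j.
Proof.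
move=> lab hc h0; rewrite or_C0_at // mulr_sumr; apply: ler_sum => j _.
have /andP[h1 h2] := h0 j.
by rewrite divr1 ler_pM ?C1_ge0.
Qed.

Lemma card_upair n : (#|{: upair n}| <= n ^ 2)%N.
Proof.
rewrite card_sig (eq_card (B := [set A : {set 'I_n} | #|A| == 2%N])) => [|A]; last by rewrite !inE.
rewrite card_draws card_ord bin2.
have : (n * n.-1 <= n ^ 2)%N by rewrite -mulnn leq_mul2l leq_pred orbT.
have := odd_double_half (n * n.-1); lia.
Qed.

Section TriangleCosts.
Variables (R : realType) (n : nat) (z : graph n).
Implicit Types (u v w t : 'I_n) (X A B : {set 'I_n}) (e : upair n).

Lemma card_tri_pairs t e : (#|tri_pairs t e| <= 3)%N.
Proof.
rewrite -(card_imset _ val_inj).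
apply: (@leq_trans #|[set B : {set 'I_n} | B \subset t |: val e & #|B| == 2%N]|).
  apply/subset_leq_card/subsetP => B /imsetP[e' h -> {B}].
  by move: h; rewrite !inE => ->; exact: (valP e').
rewrite cards_draws cardsU1 (eqP (valP e)).
by case: (t \notin _).
Qed.

Lemma H_vertex_C1 t : C1 (H_vertex R t) <= 1.
Proof. exact: or_C1. Qed.

(** The 9 is the square of 3, the cost of densely loading at most three pairs. *)
Lemma H_vertex_C0_at t : C0_at (H_vertex R t) z <= 9 * n%:R ^+ 2.
Proof.
apply: (le_trans (y := 1 * \sum_(p : {e : upair n | t \notin val e}) 9)).
  apply: or1_C0_at_le => [p|p|p]; last 2 first.
  - exact: dense_load_C1_le.
  - have /andP[h0 h] := dense_load_C0_at R (fH_triangle t (val p)) (tri_pairs t (val p)) z.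
    rewrite h0; apply: le_trans h _; rewrite -natrX (_ : 9 = (3 ^ 2)%:R) // ler_nat leq_exp2r //.
    exact: card_tri_pairs.
  apply: robust_labels; apply: dense_load_robust => y [/forallP h] y' _ /eqP/restr_eqP zy.
  congr Some; apply/forallP => e'; apply/implyP => e'T; rewrite (zy _ e'T).
  exact: (implyP (h e')).
rewrite mul1r sumr_const -[X in X <= _]mulr_natr ler_wpM2l // -natrX ler_nat.
by apply: leq_trans (card_upair n); rewrite card_sig max_card.
Qed.

Lemma H_C0_at X : C0_at (H_lg R X) z <= 9 * #|X|%:R * n%:R ^+ 2.
Proof.
apply: (le_trans (y := 1 * \sum_(p : {t : 'I_n | t \in X}) (9 * n%:R ^+ 2))).
  apply: or1_C0_at_le => [p|p|p].
  - exact: robust_labels (H_vertex_robust R _).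
  - exact: H_vertex_C1.
  - by rewrite H_vertex_C0_at andbT; apply: C0_at_ge0; apply: H_vertex_robust.
by rewrite mul1r sumr_const card_sig -[X in X <= _]mulr_natr mulrAC.
Qed.

Definition common e : {set 'I_n} := [set w | [forall u in val e, adj z u w]].

Lemma common_pair e u v : val e = [set u; v] -> common e = nbh2 z u v.
Proof.
move=> eE; apply/setP => w; rewrite !inE eE; apply/forallP/andP => [h|[h1 h2] p].
  by split; [have := h u | have := h v]; rewrite !inE eqxx ?orbT.
by apply/implyP; rewrite !inE => /orP[] /eqP ->.
Qed.

(** The condition of [Delta] without the inclusion of [e] in [B]. As it involves neither [A] nor
    [B], the sum over the nested sets and the average over [X] can be carried out separately. *)
Definition crossing X w e : nat := (common e :&: X == set0) && (w \in common e).

Lemma card_Delta X B w :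
  (#|Delta X z B w| <= \sum_(e : upair n) (val e \subset B) * crossing X w e)%N.
Proof.
rewrite -sum1_card big_mkcond; apply: leq_sum => e _.
case: ifP => //; rewrite inE => /existsP[u /andP[uB /existsP[v /andP[vB]]]].
case/and4P=> /eqP eE h; rewrite !inE => uw vw.
rewrite /crossing (common_pair eE) h eE subUset !sub1set uB vB !inE.
by rewrite (adj_sym z u) uw (adj_sym z v) vw.
Qed.

Section NoVertex.
Variables (a b : nat) (X : {set 'I_n}) (d : R).
Hypotheses (b_ge2 : (2 <= b)%N) (ba : (b <= a)%N) (an : (a <= n)%N) (d_gt0 : 0 < d).
Hypotheses (a_le : a%:R <= (1 - d) * n%:R) (b_le : b%:R <= (1 - d) * a%:R).

Let K : R := 3 / d ^+ 2.
(** [sigma2] bounds the stages of the inner Johnson graph, on [b]-subsets with [Y = [set w]], and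
    [sigma1] those of the outer one, on [a]-subsets with [Y = X]. *)
Let sigma2 : R := K * (b%:R ^+ 2 + a%:R ^+ 2 / b%:R).
Let sigma1 : R := K * ((#|X|%:R * a%:R) ^+ 2 + #|X|%:R ^+ 2 * (n%:R ^+ 2 / a%:R)).

Let K_ge0 : 0 <= K.
Proof. by rewrite divr_ge0 ?sqr_ge0. Qed.

Let l A := restr (between X A) z.

Lemma FB_C1 A l' w B m : C1 (FB_lg R X A l' w B m) <= 1.
Proof. exact: or_C1. Qed.

Lemma FA_C1 A l' : C1 (FA_lg R b X A l') <= 1.
Proof. exact: or_C1. Qed.

Lemma FB_C0_at A B w : B \subset A ->
  C0_at (FB_lg R X A (l A) w B (restr (between [set w] B) z)) z <= #|Delta X z B w|%:R.
Proof.
move=> /subsetP BA; set m := restr (between [set w] B) z.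
apply: (le_trans (y := 1 * \sum_(p : {e : upair n | e \in Delta X (known (l A) m) B w}) 1)).
  apply: or1_C0_at_le => [[e eD]|p|p].
  - apply: robust_labels; apply: dense_load_robust => y /bfun_on_true[_ ye] y' dz /eqP/restr_eqP zy.
    by apply/bfun_on_true; split; [exact: bfun_on_dom dz | rewrite (zy e) ?inE].
  - exact: dense_load_C1_le.
  - have /andP[h0 h] := dense_load_C0_at R (fedge X A (l A) w B m (val p)) [set val p] z.
    by rewrite h0; apply: le_trans h _; rewrite cards1 expr1n.
rewrite mul1r sumr_const card_sig ler_nat.
apply/subset_leq_card/subsetP => e; rewrite unfold_in /= !inE.
case/existsP=> u /andP[uB /existsP[v /andP[vB]]] /and4P[/eqP eE /eqP/setP h uw vw].
have le e' := @known_le n z (between X A) (between [set w] B) e'.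
rewrite !inE in uw vw.
apply/existsP; exists u; rewrite uB; apply/existsP; exists v; rewrite vB eE eqxx /=.
rewrite !inE (adj_le le uw) (adj_le le vw) !andbT; apply/eqP/setP => t.
have := h t; rewrite !inE; apply: contraFF => /andP[/andP[ut vt] tX].
have inl q : q \in B -> adj z q t -> adj (known (l A) m) q t.
  move=> qB qt; have [e' e'E ze'] := adj_pair qt; rewrite (adjE _ e'E).
  rewrite ffunE /l ffunE ze' andbT; apply/orP; left.
  by apply/betweenP; exists t, q; rewrite tX BA // setUC.
by rewrite !inl.
Qed.

Let nb : R := 'C(a - 2, b - 2)%:R.
Let na : R := 'C(n - 2, a - 2)%:R.

Let nb_gt0 : 0 < nb. Proof. by rewrite ltr0n bin_gt0 leq_sub2r. Qed.
Let na_gt0 : 0 < na. Proof. by rewrite ltr0n bin_gt0 leq_sub2r. Qed.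

Lemma FAw_C0_at A w : #|A| = a -> C0_at (FAw_lg R b X A (l A) w) z <=
  sigma2 + \sum_(B : {set 'I_n} | (B \subset A) && (#|B| == b)) #|Delta X z B w|%:R / nb.
Proof.
move=> Aa; apply: le_trans (johnson_C0_at _ _ _ _ _) _.
- by rewrite Aa.
- by move=> B m _ _ _; apply: FB_robust.
apply: lerD.
  have := @stage_cost R n [set w] A b d b_ge2 d_gt0.
  by rewrite Aa cards1 mul1r expr1n mul1r; apply.
apply: ler_sum => B /andP[BA /eqP Bb]; rewrite /n_used Aa -/nb mulrAC.
rewrite ler_pM2r ?invr_gt0 //; apply: le_trans (FB_C0_at w BA).
rewrite -[X in _ <= X]mul1r; apply: ler_wpM2r; last exact: FB_C1.
by apply: C0_at_ge0; exact: FB_robust.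
Qed.

Lemma FA_C0_at A : #|A| = a -> C0_at (FA_lg R b X A (l A)) z <=
  4 * \sum_w (sigma2 + \sum_(B : {set 'I_n} | (B \subset A) && (#|B| == b))
     #|Delta X z B w|%:R / nb).
Proof.
move=> Aa; apply: or1_C0_at_le => w.
- by apply: robust_labels; exact: (FAw_robust R X b_ge2 ba (l A) w Aa).
- exact: (FAw_C1 R X b_ge2 ba (l A) w Aa).
- by rewrite FAw_C0_at // andbT; apply: C0_at_ge0; exact: (FAw_robust R X b_ge2 ba (l A) w Aa).
Qed.

(** Counts the chains of nested sets e, B, A. The result is the product of the normalisations of the
    two Johnson graphs, so after both of them a pair has weight exactly 1, whatever [a] and [b]. *)
Lemma pair_count e :
  (\sum_(A : {set 'I_n} | (A \subset [set: 'I_n]) && (#|A| == a))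
    \sum_(B : {set 'I_n} | (B \subset A) && (#|B| == b)) (val e \subset B)
  = 'C(n - 2, a - 2) * 'C(a - 2, b - 2))%N.
Proof.
have e2 : #|val e| = 2%N := eqP (valP e).
have a2 : (2 <= a)%N := leq_trans b_ge2 ba.
transitivity (\sum_(A : {set 'I_n} | [&& val e \subset A, A \subset [set: 'I_n] & #|A| == a])
   'C(a - 2, b - 2))%N.
  rewrite [LHS]big_mkcond [RHS]big_mkcond; apply: eq_bigr => A _.
  rewrite andbC; case: (#|A| =P a) => Aa; rewrite ?andbF //= ?subsetT ?andbT /=.
  have [eA|eA] := boolP (val e \subset A).
    have := @card_supersets _ (val e) A b eA.
    rewrite e2 Aa => <- //; rewrite -sum1_card [LHS]big_mkcond [RHS]big_mkcond.
    apply: eq_bigr => B _; rewrite !inE.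
    by case: (B \subset A); case: (#|B| == b); case: (val e \subset B).
  apply: big1 => B /andP[BA _]; case: (boolP (val e \subset B)) => // eB.
  by rewrite (subset_trans eB BA) in eA.
rewrite sum_nat_const; congr (_ * _)%N.
have := @card_supersets _ (val e) [set: 'I_n] a (subsetT _).
rewrite e2 cardsT card_ord => <- //; apply: eq_card => A.
by rewrite !inE.
Qed.

Lemma F_C0_at : C0_at (F_lg R a b X) z <=
  sigma1 + 'C(n, a)%:R / na * (4 * n%:R * sigma2) +
  4 * \sum_(e : upair n) \sum_w (crossing X w e)%:R.
Proof.
have a2 : (2 <= a)%N := leq_trans b_ge2 ba.
apply: le_trans (johnson_C0_at _ _ _ _ _) _.
- by rewrite cardsT card_ord.
- by move=> A l' _ Aa _; exact: (FA_robust R X b_ge2 ba l' Aa).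
rewrite -addrA; apply: lerD.
  have := @stage_cost R n X [set: 'I_n] a d a2 d_gt0.
  by rewrite cardsT card_ord; apply.
rewrite /n_used cardsT card_ord -/na.
pose S A w : R := \sum_(B : {set 'I_n} | (B \subset A) && (#|B| == b)) #|Delta X z B w|%:R.
apply: (@le_trans _ _ (\sum_(A : {set 'I_n} | (A \subset [set: 'I_n]) && (#|A| == a))
    (4 * n%:R * sigma2 / na + 4 / (na * nb) * \sum_w S A w))).
  apply: ler_sum => A /andP[_ /eqP Aa].
  apply: (@le_trans _ _ (na^-1 * C0_at (FA_lg R b X A (l A)) z)).
    apply: ler_wpM2r; first by apply: C0_at_ge0; exact: (FA_robust R X b_ge2 ba (l A) Aa).
    by rewrite -[X in _ <= X]mul1r ler_wpM2r ?FA_C1 // invr_ge0 ltW.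
  rewrite -(ler_pM2l na_gt0) mulrA mulfV ?gt_eqF // mul1r.
  apply: le_trans (FA_C0_at Aa) _.
  rewrite big_split /= sumr_const card_ord -[_ *+ n]mulr_natl.
  rewrite (eq_bigr (fun w => S A w / nb)) => [|w _]; last by rewrite mulr_suml.
  rewrite -mulr_suml le_eqVlt; apply/orP; left; apply/eqP; field.
  by rewrite !gt_eqF.
rewrite big_split /= sumr_const -mulr_sumr; apply: lerD.
  rewrite -[X in X <= _]mulr_natl (_ : #|_| = 'C(n, a)); last first.
    rewrite -[n in RHS]card_ord -card_draws; apply: eq_card => A.
    by rewrite !inE; rewrite unfold_in /= subsetT.
  by rewrite le_eqVlt; apply/orP; left; apply/eqP; ring.
rewrite -mulrA ler_wpM2l // mulrC ler_pdivrMr ?mulr_gt0 //.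
apply: (@le_trans _ _ (\sum_(A : {set 'I_n} | (A \subset [set: 'I_n]) && (#|A| == a))
   \sum_w \sum_(B : {set 'I_n} | (B \subset A) && (#|B| == b))
     \sum_(e : upair n) (val e \subset B)%:R * (crossing X w e)%:R)).
  apply: ler_sum => A _; apply: ler_sum => w _; apply: ler_sum => B _.
  rewrite (eq_bigr (fun e => ((val e \subset B) * crossing X w e)%N%:R)) => [|e _].
    by rewrite -natr_sum ler_nat card_Delta.
  by rewrite natrM.
(* Exchanging the sums isolates, for each [e] and [w], the number of chains given by
   [pair_count]. *)
rewrite le_eqVlt; apply/orP; left; apply/eqP.
rewrite mulr_suml exchange_big /=.
transitivity (\sum_w \sum_(e : upair n) \sum_(A : {set 'I_n} | (A \subset [set: 'I_n]) && (#|A| == a))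
   \sum_(B : {set 'I_n} | (B \subset A) && (#|B| == b))
      (val e \subset B)%:R * (crossing X w e)%:R : R).
  apply: eq_bigr => w _; rewrite [RHS]exchange_big /=; apply: eq_bigr => A _.
  by rewrite exchange_big.
rewrite exchange_big; apply: eq_bigr => e _; rewrite mulr_suml; apply: eq_bigr => w _.
rewrite (eq_bigr (fun A : {set 'I_n} => (\sum_(B : {set 'I_n} | (B \subset A) && (#|B| == b))
  (val e \subset B))%N%:R * (crossing X w e)%:R)) => [|A _].
  by rewrite -mulr_suml -natr_sum pair_count natrM mulrC.
by rewrite natr_sum mulr_suml.
Qed.

(** The OR multiplies [F_lg] by its positive complexity, at most 4, and the inner Johnson graphs
    already carry another 4; hence 4 on the outer stages and 16 on the inner terms. *)
Lemma GX_C0_at : C0_at (GX_lg R a b X) z <=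
  9 * #|X|%:R * n%:R ^+ 2 + 4 * sigma1 + 'C(n, a)%:R / na * (16 * n%:R * sigma2) +
  16 * \sum_(e : upair n) \sum_w (crossing X w e)%:R.
Proof.
have rF : robust (F_lg R a b X) by exact: (F_robust R X b_ge2 ba an).
rewrite or_C0_at => [|c]; last by apply: robust_labels; case: c; [exact: H_robust|].
rewrite big_bool /= !divr1.
have hH : C1 (H_lg R X) * C0_at (H_lg R X) z <= 9 * #|X|%:R * n%:R ^+ 2.
  apply: le_trans (H_C0_at X); rewrite -[X in _ <= X]mul1r; apply: ler_wpM2r.
    by apply: C0_at_ge0; apply: H_robust.
  exact: or_C1.
have hF : C1 (F_lg R a b X) * C0_at (F_lg R a b X) z <= 4 *
  (sigma1 + 'C(n, a)%:R / na * (4 * n%:R * sigma2) + 4 * \sum_(e : upair n) \sum_w (crossing X w e)%:R).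
  by apply: ler_pM; [exact: C1_ge0|exact: C0_at_ge0|exact: F_C1|exact: F_C0_at].
apply: le_trans (lerD hH hF) _.
by rewrite le_eqVlt; apply/orP; left; apply/eqP; ring.
Qed.

End NoVertex.

(** For each of the at most n^2 pairs, summing the indicator over [w] gives |N| when [X] avoids N
    and 0 otherwise, so [bin_avoid] applies pair by pair. *)
Lemma crossing_average x : (0 < x)%N -> (x <= n)%N ->
  'C(n, x)%:R^-1 * \sum_(p : {X : {set 'I_n} | #|X| == x}) \sum_(e : upair n) \sum_w
     (crossing (val p) w e)%:R <= n%:R ^+ 3 / x%:R :> R.
Proof.
move=> x0 xn; have cn : 0 < 'C(n, x)%:R :> R by rewrite ltr0n bin_gt0.
have xp : 0 < x%:R :> R by rewrite ltr0n.
rewrite mulrC ler_pdivrMr // exchange_big /=.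
apply: (@le_trans _ _ (\sum_(e : upair n) (n%:R / x%:R * 'C(n, x)%:R))); last first.
  rewrite sumr_const -[X in X <= _]mulr_natl.
  rewrite (_ : _ ^+ 3 / _ * _ = n%:R ^+ 2 * (n%:R / x%:R * 'C(n, x)%:R)); last first.
    by field; rewrite gt_eqF.
  by rewrite ler_wpM2r ?mulr_ge0 ?invr_ge0 ?ler0n // -natrX ler_nat card_upair.
apply: ler_sum => e _.
rewrite (big_sig_val (fun X : {set 'I_n} => #|X| == x)
  (fun X => \sum_w (crossing X w e)%:R)).
pose N := common e.
have -> : \sum_(X : {set 'I_n} | #|X| == x) \sum_w (crossing X w e)%:R =
   (#|N| * 'C(n - #|N|, x))%N%:R :> R.
  rewrite (eq_bigr (fun X => (N :&: X == set0)%:R * #|N|%:R)) => [|X _].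
    rewrite -mulr_suml natrM mulrC; congr (_ * _).
    have <- : #|~: N| = (n - #|N|)%N by have := cardsC N; rewrite card_ord; lia.
    rewrite -cards_draws -natr_sum; congr _%:R.
    rewrite -sum1_card [LHS]big_mkcond [RHS]big_mkcond; apply: eq_bigr => X _.
    rewrite inE setI_eq0 disjoint_sym disjoints_subset.
    by case: (_ \subset _); case: (_ == x).
  rewrite -natrM -natr_sum /crossing -/N; congr _%:R.
  rewrite -sum1_card [in RHS]big_mkcond big_distrr /=; apply: eq_bigr => w _.
  by case: (_ == _); case: (w \in N).
rewrite mulrAC ler_pdivlMr // -!natrM ler_nat.
have Nn : (#|N| <= n)%N by have := max_card (mem N); rewrite card_ord.
have := @bin_avoid (n - #|N|) #|N| x x0; rewrite subnK //.
by move=> h; rewrite mulnC mulnA.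
Qed.

End TriangleCosts.

Lemma G_C1 (R : realType) n x a b : (x <= n)%N -> C1 (G_lg R n x a b) <= 1.
Proof. by move=> xn; apply: or_C1; rewrite bin_gt0. Qed.

Definition triangle_cost (R : realType) (n x a b : R) : R :=
  x * n ^+ 2 + (a * x) ^+ 2 + (n / a) ^+ 2 * (a * x ^+ 2 +
    n * (b ^+ 2 + (a / b) ^+ 2 * (b + b ^+ 2 / x))).

(** The cost splits into the monomials [p1] to [p6]; in [p6] the sizes [a] and [b] cancel and leave
    n^3/x, the bound of [crossing_average]. The 96 is 16 times 3, from [stage_cost], times 2, from
    comparing n(n-1)/(a(a-1)) with (n/a)^2. *)
Lemma G_C0_le (R : realType) n x a b (d : R) :
  (1 <= x <= n)%N -> (2 <= b <= a)%N -> (a <= n)%N -> 0 < d ->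
  a%:R <= (1 - d) * n%:R -> b%:R <= (1 - d) * a%:R ->
  C0 (G_lg R n x a b) <= (16 + 96 / d ^+ 2) * triangle_cost n%:R x%:R a%:R b%:R.
Proof.
case/andP=> x0 xn /andP[b2 ba] an d0 a_le b_le.
have xp : 0 < x%:R :> R by rewrite ltr0n.
have ap : 0 < a%:R :> R by rewrite ltr0n; lia.
have bp : 0 < b%:R :> R by rewrite ltr0n; lia.
have np : 0 < n%:R :> R by rewrite ltr0n; lia.
have cn : 0 < 'C(n, x)%:R :> R by rewrite ltr0n bin_gt0.
have na : 0 < 'C(n - 2, a - 2)%:R :> R by rewrite ltr0n bin_gt0 leq_sub2r.
have costE : triangle_cost n%:R x%:R a%:R b%:R = x%:R * n%:R ^+ 2 + (x%:R * a%:R) ^+ 2 +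
    x%:R ^+ 2 * (n%:R ^+ 2 / a%:R) + (n%:R / a%:R) ^+ 2 * (n%:R * b%:R ^+ 2) +
    (n%:R / a%:R) ^+ 2 * (n%:R * (a%:R ^+ 2 / b%:R)) + n%:R ^+ 3 / x%:R :> R.
  by rewrite /triangle_cost; field; rewrite !gt_eqF.
pose p1 : R := x%:R * n%:R ^+ 2; pose p2 : R := (x%:R * a%:R) ^+ 2.
pose p3 : R := x%:R ^+ 2 * (n%:R ^+ 2 / a%:R).
pose p4 : R := (n%:R / a%:R) ^+ 2 * (n%:R * b%:R ^+ 2).
pose p5 : R := (n%:R / a%:R) ^+ 2 * (n%:R * (a%:R ^+ 2 / b%:R)).
pose p6 : R := n%:R ^+ 3 / x%:R.
have p1_ge0 : 0 <= p1 by rewrite mulr_ge0 ?sqr_ge0.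
have p2_ge0 : 0 <= p2 by rewrite sqr_ge0.
have p3_ge0 : 0 <= p3 by rewrite mulr_ge0 ?sqr_ge0 // divr_ge0 ?sqr_ge0.
have p4_ge0 : 0 <= p4 by rewrite !mulr_ge0 ?sqr_ge0.
have p5_ge0 : 0 <= p5 by rewrite !mulr_ge0 ?sqr_ge0 ?invr_ge0.
have p6_ge0 : 0 <= p6 by rewrite divr_ge0 ?exprn_ge0.
rewrite costE -/p1 -/p2 -/p3 -/p4 -/p5 -/p6.
have d2 : 0 < d ^+ 2 by rewrite exprn_gt0.
pose q : R := (d ^+ 2)^-1; have q0 : 0 <= q by rewrite invr_ge0 ltW.
rewrite -/q.
apply: C0_le => [|z _].
  by rewrite mulr_ge0 ?addr_ge0 ?mulr_ge0.
have ratio : 'C(n, a)%:R / 'C(n - 2, a - 2)%:R <= 2 * (n%:R / a%:R) ^+ 2 :> R.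
  rewrite ler_pdivrMr //.
  have h : 'C(n, a)%:R * (a%:R * (a - 1)%:R) = n%:R * (n - 1)%:R * 'C(n - 2, a - 2)%:R :> R.
    by rewrite -!natrM bin_diag2 // (leq_trans b2 ba).
  have a1 : a%:R / 2 <= (a - 1)%:R :> R.
    have a2 : 2 <= a%:R :> R by rewrite ler_nat (leq_trans b2 ba).
    by rewrite natrB ?(leq_trans _ ba) 1?ltnW // ; lra.
  have n1 : (n - 1)%:R <= n%:R :> R by rewrite ler_nat leq_subr.
  rewrite -(ler_pM2r (x := a%:R ^+ 2 / 2)) ?divr_gt0 ?exprn_gt0 //.
  rewrite [leRHS](_ : _ = n%:R * n%:R * 'C(n - 2, a - 2)%:R); last by field; rewrite gt_eqF.
  apply: (@le_trans _ _ (n%:R * (n - 1)%:R * 'C(n - 2, a - 2)%:R)); last first.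
    by rewrite ler_wpM2r // ler_wpM2l.
  by rewrite -h ler_wpM2l // expr2 -mulrA ler_wpM2l.
pose U : R := 9 * x%:R * n%:R ^+ 2 + 4 * (3 / d ^+ 2 * ((x%:R * a%:R) ^+ 2 +
    x%:R ^+ 2 * (n%:R ^+ 2 / a%:R))) +
  'C(n, a)%:R / 'C(n - 2, a - 2)%:R * (16 * n%:R * (3 / d ^+ 2 *
    (b%:R ^+ 2 + a%:R ^+ 2 / b%:R))).
rewrite or_C0_at => [|p]; last by apply: robust_labels; exact: (GX_robust R (val p) b2 ba an).
apply: (@le_trans _ _ (\sum_(p : {X : {set 'I_n} | #|X| == x}) 'C(n, x)%:R^-1 *
   (U + 16 * \sum_(e : upair n) \sum_w (crossing z (val p) w e)%:R))).
  apply: ler_sum => p _.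
  have := @GX_C0_at R n z a b (val p) d b2 ba an d0 a_le b_le.
  rewrite (eqP (valP p)) -/U => h.
  apply: ler_pM.
  - by rewrite divr_ge0 ?C1_ge0.
  - by apply: C0_at_ge0; exact: (GX_robust R (val p) b2 ba an).
  - by rewrite -[leRHS]mul1r ler_wpM2r ?invr_ge0 // or_C1.
  - exact: h.
rewrite -mulr_sumr big_split /= sumr_const card_xsets -mulr_sumr mulrDr.
rewrite -[U *+ _]mulr_natl mulrA mulVf ?gt_eqF // mul1r mulrCA.
have := crossing_average R z x0 xn; rewrite -/p6.
set av := _^-1 * _ => hav.
have hU : U <= 9 * p1 + 12 * q * (p2 + p3) + 96 * q * (p4 + p5).
  rewrite /U (_ : 96 * q * (p4 + p5) = 2 * (n%:R / a%:R) ^+ 2 * (16 * n%:R * (3 / d ^+ 2 *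
    (b%:R ^+ 2 + a%:R ^+ 2 / b%:R)))); last by rewrite /q /p4 /p5; ring.
  rewrite (_ : 9 * p1 + 12 * q * (p2 + p3) = 9 * x%:R * n%:R ^+ 2 + 4 * (3 / d ^+ 2 * ((x%:R * a%:R) ^+ 2 +
    x%:R ^+ 2 * (n%:R ^+ 2 / a%:R)))); last by rewrite /q /p1 /p2 /p3; ring.
  rewrite lerD2l ler_wpM2r // !mulr_ge0 ?addr_ge0 ?divr_ge0 ?sqr_ge0 //.
have := mulr_ge0 q0 p1_ge0; have := mulr_ge0 q0 p2_ge0; have := mulr_ge0 q0 p3_ge0.
have := mulr_ge0 q0 p4_ge0; have := mulr_ge0 q0 p5_ge0; have := mulr_ge0 q0 p6_ge0.
nra.
Qed.

(** * Conclusion *)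

Lemma Q_le_learning_graph (R : realType) (I : finType) (f : bfun I) (G : elg R f) :
  learning_graph G -> C1 G <= 1 -> (Q R f <= (8 + 6 * Num.sqrt (C0 G))%:E)%E.
Proof.
move=> lg c1; have [T hT qT] := query_count_bound (C0_ge0 G).
have [|P hP] := @learning_graph_algorithm R I f G lg (C0 G) 1 T ltr01 (lexx _) c1.
  by rewrite mulr1.
by apply: le_trans (Q_le_queries hP) _; rewrite lee_fin.
Qed.

Lemma complexity_le (R : realType) (I : finType) (f : bfun I) (G : elg R f) (c : R) :
  C1 G <= 1 -> C0 G <= c -> complexity G <= Num.sqrt c.
Proof.
move=> c1 c0; rewrite /complexity ler_wsqrtr // -[leRHS]mulr1.
by apply: ler_pM; rewrite ?C0_ge0 ?C1_ge0.
Qed.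

(** Meant for finitely many [n], where any finite bound serves; with these smallest parameters the
    graph is valid as soon as n >= 2. *)
Lemma Q_triangle_small (R : realType) n : (1 <= n)%N ->
  (Q R (triangle n) <= (8 + 6 * Num.sqrt (C0 (G_lg R n 1 2 2)))%:E)%E.
Proof.
move=> n1; have [n2|n2] := leqP 2 n.
  apply: Q_le_learning_graph; last exact: G_C1.
  by apply: proj1; apply: robust_learning_graph; apply: G_robust.
have {n1 n2}-> : n = 1%N by apply/eqP; rewrite eqn_leq n1 andbT -ltnS.
have no_triangle y : triangle 1 y <> Some true.
  case=> /existsP[u /existsP[v /existsP[w /and3P[/adj_neq /eqP[]]]]].
  by rewrite (ord1 u) (ord1 v).
(* Without positive inputs the zero vectors meet the adversary conditions with [A = 0] and [B = 1],
   and [T = 1] suffices since 3 <= 4. *)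
have [] := @adversary_algorithm R (upair 1) unit (triangle 1)
  (fun _ _ _ => 0) (fun _ _ _ => 0) 0 1 ltr01 _ _ _ 1%N.
- by move=> x _; rewrite big1 // => j _; rewrite big1 // => k _; rewrite expr0n.
- by move=> y /no_triangle.
- by move=> x y _ /no_triangle.
- by rewrite mulr0 mul0r addr0 mulr1 -natrX ler_nat.
move=> P hP; apply: le_trans (Q_le_queries hP) _; rewrite lee_fin.
apply: (@le_trans _ _ 8); first by rewrite ler_nat.
by rewrite lerDl mulr_ge0 ?sqrtr_ge0.
Qed.

(** * The rounded parameters in terms of the fourth root of n *)

Section QuarterPowers.
Variables (R : realType) (n : nat).

(** Here n is r^4, [s] is about r^2 and [a] about r^3. All terms of the cost are then O(r^10), and
    the square root r^5 is the power 5/4 of n. *)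
Let r : R := n%:R `^ (4^-1).

Lemma quarter_power k : n%:R `^ (k%:R / 4) = r ^+ k.
Proof. by rewrite mulrC powRrM powR_mulrn ?powR_ge0. Qed.

Lemma quarter_four : r ^+ 4 = n%:R.
Proof. by rewrite -quarter_power divff // powRr1. Qed.

Lemma quarter_sqrt : Num.sqrt n%:R = r ^+ 2 :> R.
Proof. by rewrite -quarter_four (exprM r 2 2) sqrtr_sqr ger0_norm ?sqr_ge0. Qed.

Hypothesis n_ge : (256 <= n)%N.

Let s := Num.truncn (Num.sqrt n%:R : R).
Let a := Num.truncn (n%:R `^ (3%:R / 4%:R) : R).

Lemma quarter_ge4 : 4 <= r.
Proof.
rewrite -(@ler_pXn2r _ 4) ?nnegrE ?powR_ge0 // quarter_four -natrX ler_nat.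
exact: leq_trans n_ge.
Qed.

Lemma s_bounds : s%:R <= r ^+ 2 /\ r ^+ 2 < s%:R + 1.
Proof.
rewrite /s quarter_sqrt; split; first by rewrite truncn_le ?sqr_ge0.
by rewrite natr1 truncnS_gt.
Qed.

Lemma a_bounds : a%:R <= r ^+ 3 /\ r ^+ 3 < a%:R + 1.
Proof.
have r0 : 0 <= r ^+ 3 by rewrite exprn_ge0 // powR_ge0.
rewrite /a quarter_power; split; first by rewrite truncn_le.
by rewrite natr1 truncnS_gt.
Qed.

(** From n >= 256 = 4^4 one gets r >= 4: consecutive powers of r differ by a factor at least 4,
    which leaves the margin [d] = 1/4 even after rounding. *)
Lemma parameters_ok : [/\ (1 <= s <= n)%N, (2 <= s <= a)%N, (a <= n)%N,
  a%:R <= (1 - 4^-1) * n%:R :> R & s%:R <= (1 - 4^-1) * a%:R :> R].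
Proof.
have r4 := quarter_ge4; have [s1 s2] := s_bounds; have [a1 a2] := a_bounds.
have nE := quarter_four.
have r2 : 16 <= r ^+ 2 by nra.
have e3 : r ^+ 3 = r * r ^+ 2 by rewrite exprS.
have e4 : r ^+ 4 = r * r ^+ 3 by rewrite exprS.
have r3 : 4 * r ^+ 2 <= r ^+ 3 by rewrite e3; nra.
have rn : 4 * r ^+ 3 <= n%:R by rewrite -nE e4; nra.
have sR : 2 <= s%:R :> R by lra.
have sn : s%:R <= n%:R :> R by lra.
have sa : s%:R <= a%:R :> R by lra.
have an : a%:R <= n%:R :> R by lra.
rewrite !ler_nat in sR sn sa an.
by split; rewrite ?sR ?sn ?sa ?an ?(leq_trans _ sR) //; lra.
Qed.

(** Rounding down loses at most a factor 2, so n/a and a/s are at most 2r. The first two terms give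
    1 each, and the bracket gives 4 times 1 + 1 + 8, in all 42. *)
Lemma cost_bound : triangle_cost n%:R s%:R a%:R s%:R <= 42 * r ^+ 10.
Proof.
have r4 := quarter_ge4; have [s1 s2] := s_bounds; have [a1 a2] := a_bounds.
have nE := quarter_four.
have r2 : 16 <= r ^+ 2 by nra.
have e3 : r ^+ 3 = r * r ^+ 2 by rewrite exprS.
have r3 : 4 * r ^+ 2 <= r ^+ 3 by rewrite e3; nra.
have r0 : 0 < r by lra.
have sh : r ^+ 2 / 2 <= s%:R by lra.
have ah : r ^+ 3 / 2 <= a%:R by lra.
have s0 : 0 < s%:R :> R by lra.
have a0 : 0 < a%:R :> R by lra.
have na : n%:R / a%:R <= 2 * r.
  rewrite ler_pdivrMr // -nE; apply: (@le_trans _ _ (2 * r * (r ^+ 3 / 2))).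
    by rewrite le_eqVlt; apply/orP; left; apply/eqP; field.
  by rewrite ler_wpM2l // mulr_ge0 // ltW.
have as_ : a%:R / s%:R <= 2 * r.
  rewrite ler_pdivrMr //; apply: (le_trans a1); apply: (@le_trans _ _ (2 * r * (r ^+ 2 / 2))).
    by rewrite le_eqVlt; apply/orP; left; apply/eqP; field.
  by rewrite ler_wpM2l // mulr_ge0 // ltW.
have na2 : (n%:R / a%:R) ^+ 2 <= (2 * r) ^+ 2.
  by rewrite ler_sqr ?nnegrE ?divr_ge0 // ?mulr_ge0 // ltW.
have as2 : (a%:R / s%:R) ^+ 2 <= (2 * r) ^+ 2.
  by rewrite ler_sqr ?nnegrE ?divr_ge0 // ?mulr_ge0 // ltW.
have ss2 : s%:R ^+ 2 <= (r ^+ 2) ^+ 2 by rewrite ler_sqr ?nnegrE ?sqr_ge0.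
have rk k : 0 <= r ^+ k by rewrite exprn_ge0 // ltW.
rewrite /triangle_cost.
have -> : s%:R + s%:R ^+ 2 / s%:R = 2 * s%:R :> R by field; rewrite gt_eqF.
have t1 : s%:R * n%:R ^+ 2 <= r ^+ 10.
  rewrite (_ : r ^+ 10 = r ^+ 2 * n%:R ^+ 2); last by rewrite -nE; ring.
  by rewrite ler_wpM2r ?sqr_ge0.
have t2 : (a%:R * s%:R) ^+ 2 <= r ^+ 10.
  rewrite (_ : r ^+ 10 = (r ^+ 3 * r ^+ 2) ^+ 2); last by ring.
  have h : a%:R * s%:R <= r ^+ 3 * r ^+ 2 by apply: ler_pM.
  by apply: lerXn2r h; rewrite nnegrE; [exact: mulr_ge0 | exact: mulr_ge0 (rk _) (rk _)].
have t3 : a%:R * s%:R ^+ 2 <= r ^+ 8.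
  apply: (@le_trans _ _ (r ^+ 3 * (r ^+ 2) ^+ 2)); first by rewrite ler_pM ?sqr_ge0 ?rk.
  rewrite (_ : r ^+ 8 = r * (r ^+ 3 * (r ^+ 2) ^+ 2)); last by ring.
  by rewrite ler_peMl ?mulr_ge0 ?sqr_ge0 ?rk //; lra.
have t4 : n%:R * s%:R ^+ 2 <= r ^+ 8.
  rewrite (_ : r ^+ 8 = n%:R * (r ^+ 2) ^+ 2); last by rewrite -nE; ring.
  by rewrite ler_wpM2l.
have t5 : n%:R * ((a%:R / s%:R) ^+ 2 * (2 * s%:R)) <= 8 * r ^+ 8.
  rewrite (_ : 8 * r ^+ 8 = n%:R * ((2 * r) ^+ 2 * (2 * r ^+ 2))); last by rewrite -nE; ring.
  by rewrite ler_wpM2l // ler_pM ?sqr_ge0 ?mulr_ge0 // ler_wpM2l.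
have t6 : (n%:R / a%:R) ^+ 2 * (a%:R * s%:R ^+ 2 + n%:R * (s%:R ^+ 2 +
    (a%:R / s%:R) ^+ 2 * (2 * s%:R))) <= (2 * r) ^+ 2 * (10 * r ^+ 8).
  apply: ler_pM; [exact: sqr_ge0 | | exact: na2 | by rewrite mulrDr; lra].
  by rewrite !(sqr_ge0, addr_ge0, mulr_ge0).
have e10 : (2 * r) ^+ 2 * (10 * r ^+ 8) = 40 * r ^+ 10 by ring.
by lra.
Qed.

(** With [d] = 1/4 the constant 16 + 96/d^2 is 1552, and 1552 times 42 is 65184, below the square of
    300. *)
Lemma G_C0_parameters : C0 (G_lg R n s a s) <= (300 * r ^+ 5) ^+ 2.
Proof.
have [sn sa an h1 h2] := parameters_ok.
have d0 : 0 < 4^-1 :> R by rewrite invr_gt0.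
apply: le_trans (G_C0_le sn sa an d0 h1 h2) _.
apply: (@le_trans _ _ ((16 + 96 / 4^-1 ^+ 2) * (42 * r ^+ 10))).
  rewrite ler_wpM2l ?cost_bound // addr_ge0 // divr_ge0 // sqr_ge0 //.
have r10 : 0 <= r ^+ 10 by rewrite exprn_ge0 // powR_ge0.
have -> : (300 * r ^+ 5) ^+ 2 = 300 * 300 * r ^+ 10 by ring.
have -> : 4^-1 ^+ 2 = 16^-1 :> R by field.
by rewrite invrK; lra.
Qed.

End QuarterPowers.

Lemma powR_ge1 (R : realType) n (c : R) : (1 <= n)%N -> 0 <= c -> 1 <= n%:R `^ c.
Proof.
move=> n1 c0; have n1' : 1 <= n%:R :> R by rewrite ler1n.
by have := ler_powR n1' c0; rewrite powRr0.
Qed.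

(** The finitely many values below [m] are added to the constant, which is enough because [g] is at
    least 1. *)
Lemma extend_bound (R : realType) (F g : nat -> R) (c : R) k m :
  0 < c -> (forall n, 0 <= F n) -> (forall n, (k <= n)%N -> 1 <= g n) ->
  (forall n, (m <= n)%N -> F n <= c * g n) ->
  exists2 C : R, 0 < C & forall n, (k <= n)%N -> F n <= C * g n.
Proof.
move=> c0 F0 g1 Fg; pose S := \sum_(i < m) F i.
have S0 : 0 <= S by apply: sumr_ge0 => i _; apply: F0.
exists (c + S) => [|n kn]; first by rewrite ltr_wpDr.
have gn := g1 n kn; have gn0 := le_trans ler01 gn.
have [mn|nm] := leqP m n.
  by apply: le_trans (Fg n mn) _; rewrite ler_wpM2r ?lerDl.
apply: (@le_trans _ _ S).
  rewrite /S (bigD1 (Ordinal nm)) //= lerDl.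
  by apply: sumr_ge0 => i _; apply: F0.
apply: (@le_trans _ _ (c + S)); first by rewrite lerDr ltW.
by rewrite ler_peMr // addr_ge0 // ltW.
Qed.

Theorem theorem5p1 (R : realType) :
  (forall n x a b : nat, (1 <= x <= n)%N -> (2 <= b <= a)%N -> (a <= n)%N ->
     learning_graph (G_lg R n x a b) /\ adaptive (G_lg R n x a b)) /\
  (forall d : R, 0 < d -> exists2 C : R, 0 < C &
     forall n x a b : nat, (1 <= x <= n)%N -> (2 <= b <= a)%N -> (a <= n)%N ->
     a%:R <= (1 - d) * n%:R -> b%:R <= (1 - d) * a%:R ->
     let n' : R := n%:R in let x' : R := x%:R in
     let a' : R := a%:R in let b' : R := b%:R in
     complexity (G_lg R n x a b) <=
       C * Num.sqrt (x' * n' ^+ 2 + (a' * x') ^+ 2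
         + (n' / a') ^+ 2 * (a' * x' ^+ 2
             + n' * (b' ^+ 2 + (a' / b') ^+ 2 * (b' + b' ^+ 2 / x'))))) /\
  (exists2 C : R, 0 < C & forall n : nat, (4 <= n)%N ->
     let s := Num.truncn (Num.sqrt n%:R : R) in
     let a := Num.truncn (n%:R `^ (3%:R / 4%:R) : R) in
     complexity (G_lg R n s a s) <= C * n%:R `^ (5%:R / 4%:R)) /\
  (exists2 C : R, 0 < C & forall n : nat, (1 <= n)%N ->
     (Q R (triangle n) <= (C * n%:R `^ (5%:R / 4%:R))%:E)%E).
Proof.
have valid n x a b : (1 <= x <= n)%N -> (2 <= b <= a)%N -> (a <= n)%N ->
    robust (G_lg R n x a b).
  by move=> /andP[_ xn] /andP[b2 ba] an; exact: (G_robust R xn b2 ba an).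
split; first by move=> n x a b hx hb ha; apply: robust_learning_graph; apply: valid.
split.
  move=> d d0; pose M : R := 16 + 96 / d ^+ 2.
  have M0 : 0 < M by rewrite ltr_pwDl // divr_ge0 // sqr_ge0.
  exists (Num.sqrt M); first by rewrite sqrtr_gt0.
  move=> n x a b hx hb ha h1 h2; cbv zeta.
  rewrite -sqrtrM ?(ltW M0) //; apply: complexity_le; last exact: G_C0_le hx hb ha d0 h1 h2.
  by apply: G_C1; case/andP: hx.
have bound5 n : (256 <= n)%N -> let s := Num.truncn (Num.sqrt n%:R : R) in
    let a := Num.truncn (n%:R `^ (3%:R / 4%:R) : R) in
    C1 (G_lg R n s a s) <= 1 /\
    C0 (G_lg R n s a s) <= (300 * n%:R `^ (5 / 4)) ^+ 2.
  move=> n256 s a; split; last by rewrite quarter_power; exact: G_C0_parameters.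
  by apply: G_C1; have [/andP[]] := @parameters_ok R n n256.
have sqrt5 n : Num.sqrt ((300 * n%:R `^ (5 / 4)) ^+ 2) = 300 * n%:R `^ (5 / 4) :> R.
  by rewrite sqrtr_sqr ger0_norm ?mulr_ge0 ?ler0n ?powR_ge0.
have p1 n : (1 <= n)%N -> 1 <= n%:R `^ (5 / 4) :> R.
  by move=> n1; apply: powR_ge1 => //; rewrite divr_ge0.
split.
  apply: (@extend_bound R (fun n => complexity (G_lg R n (Num.truncn (Num.sqrt n%:R : R))
    (Num.truncn (n%:R `^ (3%:R / 4%:R) : R)) (Num.truncn (Num.sqrt n%:R : R))))
    (fun n => n%:R `^ (5%:R / 4%:R)) 300 4 256).
  - exact: ltr0n.
  - by move=> n; apply: sqrtr_ge0.
  - by move=> n n4; apply: p1; apply: leq_trans n4.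
  - by move=> n n256; have [c1 c0] := bound5 n n256; rewrite -sqrt5; apply: complexity_le.
pose lg_bound n x a b : R := 8 + 6 * Num.sqrt (C0 (G_lg R n x a b)).
(* A real bound on [Q] for every n >= 1; below 256 only its finiteness matters. *)
pose H n : R := if (256 <= n)%N then lg_bound n (Num.truncn (Num.sqrt n%:R : R))
    (Num.truncn (n%:R `^ (3%:R / 4%:R) : R)) (Num.truncn (Num.sqrt n%:R : R))
  else lg_bound n 1%N 2%N 2%N.
have QH n : (1 <= n)%N -> (Q R (triangle n) <= (H n)%:E)%E.
  move=> n1; rewrite /H; case: ifPn => [n256|_]; last exact: Q_triangle_small.
  have [c1 _] := bound5 n n256; have [sn sa an _ _] := @parameters_ok R n n256.
  have [lg _] := robust_learning_graph (valid _ _ _ _ sn sa an).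
  exact: Q_le_learning_graph lg c1.
(* 1808 is 8 + 6 times 300; the 8 is absorbed because the power of n is at least 1. *)
have [||n n256|C C0 hC] :=
  @extend_bound R H (fun n => n%:R `^ (5%:R / 4%:R)) 1808 1 256 (ltr0n _ _).
- by move=> n; rewrite /H; case: ifP => _; rewrite /lg_bound addr_ge0 // mulr_ge0 // sqrtr_ge0.
- by move=> n; apply: p1.
- have [c1 c0] := bound5 n n256; rewrite /H n256 /lg_bound.
  have := p1 n (leq_trans (isT : (1 <= 256)%N) n256).
  have := ler_wsqrtr c0; rewrite sqrt5; move: (Num.sqrt _) (n%:R `^ _) => c p.
  by clear; lra.
- exists C => // n n1; apply: le_trans (QH n n1) _; rewrite lee_fin.
  exact: hC.
Qed.
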